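(* Let $G$ be a connected Lie group with Lie algebra $\mathfrak g$ and let $h\in\mathfrak g$ be an Euler element such that $\tau_h^{\mathfrak g}=e^{\pi i\operatorname{ad}h}$ integrates to an involutive automorphism $\tau_h$ of $G$. Let $M=G/H$ be a homogeneous space, let $W\subseteq M$ be a non-empty open subset invariant under $\exp(\mathbb R h)$, let $(U,\mathcal H)$ be an antiunitary representation of $G_{\tau_h}=G\rtimes\{\mathrm{id}_G,\tau_h\}$, and let $\mathsf V=\mathsf V(h,U)$. Let $\mathsf H_M^{\max}$ and $\mathsf H_M^{\min}$ be the maximal and minimal nets on open subsets of $M$ associated to $(U,M,W)$, and put $$S_W=\{g\in G: g.W\subseteq W\},\qquad S_{\mathsf V}=\{g\in G: U(g)\mathsf V\subseteq\mathsf V\}.$$ Then: (a) The nets $\mathsf H_M^{\max}$ and $\mathsf H_M^{\min}$ satisfy (Iso) and (Cov). (b) The set of all open subsets $\mathcal O\subseteq M$ for which $\mathsf H_M^{\max}(\mathcal O)$ is cyclic is $G$-invariant. (c) The following are equivalent: (i) $S_W\subseteq S_{\mathsf V}$; (ii) $\mathsf H_M^{\max}(W)=\mathsf V$; (iii) $\mathsf H_M^{\max}(W)$ is standard; (iv) $\mathsf H_M^{\max}(W)$ is cyclic; (v) $\mathsf H_M^{\min}(W)=\mathsf V$; (vi) $\mathsf H_M^{\min}(W)$ is standard; (vii) $\mathsf H_M^{\min}(W)$ is separating.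
   Context: An Euler element is $h\in\mathfrak g$ with $\operatorname{ad}h$ non-zero, diagonalizable, and $\operatorname{Spec}(\operatorname{ad}h)\subseteq\{-1,0,1\}$. An antiunitary representation of $G_{\tau_h}$ is a strongly continuous homomorphism $U$ into the group of unitary or antiunitary operators on a complex Hilbert space $\mathcal H$ with $U(G)$ unitary and $J:=U(\tau_h)$ antiunitary. For $x\in\mathfrak g$, $\partial U(x)$ denotes the infinitesimal generator, $U(\exp tx)=e^{t\,\partial U(x)}$. A closed real subspace $\mathsf V\subseteq\mathcal H$ is cyclic if $\mathsf V+i\mathsf V$ is dense, separating if $\mathsf V\cap i\mathsf V=\{0\}$, standard if both. The standard subspace $\mathsf V(h,U)$ is $\operatorname{Fix}(J\Delta^{1/2})=\{\xi\in\mathcal D(\Delta^{1/2}):J\Delta^{1/2}\xi=\xi\}$ with $\Delta=e^{2\pi i\,\partial U(h)}$. For open $\mathcal O\subseteq M$: $$\mathsf H_M^{\max}(\mathcal O):=\bigcap_{g\in G,\ \mathcal O\subseteq gW}U(g)\mathsf V,\qquad \mathsf H_M^{\min}(\mathcal O):=\overline{\sum_{g\in G,\ gW\subseteq\mathcal O}U(g)\mathsf V},$$ where the empty intersection is $\mathcal H$ and the empty sum is $\{0\}$. (Iso): $\mathcal O_1\subseteq\mathcal O_2$ implies $\mathsf H(\mathcal O_1)\subseteq\mathsf H(\mathcal O_2)$. (Cov): $U(g)\mathsf H(\mathcal O)=\mathsf H(g\mathcal O)$ for $g\in G$. *)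

(* Defs.v *)
From HB Require Import structures.
From mathcomp Require Import all_boot all_order all_algebra complex.
From mathcomp Require Import all_classical all_reals all_analysis.

Import Order.TTheory GRing.Theory Num.Theory.
Import numFieldNormedType.Exports.

Set Implicit Arguments.
Unset Strict Implicit.
Unset Printing Implicit Defensive.

Local Open Scope classical_set_scope.
Local Open Scope complex_scope.
Local Open Scope ring_scope.

(* C^k on an open set D; since all spaces in use are finite-dimensional,
   continuity of the iterated directional derivatives is enough. *)
Fixpoint Ck_on (R : realType) (E F : normedModType R) (k : nat) (D : set E)
    (f : E -> F) : Prop :=
  (forall x, D x -> {for x, continuous f}) /\
  (if k is k'.+1 then
     forall v, (forall x, D x -> derivable f x v) /\
               Ck_on k' D (fun x => 'D_v f x)
   else True).

Definition smooth_on (R : realType) (E F : normedModType R) (D : set E)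
    (f : E -> F) : Prop := forall k, Ck_on k D f.

Record chart (E M : Type) := Chart {
  chart_dom : set M;
  chart_fun : M -> E;
  chart_inv : E -> M }.

Definition chart_codom (E M : Type) (c : chart E M) : set E :=
  chart_fun c @` chart_dom c.

(* Values of chart_fun and chart_inv outside these sets are irrelevant. *)
Definition is_chart (E M : topologicalType) (c : chart E M) : Prop :=
  [/\ open (chart_dom c), open (chart_codom c),
      (forall p, chart_dom c p -> chart_inv c (chart_fun c p) = p),
      (forall p, chart_dom c p -> {for p, continuous (chart_fun c)}) &
      (forall x, chart_codom c x -> {for x, continuous (chart_inv c)})].

Definition prod_chart (E M F N : Type) (c : chart E M) (d : chart F N) :
    chart (E * F)%type (M * N)%type :=
  Chart (chart_dom c `*` chart_dom d)
        (fun p => (chart_fun c p.1, chart_fun d p.2))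
        (fun x => (chart_inv c x.1, chart_inv d x.2)).

(* An atlas is given as a family of charts indexed by a type (in practice by
   the points of the manifold). *)
Definition smooth_map (R : realType) (E F : normedModType R)
    (M N : topologicalType) (I J : Type) (c : I -> chart E M)
    (d : J -> chart F N) (f : M -> N) : Prop :=
  continuous f /\
  forall i j,
    smooth_on
      [set x | chart_codom (c i) x /\ chart_dom (d j) (f (chart_inv (c i) x))]
      (fun x => chart_fun (d j) (f (chart_inv (c i) x))).

(* lie_chart p is a distinguished chart around p, so that smoothness of the
   identity says that the charts form a smooth atlas.  Second countability is
   not required separately: it is automatic for connected Lie groups. *)
HB.mixin Record isLieGroup (R : realType) (n : nat) (G : Type)
    of Group G & Topological G := {
  lie_chart : G -> chart 'rV[R]_n G;
  lie_chartP : forall p : G, is_chart (lie_chart p);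
  lie_chart_center : forall p : G, chart_dom (lie_chart p) p;
  lie_atlas : smooth_map lie_chart lie_chart (fun x : G => x);
  lie_hausdorff : hausdorff_space G;
  lie_mulg_smooth :
    smooth_map (fun pq : G * G => prod_chart (lie_chart pq.1) (lie_chart pq.2))
               lie_chart (fun x : G * G => (x.1 * x.2)%g);
  lie_invg_smooth : smooth_map lie_chart lie_chart (fun x : G => (x^-1)%g)
}.

#[short(type="lieGroupType")]
HB.structure Definition LieGroup (R : realType) (n : nat) :=
  {G of isLieGroup R n G & Group G & Topological G}.

Section LieAlgebra.
Context {R : realType} {n : nat} {G : lieGroupType R n}.

Let c1 := lie_chart (1%g : G).

(* The Lie algebra is the tangent space of G at 1, identified with 'rV[R]_n by
   the distinguished chart at 1. *)

(* Tangent map at 1 of a smooth map f : G -> G with f 1 = 1. *)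
Definition tangent1 (f : G -> G) (y : 'rV[R]_n) : 'rV[R]_n :=
  'D_y (fun x => chart_fun c1 (f (chart_inv c1 x))) (chart_fun c1 1%g).

Definition Ad (g : G) : 'rV[R]_n -> 'rV[R]_n :=
  tangent1 (fun x => g * x * g^-1)%g.

(* ad is the tangent map of Ad at 1; the Lie bracket is [x, y] = ad x y. *)
Definition ad (x y : 'rV[R]_n) : 'rV[R]_n :=
  'D_x (fun z => Ad (chart_inv c1 z) y) (chart_fun c1 1%g).

(* Row-vector convention: y *m ad_mx x = ad x y. *)
Definition ad_mx (x : 'rV[R]_n) : 'M[R]_n := lin1_mx (ad x).

Definition euler_element (h : 'rV[R]_n) : Prop :=
  [/\ ad_mx h != 0, diagonalizable (ad_mx h) &
      forall a : R, eigenvalue (ad_mx h) a -> a \in [:: -1; 0; 1]].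

Definition one_parameter_group (gamma : R -> G) (x : 'rV[R]_n) : Prop :=
  [/\ continuous gamma, forall s t, gamma (s + t) = (gamma s * gamma t)%g &
      is_derive (0 : R) (1 : R) (fun t => chart_fun c1 (gamma t)) x].

(* The one-parameter group with initial velocity x exists and is unique, so
   that the default value 1 is never used. *)
Definition lie_exp (x : 'rV[R]_n) : G :=
  xget 1%g [set gamma 1 | gamma in [set gamma | one_parameter_group gamma x]].

Definition involutive_lie_automorphism (tau : G -> G) : Prop :=
  [/\ {morph tau : x y / (x * y)%g}, involutive tau &
      smooth_map (@lie_chart R n G) (@lie_chart R n G) tau].

End LieAlgebra.

Definition is_mx_exp (K : numFieldType) (n : nat) (A B : 'M[K]_n) : Prop :=
  [series k`!%:R^-1 *: A ^+ k]_k @ \oo --> B.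

(* The tangent map of tau at 1 is (the real form of) e^{pi i ad h}, which is
   computed in the complexification. *)
Definition integrates_tau_h (R : realType) (n : nat) (G : lieGroupType R n)
    (h : 'rV[R]_n) (tau : G -> G) : Prop :=
  is_mx_exp (('i * pi%:C) *: map_mx (real_complex R) (@ad_mx R n G h))
            (map_mx (real_complex R) (lin1_mx (tangent1 tau))).

Record closed_subgroup (R : realType) (n : nat) (G : lieGroupType R n) :=
  ClosedSubgroup {
    csub : set G;
    csub_closed : closed csub;
    csub1 : csub 1%g;
    csubM : forall x y, csub x -> csub y -> csub (x * y)%g;
    csubV : forall x, csub x -> csub (x^-1)%g }.

Section Homogeneous.
Local Open Scope quotient_scope.
Context {R : realType} {n : nat} {G : lieGroupType R n}.
Variable H : closed_subgroup G.

Definition coset_rel (x y : G) : bool := `[< csub H (x^-1 * y)%g >].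

Lemma coset_rel_refl : reflexive coset_rel.
Proof. by move=> x; apply/asboolP; rewrite mulVg; exact: csub1. Qed.

Lemma coset_rel_sym : symmetric coset_rel.
Proof.
have sub x y : coset_rel x y -> coset_rel y x.
  by move=> /asboolP /csubV Hyx; apply/asboolP; move: Hyx; rewrite invgM invgK.
by move=> x y; apply/idP/idP; exact: sub.
Qed.

Lemma coset_rel_trans : transitive coset_rel.
Proof.
move=> y x z /asboolP Hxy /asboolP Hyz; apply/asboolP.
by move: (csubM Hxy Hyz); rewrite -mulgA (mulgA y) mulgV mul1g.
Qed.

Definition coset_equiv : equiv_rel G :=
  EquivRel coset_rel coset_rel_refl coset_rel_sym coset_rel_trans.

Definition coset_space : topologicalType :=
  quotient_topology {eq_quot coset_equiv}.

Definition coset_act (g : G) (m : coset_space) : coset_space :=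
  \pi_coset_space (g * repr m)%g.

Definition translate (g : G) (A : set coset_space) : set coset_space :=
  coset_act g @` A.

End Homogeneous.

(* hdot is linear in its first argument and conjugate-linear in the second. *)
HB.mixin Record isHilbert (R : realType) X of CompleteNormedModule R[i] X := {
  hdot : X -> X -> R[i];
  hdot_linear : forall (a : R[i]) (x y z : X),
    hdot (a *: x + y) z = a * hdot x z + hdot y z;
  hdot_conj : forall x y : X, hdot x y = (hdot y x)^*;
  hdot_norm : forall x : X, hdot x x = `|x| ^+ 2
}.

#[short(type="hilbertType")]
HB.structure Definition Hilbert (R : realType) :=
  {X of isHilbert R X & CompleteNormedModule R[i] X}.

Section HilbertSpace.
Context {R : realType} {X : hilbertType R}.

Definition unitary_op (u : X -> X) : Prop :=
  [/\ forall (a : R[i]) x y, u (a *: x + y) = a *: u x + u y,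
      forall y, exists x, u x = y &
      forall x y, hdot (u x) (u y) = hdot x y].

Definition antiunitary_op (u : X -> X) : Prop :=
  [/\ forall (a : R[i]) x y, u (a *: x + y) = a^* *: u x + u y,
      forall y, exists x, u x = y &
      forall x y, hdot (u x) (u y) = (hdot x y)^*].

Definition orthogonal_projection (p : X -> X) : Prop :=
  [/\ forall (a : R[i]) x y, p (a *: x + y) = a *: p x + p y,
      forall x, p (p x) = p x &
      forall x y, hdot (p x) y = hdot x (p y)].

(* Projection-valued Borel measures on R.  Countable additivity is that of all
   the scalar measures pvm_meas x = <E(.) x, x>; together with projection
   values it implies E(A `&` B) = E(A) E(B). *)
Record pvm := Pvm {
  pvm_proj : set (measurableTypeR R) -> X -> X;
  pvm_meas : X -> {measure set (measurableTypeR R) -> \bar R};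
  pvm_projP : forall B, measurable B -> orthogonal_projection (pvm_proj B);
  pvm_projT : forall x, pvm_proj setT x = x;
  pvm_measE : forall x B, measurable B ->
    pvm_meas x B = (complex.Re (hdot (pvm_proj B x) x))%:E }.

(* Partially defined operators are represented by their graphs. *)
Definition operator : Type := X -> X -> Prop.

Definition pvm_dom (E : pvm) (f : R -> R) (x : X) : Prop :=
  (\int[pvm_meas E x]_t ((f t) ^+ 2)%:E < +oo)%E.

(* The graph of the selfadjoint operator \int f dE, f a real Borel function:
   <T x, z> = \int f d<E x, z> for all z in the (dense) domain, where the
   complex measure <E x, z> is expanded by polarization. *)
Definition pvm_int (E : pvm) (f : R -> R) : operator := fun x y =>
  pvm_dom E f x /\
  forall z, pvm_dom E f z ->
    hdot y z = 4%:R^-1 *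
      \sum_(k < 4) 'i ^+ k *
        (\int[pvm_meas E (x + 'i ^+ k *: z)]_t f t)%:C.

(* E is the spectral measure of A, i.e. A = \int t dE(t). *)
Definition spectral_measure (A : operator) (E : pvm) : Prop :=
  forall x y, A x y <-> pvm_int E id x y.

(* f(A) for a selfadjoint operator A and a Borel function f; the spectral
   measure E of such an A exists and is unique. *)
Definition fun_calc (A : operator) (f : R -> R) : operator := fun x y =>
  exists2 E, spectral_measure A E & pvm_int E f x y.

Definition generator (T : R -> X -> X) : operator := fun x y =>
  (t^-1)%:C *: (T t x - x) @[t --> (0 : R)^'] --> y.

Definition scale_op (a : R[i]) (A : operator) : operator := fun x y =>
  exists2 z, A x z & y = a *: z.

Definition real_subspace (V : set X) : Prop :=
  [/\ V 0, forall x y, V x -> V y -> V (x + y) &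
      forall (r : R) x, V x -> V (r%:C *: x)].

Definition cyclic (V : set X) : Prop :=
  dense [set x + 'i *: y | x in V & y in V].

Definition separating (V : set X) : Prop :=
  V `&` [set 'i *: x | x in V] = [set 0].

Definition standard (V : set X) : Prop :=
  [/\ closed V, real_subspace V, cyclic V & separating V].

(* For real subspaces F i; the value is {0} if P is empty. *)
Definition subspace_sum (I : Type) (P : set I) (F : I -> set X) : set X :=
  [set \sum_(x <- s) x | s in
    [set s : seq X | forall x, x \in s -> exists2 i, P i & F i x]].

End HilbertSpace.

Arguments pvm {R} X.
Arguments operator {R} X.

Section Nets.
Context {R : realType} {n : nat} {G : lieGroupType R n} {X : hilbertType R}.

(* G_tau = G x| {id, tau} on the topological space G * bool, where true stands
   for tau. *)
Definition semidirect_mul (tau : G -> G) (x y : G * bool) : G * bool :=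
  ((x.1 * (if x.2 then tau y.1 else y.1))%g, x.2 (+) y.2).

Definition antiunitary_rep (tau : G -> G) (U : G * bool -> X -> X) : Prop :=
  [/\ forall x, unitary_op (U x) \/ antiunitary_op (U x),
      forall x y v, U (semidirect_mul tau x y) v = U x (U y v),
      forall v, continuous (fun x => U x v),
      forall g, unitary_op (U (g, false)) &
      antiunitary_op (U (1%g, true))].

Variable U : G * bool -> X -> X.

Definition dU (x : 'rV[R]_n) : operator X :=
  generator (fun t => U (lie_exp (t *: x), false)).

(* Delta = e^{2 pi i dU(h)} as a function of the selfadjoint operator
   i dU(h). *)
Definition modular_op (h : 'rV[R]_n) : operator X :=
  fun_calc (scale_op 'i (dU h)) (fun t => expR (2 * pi * t)).

Definition sqrt_modular_op (h : 'rV[R]_n) : operator X :=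
  fun_calc (modular_op h) Num.sqrt.

(* Fix(J Delta^{1/2}), with J = U (1, true) *)
Definition std_subspace (h : 'rV[R]_n) : set X :=
  [set v | exists2 w, sqrt_modular_op h v w & U (1%g, true) w = v].

Variable H : closed_subgroup G.
Notation M := (coset_space H).
Variables (V : set X) (W : set M).

Definition Hmax (O : set M) : set X :=
  \bigcap_(g in [set g | O `<=` translate g W]) (U (g, false) @` V).

Definition Hmin (O : set M) : set X :=
  closure (subspace_sum [set g | translate g W `<=` O]
                        (fun g => U (g, false) @` V)).

Definition isotone (N : set M -> set X) : Prop :=
  forall O1 O2, open O1 -> open O2 -> O1 `<=` O2 -> N O1 `<=` N O2.

Definition covariant (N : set M -> set X) : Prop :=
  forall g O, open O -> U (g, false) @` N O = N (translate g O).

Definition S_W : set G := [set g | translate g W `<=` W].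

Definition S_V : set G := [set g | U (g, false) @` V `<=` V].

End Nets.

(* Main.v *)
(* Parts (a) and (b) are formal, and in (c) each of the two nets gives W the
   space V if and only if S_W is contained in S_V.  Since Hmax(W) is contained
   in V and Hmin(W) contains V, it remains to see that a closed real subspace K
   invariant under U(exp(R h)) equals V if it is contained in V and cyclic, or
   contains V and is separating.

   Let d = dU(h), let E be the spectral measure of i d and E_n = E([-n, n]).
   The range of E_n consists of the x with |d^k x| <= n^k |x| for all k.  As this
   does not involve the complex structure, E_n commutes with the reflection at
   K, so that E_n maps K into K.  Moreover J E(B) J = E(-B), so on the range of
   E_n the operator S = J Delta^(1/2) is a bounded antilinear involution and
   every vector there is v + i w with v, w in V.  If K is contained in V and
   k_j + i l_j converges to v in V, then applying E_n and S E_n shows that E_n k_j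
   converges to E_n v, so that E_n v is in K; now let n grow.  If K contains V
   and k is in K, then E_n k = v + i w with v, w in V, and i w lies in the
   intersection of K and i K, which is 0; so E_n k is in V.

   J commutes with U(exp(t h)) because tau_h fixes exp(t h): ad h kills h, so
   e^(pi i ad h) fixes h, and one-parameter groups are unique. *)

Require Import Defs.
From HB Require Import structures.
From mathcomp Require Import all_boot all_order all_algebra complex.
From mathcomp Require Import all_classical all_reals all_analysis.
From mathcomp Require Import measurable_realfun.
From mathcomp Require Import ring lra.

Import Order.TTheory GRing.Theory Num.Theory.
Import numFieldNormedType.Exports.

Set Implicit Arguments.
Unset Strict Implicit.
Unset Printing Implicit Defensive.

Local Open Scope classical_set_scope.
Local Open Scope complex_scope.
Local Open Scope ring_scope.

(** * Hilbert spaces as real inner product spaces *)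

(** The group t -> U(exp(t h)) is given only as a strongly continuous unitary group, so the spectral
    theorem for its generator d is proved on the way, existence as well as uniqueness: [fun_calc]
    quantifies existentially over spectral measures, and uniqueness is what makes Delta^(1/2) the
    integral of exp(pi t) against one fixed E. The construction stays with bounded operators: (1 -
    d)^-1 and (1 + d)^-1 exist because a bounded solution of g' = g or g' = - g on the line
    vanishes, and E(]-oo, l]) projects onto the part where (A - l)(1 + A^2)^-1, with A = i d, is
    nonpositive; a square root of its square separates that part. Uniqueness rests on the same
    growth condition on iterates that frees the E_n from the complex structure. Operators are
    treated as real-linear, because J and the projection onto K are no more than that. The
    invariance of both subspaces under U(exp(R h)) is (Cov) applied to exp(t h) W = W. On the group
    side, smoothness speaks of iterated directional derivatives, so total differentiability is
    derived before any chain rule. *)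

Section RealHilbert.
Context {R : realType} {X : hilbertType R}.
Implicit Types x y z : X.

(* The complex Hilbert space is treated as a real one, with multiplication by
   'i as the operator [ii]. *)
Definition ip x y : R := complex.Re (hdot x y).
Definition rs (r : R) x : X := r%:C *: x.
Definition ii x : X := 'i *: x.
Definition nm x : R := Num.sqrt (ip x x).

Lemma hdotDl x y z : hdot (x + y) z = hdot x z + hdot y z.
Proof. by have := hdot_linear 1 x y z; rewrite scale1r mul1r. Qed.

Lemma hdot0l z : hdot (0 : X) z = 0.
Proof. by apply: (addIr (hdot 0 z)); rewrite -hdotDl !add0r. Qed.

Lemma hdotZl a x z : hdot (a *: x) z = a * hdot x z.
Proof. by have := hdot_linear a x 0 z; rewrite !addr0 hdot0l addr0. Qed.

Lemma Re_conj (z : R[i]) : complex.Re (Num.conj z) = complex.Re z.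
Proof. by case: z. Qed.

Lemma ipC x y : ip x y = ip y x.
Proof. by rewrite /ip hdot_conj Re_conj. Qed.

Lemma ipDl x y z : ip (x + y) z = ip x z + ip y z.
Proof. by rewrite /ip hdotDl; case: (hdot x z); case: (hdot y z). Qed.

Lemma ipDr x y z : ip x (y + z) = ip x y + ip x z.
Proof. by rewrite !(ipC x) ipDl. Qed.

Lemma ipZl r x y : ip (rs r x) y = r * ip x y.
Proof. by rewrite /ip /rs hdotZl; case: (hdot x y) => a b /=; rewrite mul0r subr0. Qed.

Lemma ipZr r x y : ip x (rs r y) = r * ip x y.
Proof. by rewrite ipC ipZl ipC. Qed.

Lemma rsN1 x : rs (-1) x = - x.
Proof. by rewrite /rs rmorphN1 scaleN1r. Qed.

Lemma ipNl x y : ip (- x) y = - ip x y.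
Proof. by rewrite -rsN1 ipZl mulN1r. Qed.

Lemma ipNr x y : ip x (- y) = - ip x y.
Proof. by rewrite ipC ipNl ipC. Qed.

Lemma ip0l x : ip 0 x = 0. Proof. by rewrite /ip hdot0l. Qed.
Lemma ip0r x : ip x 0 = 0. Proof. by rewrite ipC ip0l. Qed.

Lemma hdotii x y : hdot (ii x) y = 'i * hdot x y.
Proof. by rewrite hdotZl. Qed.

Lemma hdotr_ii x y : hdot x (ii y) = - ('i * hdot x y).
Proof.
by rewrite hdot_conj hdotii rmorphM /= conjCi mulNr (hdot_conj x y).
Qed.

Lemma Re_imul (z : R[i]) : complex.Re ('i * z) = - complex.Im z.
Proof. by rewrite -complexiE; case: z => a b /=; rewrite mul0r mul1r sub0r. Qed.

Lemma ReN (z : R[i]) : complex.Re (- z) = - complex.Re z.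
Proof. by case: z. Qed.

Lemma ReD (z w : R[i]) : complex.Re (z + w) = complex.Re z + complex.Re w.
Proof. by case: z; case: w. Qed.

Lemma ip_iir x y : ip x (ii y) = complex.Im (hdot x y).
Proof. by rewrite /ip hdotr_ii ReN Re_imul opprK. Qed.

Lemma ip_ii x y : ip (ii x) (ii y) = ip x y.
Proof.
by rewrite {1}/ip hdotii hdotr_ii mulrN mulrA -expr2 sqrCi mulN1r opprK.
Qed.

Lemma iiK x : ii (ii x) = - x.
Proof. by rewrite /ii scalerA -expr2 sqrCi scaleN1r. Qed.

Lemma ip_iil x y : ip (ii x) y = - ip x (ii y).
Proof. by rewrite -[LHS]ip_ii iiK ipNl. Qed.

Lemma hdotE x y : hdot x y = (ip x y)%:C + 'i * (ip x (ii y))%:C.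
Proof. by rewrite ip_iir /ip -complexiE -complexE. Qed.

Lemma normE x : `|x| = (nm x)%:C.
Proof.
have h : hdot x x = (ip x x)%:C.
  have : ip x (ii x) = 0.
    by have := ip_iil x x; rewrite ipC; lra.
  by rewrite hdotE => ->; rewrite mulr0 addr0.
have := hdot_norm x; rewrite h => h2.
have [r hr] : exists r : R, `|x| = r%:C.
  have /ger0_Im : 0 <= `|x| by [].
  by case: (`|x|) => a b /= ->; exists a.
have r0 : 0 <= r by rewrite -ler0c -hr.
rewrite hr /nm; congr (_%:C); apply/eqP; rewrite -(eqrXn2 (n := 2)) ?sqrtr_ge0 //.
rewrite hr -rmorphXn /= in h2; case: h2 => h2.
by rewrite h2 sqr_sqrtr ?sqr_ge0.
Qed.

Lemma ip_ge0 x : 0 <= ip x x.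
Proof.
have := hdot_norm x; rewrite normE -rmorphXn /= hdotE => /(congr1 (@complex.Re R)) /=.
rewrite !(mul0r, mulr0) !subr0 addr0 => ->; exact: sqr_ge0.
Qed.

Lemma nm_ge0 x : 0 <= nm x. Proof. exact: sqrtr_ge0. Qed.
Lemma nm_sq x : nm x ^+ 2 = ip x x.
Proof. by rewrite sqr_sqrtr ?ip_ge0. Qed.

Lemma nm_eq0 x : nm x = 0 -> x = 0.
Proof. by move=> h; apply/eqP; rewrite -normr_eq0 normE h. Qed.

Lemma ip_eq0 x : ip x x = 0 -> x = 0.
Proof. by move=> h; apply: nm_eq0; rewrite /nm h sqrtr0. Qed.

Lemma ip_le0 x : ip x x <= 0 -> x = 0.
Proof. by move=> h; apply: ip_eq0; apply/eqP; rewrite eq_le h ip_ge0. Qed.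

Lemma ipext x y : (forall z, ip x z = ip y z) -> x = y.
Proof.
move=> h; apply/eqP; rewrite -subr_eq0; apply/eqP/ip_eq0.
by rewrite ipDl ipNl h subrr.
Qed.

Lemma rsD r x y : rs r (x + y) = rs r x + rs r y. Proof. exact: scalerDr. Qed.
Lemma rsA r s x : rs r (rs s x) = rs (r * s) x.
Proof. by rewrite /rs scalerA -rmorphM. Qed.
Lemma rs1 x : rs 1 x = x. Proof. exact: scale1r. Qed.
Lemma rs0 x : rs 0 x = 0. Proof. exact: scale0r. Qed.
Lemma rsN r x : rs r (- x) = - rs r x. Proof. exact: scalerN. Qed.
Lemma rsr0 r : rs r 0 = 0. Proof. exact: scaler0. Qed.
Lemma iiD x y : ii (x + y) = ii x + ii y. Proof. exact: scalerDr. Qed.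
Lemma iiZ r x : ii (rs r x) = rs r (ii x).
Proof. by rewrite /ii /rs !scalerA mulrC. Qed.
Lemma iiN x : ii (- x) = - ii x. Proof. exact: scalerN. Qed.
Lemma nm0 : nm 0 = 0. Proof. by rewrite /nm ip0l sqrtr0. Qed.
Lemma nmN x : nm (- x) = nm x. Proof. by rewrite /nm ipNl ipNr opprK. Qed.
Lemma nmB x y : nm (x - y) = nm (y - x). Proof. by rewrite -nmN opprB. Qed.
Lemma nmD x y : nm (x + y) <= nm x + nm y.
Proof. by have := ler_normD x y; rewrite !normE -rmorphD lecR. Qed.
Lemma nmZ r x : nm (rs r x) = `|r| * nm x.
Proof. by rewrite /nm ipZl ipZr mulrA -expr2 sqrtrM ?sqr_ge0// sqrtr_sqr. Qed.
Lemma nm_ii x : nm (ii x) = nm x. Proof. by rewrite /nm ip_ii. Qed.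

Lemma nm_triangle x y z : nm (x - z) <= nm (x - y) + nm (y - z).
Proof. by have := nmD (x - y) (y - z); rewrite addrA subrK. Qed.

Lemma le_nm x y : (nm x <= nm y) = (ip x x <= ip y y).
Proof. by rewrite -!nm_sq ler_sqr ?nnegrE ?nm_ge0. Qed.

Lemma CS_sq x y : ip x y ^+ 2 <= ip x x * ip y y.
Proof.
have [->|/eqP y0] := eqVneq y 0; first by rewrite !ip0r expr0n mulr0.
have yy : 0 < ip y y.
  by rewrite lt_def ip_ge0 andbT; apply/eqP => /ip_eq0.
(* This vector is |y|^2 times the component of x orthogonal to y; the scaling avoids a division. *)
have := ip_ge0 (rs (ip y y) x - rs (ip x y) y).
rewrite !(ipDl, ipDr, ipNl, ipNr, ipZl, ipZr) (ipC y x) => h.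
have {}h : 0 <= ip y y * (ip x x * ip y y - ip x y ^+ 2) by nra.
by rewrite -subr_ge0; rewrite pmulr_rge0 in h.
Qed.

Lemma CS x y : `|ip x y| <= nm x * nm y.
Proof.
rewrite -ler_sqr ?nnegrE ?mulr_ge0 ?nm_ge0// exprMn !nm_sq real_normK ?num_real//.
exact: CS_sq.
Qed.

Lemma CS' x y : ip x y <= nm x * nm y.
Proof. exact: le_trans (ler_norm _) (CS x y). Qed.

Lemma ip_subZ q t k :
  ip (q - rs t k) (q - rs t k) = ip q q - 2 * t * ip q k + t ^+ 2 * ip k k.
Proof. rewrite !(ipDl, ipDr, ipNl, ipNr, ipZl, ipZr) (ipC k q); ring. Qed.

(** Norm estimates for vector-valued functions thus follow from the scalar mean value theorem,
    applied to the pairing with each y. *)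
Lemma nm_bound x c : 0 <= c -> (forall y, ip x y <= c * nm y) -> nm x <= c.
Proof.
move=> c0 /(_ x); rewrite -nm_sq expr2.
have [->|n0] := eqVneq (nm x) 0; first by rewrite mul0r.
by rewrite ler_pM2r // lt_def n0 nm_ge0.
Qed.

Section Cvg.
Context {T : Type} {F : set_system T}.

(** The norm of [X] is valued in [R[i]], hence so are the radii of balls. A positive element of
    [R[i]] is real, which reduces every limit to the real norm [nm]. *)
Lemma cvg_nmP (FF : Filter F) (u : T -> X) x :
  u @ F --> x <-> forall e : R, 0 < e -> \forall t \near F, nm (u t - x) < e.
Proof.
split=> [/cvgrPdist_lt h e e0|h].
  have e0' : 0 < e%:C by rewrite ltcR.
  have := h _ e0'; apply: filterS => t.
  by rewrite normE ltcR nmB.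
apply/cvgrPdist_lt => e e0.
have re : e = (complex.Re e)%:C by rewrite RRe_real // realE ltW.
have e0' : 0 < complex.Re e by rewrite -ltcR -re.
have := h _ e0'; apply: filterS => t.
by rewrite re normE ltcR nmB.
Qed.

Lemma cvg_nm0P (FF : Filter F) (u : T -> X) x :
  u @ F --> x <-> nm (u t - x) @[t --> F] --> (0 : R).
Proof.
rewrite cvg_nmP; split=> h.
  apply/cvgrPdist_lt => e /h; apply: filterS => t.
  by rewrite sub0r normrN ger0_norm ?nm_ge0.
move=> e e0; move/cvgrPdist_lt : h => /(_ _ e0); apply: filterS => t.
by rewrite sub0r normrN ger0_norm ?nm_ge0.
Qed.

Lemma cvg_nm (FF : Filter F) (u : T -> X) x :
  u @ F --> x -> nm (u t) @[t --> F] --> nm x.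
Proof.
move=> /cvg_nmP h; apply/cvgrPdist_lt => e /h; apply: filterS => t; apply: le_lt_trans.
rewrite ler_norml; apply/andP; split.
  by have := nmD (u t - x) x; rewrite subrK; lra.
by have := nmD (x - u t) (u t); rewrite subrK (nmB x); lra.
Qed.

Lemma cvg_ip (FF : Filter F) (u v : T -> X) x y :
  u @ F --> x -> v @ F --> y -> ip (u t) (v t) @[t --> F] --> ip x y.
Proof.
move=> hu hv.
have pol a b : ip a b = 4^-1 * (nm (a + b) ^+ 2 - nm (a - b) ^+ 2).
  by rewrite !nm_sq !(ipDl, ipDr, ipNl, ipNr, ipC b a); field.
rewrite pol; under eq_cvg do rewrite pol.
apply: cvgM; first exact: cvg_cst.
by apply: cvgB; rewrite expr2; apply: cvgM; apply: cvg_nm; first [exact: cvgD|exact: cvgB].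
Qed.

Lemma cvg_rs (FF : Filter F) (u : T -> X) r x :
  u @ F --> x -> rs r (u t) @[t --> F] --> rs r x.
Proof. exact: cvgZr. Qed.

Lemma cvg_ii (FF : Filter F) (u : T -> X) x :
  u @ F --> x -> ii (u t) @[t --> F] --> ii x.
Proof. exact: cvgZr. Qed.

End Cvg.

Lemma cvgX_unique {T : Type} {F : set_system T} {FF : ProperFilter F}
  (u : T -> X) x y : u @ F --> x -> u @ F --> y -> x = y.
Proof. move=> h1 h2; exact: (cvg_unique _ h1 h2). Qed.

Lemma cauchy_nm (u : nat -> X) (a : nat -> R) :
  a @ \oo --> 0 -> (forall n m, (n <= m)%N -> nm (u m - u n) <= a n) ->
  exists x : X, u @ \oo --> x.
Proof.
move=> a0 h; exists (lim (u @ \oo)); apply/cauchy_cvgP; apply/cauchy_ballP => e e0.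
have re : e = (complex.Re e)%:C by rewrite RRe_real // realE ltW.
have e0' : 0 < complex.Re e / 2 by rewrite divr_gt0// -ltcR -re.
move/cvgrPdist_lt : a0 => /(_ _ e0')[N _ hN].
have aN : a N < complex.Re e / 2.
  have := hN N (leqnn N); rewrite sub0r normrN; apply: le_lt_trans; exact: ler_norm.
exists (u @` [set n | (N <= n)%N], u @` [set n | (N <= n)%N]).
  by split; exists N => // n /= hn; exists n.
move=> [_ _] /= [[n hn <-] [m hm <-]]; rewrite -ball_normE /= re normE ltcR.
have := nm_triangle (u n) (u N) (u m).
have := h _ _ hn; have := h _ _ hm; rewrite (nmB (u m)); lra.
Qed.

Lemma closed_seq (V : set X) :
  (forall (u : nat -> X) x, (forall n, V (u n)) -> u @ \oo --> x -> V x) -> closed V.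
Proof.
move=> h x /= clx.
have P n : exists y, V y /\ nm (y - x) < n.+1%:R^-1.
  have e0 : 0 < (n.+1%:R^-1)%:C :> R[i] by rewrite ltcR invr_gt0.
  have [y [Vy]] := clx _ (nbhsx_ballx x _ e0).
  by rewrite -ball_normE /= normE ltcR nmB => ?; exists y.
move: (choice P) => [u hu]; apply: (h u); first by move=> n; case: (hu n).
apply/cvg_nm0P; apply: (@squeeze_cvgr _ _ _ _ (fun=> 0) (fun n => n.+1%:R^-1)).
- by near=> n; rewrite nm_ge0 /= ltW//; case: (hu n).
- exact: cvg_cst.
- exact: cvg_harmonic.
Unshelve. all: by end_near. Qed.

Lemma closed_lim (V : set X) (u : nat -> X) x :
  closed V -> (forall n, V (u n)) -> u @ \oo --> x -> V x.
Proof. by move=> cV hV; apply: (closed_cvg _ cV); near=> n. Unshelve. all: by end_near. Qed.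

Lemma dense_nmP (V : set X) :
  dense V <-> forall x (e : R), 0 < e -> exists2 y, V y & nm (y - x) < e.
Proof.
split=> [dV x e e0|h O [x Ox] oO].
  have e0' : 0 < e%:C :> R[i] by rewrite ltcR.
  have /dV[|y [xy Vy]] : ball x (e%:C : R[i]) !=set0 by exists x; exact: ballxx.
    exact: ball_open.
  by exists y => //; move: xy; rewrite -ball_normE /= normE ltcR nmB.
have : nbhs x O by exact: open_nbhs_nbhs.
rewrite -nbhs_ballE => -[e /= e0 he].
have re : e = (complex.Re e)%:C by rewrite RRe_real // realE ltW.
have e0' : 0 < complex.Re e by rewrite -ltcR -re.
have [y Vy xy] := h x _ e0'; exists y; split => //; apply: he.
by rewrite -ball_normE /= normE re ltcR nmB.
Qed.

Lemma dense_seq (V : set X) x : dense V ->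
  exists2 u : nat -> X, (forall n, V (u n)) & u @ \oo --> x.
Proof.
move=> /dense_nmP h.
have P n : exists y, V y /\ nm (y - x) < n.+1%:R^-1.
  by have [|y] := h x n.+1%:R^-1; rewrite ?invr_gt0// => ? ?; exists y.
move: (choice P) => [u hu]; exists u; first by move=> n; case: (hu n).
apply/cvg_nm0P; apply: (@squeeze_cvgr _ _ _ _ (fun=> 0) (fun n => n.+1%:R^-1)).
- by near=> n; rewrite nm_ge0 /= ltW//; case: (hu n).
- exact: cvg_cst.
- exact: cvg_harmonic.
Unshelve. all: by end_near. Qed.

(** Real linearity is the common denominator of unitary operators, the antilinear J and projections
    onto real subspaces. *)
Definition rlin (f : X -> X) : Prop :=
  (forall x y, f (x + y) = f x + f y) /\ forall r x, f (rs r x) = rs r (f x).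

Section Rlin.
Variable f : X -> X.
Hypothesis fl : rlin f.
Lemma rlinD x y : f (x + y) = f x + f y. Proof. exact: fl.1. Qed.
Lemma rlinZ r x : f (rs r x) = rs r (f x). Proof. exact: fl.2. Qed.
Lemma rlin0 : f 0 = 0. Proof. by rewrite -(rs0 0) rlinZ !rs0. Qed.
Lemma rlinN x : f (- x) = - f x. Proof. by rewrite -rsN1 rlinZ rsN1. Qed.
Lemma rlinB x y : f (x - y) = f x - f y. Proof. by rewrite rlinD rlinN. Qed.
End Rlin.

Definition bnd (f : X -> X) : Prop := exists c, forall x, nm (f x) <= c * nm x.

Lemma cvg_op (f : X -> X) {T : Type} {F : set_system T} {FF : Filter F}
   (u : T -> X) x : rlin f -> bnd f -> u @ F --> x -> f (u t) @[t --> F] --> f x.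
Proof.
move=> fl [c fc] /cvg_nm0P h; apply/cvg_nm0P.
apply: (@squeeze_cvgr _ _ _ _ (fun=> 0) (fun t => c * nm (u t - x))).
- by near=> t; rewrite nm_ge0 /= -rlinB.
- exact: cvg_cst.
- by rewrite -[X in _ --> X](mulr0 c); apply: cvgM => //; exact: cvg_cst.
Unshelve. all: by end_near. Qed.

Lemma rlin_id : rlin id. Proof. by []. Qed.
Lemma rlin_ii : rlin ii. Proof. by split; [exact: iiD|exact: iiZ]. Qed.
Lemma bnd_ii : bnd ii. Proof. by exists 1 => x; rewrite nm_ii mul1r. Qed.
Lemma bnd_iso f : (forall x, nm (f x) = nm x) -> bnd f.
Proof. by move=> h; exists 1 => x; rewrite h mul1r. Qed.

(** * Orthogonal projections onto closed real subspaces *)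

Section Projection.
Variable K : set X.
Hypotheses (cK : closed K) (sK : real_subspace K).

Lemma rsubN x : K x -> K (- x).
Proof. by case: sK => _ _ h /(h (-1)); rewrite -[_ *: _]/(rs _ _) rsN1. Qed.
Lemma rsubB x y : K x -> K y -> K (x - y).
Proof. by case: (sK) => _ h _ Kx /rsubN; exact: h. Qed.
Lemma rsubZ r x : K x -> K (rs r x). Proof. by case: sK => _ _; exact. Qed.
Lemma rsubD x y : K x -> K y -> K (x + y). Proof. by case: (sK) => _ + _; exact. Qed.

Lemma oproj_ex x : exists2 p, K p & forall k, K k -> ip (x - p) k = 0.
Proof.
pose S := [set ip (x - k) (x - k) | k in K].
have S0 : S !=set0 by exists (ip (x - 0) (x - 0)); exists 0 => //; case: sK.
have hS : has_inf S by split=> //; exists 0 => _ [k _ <-]; exact: ip_ge0.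
pose d := inf S.
have dle k : K k -> d <= ip (x - k) (x - k).
  by move=> Kk; apply: (ge_inf hS.2); exists k.
have P n : exists k, K k /\ ip (x - k) (x - k) < d + n.+1%:R^-1.
  have e0 : 0 < n.+1%:R^-1 :> R by rewrite invr_gt0.
  by have [_ [k Kk <-] h] := inf_adherent e0 hS; exists k.
move: (choice P) => [u hu].
have [p up] : exists p : X, u @ \oo --> p.
  (* By the parallelogram law |u m - u n|^2 <= 2/(n+1) + 2/(m+1) <= 4/(n+1), the midpoint being at
     squared distance at least d from x. *)
  apply: (@cauchy_nm u (fun n => Num.sqrt (4 * n.+1%:R^-1))).
    rewrite -[X in _ --> X]sqrtr0; apply: continuous_cvg; first exact: sqrt_continuous.
    rewrite -[X in _ --> X](mulr0 4); apply: cvgM; [exact: cvg_cst|exact: cvg_harmonic].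
  move=> n m lenm; rewrite ler_wsqrtr//.
  have [Kn hn] := hu n; have [Km hm] := hu m.
  have /dle : K (rs 2^-1 (u n + u m)) by apply: rsubZ; apply: rsubD.
  have : m.+1%:R^-1 <= n.+1%:R^-1 :> R by rewrite lef_pV2 ?posrE// ler_nat.
  move: hn hm; rewrite !(ipDl, ipDr, ipNl, ipNr, ipZl, ipZr) (ipC _ x) (ipC (u m) (u n)) (ipC (u m) x).
  by move: (n.+1%:R^-1) (m.+1%:R^-1) => a b; lra.
exists p; first by apply: (closed_lim cK _ up) => n; case: (hu n).
have Kp : K p by apply: (closed_lim cK _ up) => n; case: (hu n).
have pd : ip (x - p) (x - p) <= d.
  have h1 : ip (x - u n) (x - u n) @[n --> \oo] --> ip (x - p) (x - p).
    by apply: cvg_ip; apply: cvgB => //; exact: cvg_cst.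
  have h2 : d + n.+1%:R^-1 @[n --> \oo] --> d.
    by rewrite -[X in _ --> X]addr0; apply: cvgD; [exact: cvg_cst|exact: cvg_harmonic].
  apply: (ler_cvg_to h1 h2); near=> n; rewrite ltW//; by case: (hu n).
move=> k Kk.
have [kk|kk] := eqVneq (ip k k) 0; first by rewrite (ip_eq0 kk) ip0r.
have kk0 : 0 < ip k k by rewrite lt_def kk ip_ge0.
set b := ip (x - p) k.
(* Moving p by this multiple of k lowers the squared distance by b^2 / |k|^2, so minimality forces b
   = 0. *)
have := dle (p + rs (b / ip k k) k) (rsubD Kp (rsubZ _ Kk)).
have -> : x - (p + rs (b / ip k k) k) = (x - p) - rs (b / ip k k) k by rewrite opprD addrA.
rewrite ip_subZ -/b.
have -> : ip (x - p) (x - p) - 2 * (b / ip k k) * b + (b / ip k k) ^+ 2 * ip k k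
   = ip (x - p) (x - p) - b ^+ 2 / ip k k by field.
move=> h; have : b ^+ 2 / ip k k <= 0 by lra.
rewrite pmulr_lle0 ?invr_gt0// => h2.
by apply/eqP; rewrite -sqrf_eq0 eq_le h2 sqr_ge0.
Unshelve. all: by end_near. Qed.

Definition oproj x : X := xget 0 [set p | K p /\ forall k, K k -> ip (x - p) k = 0].

Lemma oprojP x : K (oproj x) /\ forall k, K k -> ip (x - oproj x) k = 0.
Proof. by rewrite /oproj; case: xgetP => // h; have [p] := oproj_ex x => ? ?; case: (h p). Qed.

Lemma oproj_uniq x p : K p -> (forall k, K k -> ip (x - p) k = 0) -> oproj x = p.
Proof.
move=> Kp hp; have [Kq hq] := oprojP x; apply/eqP; rewrite -subr_eq0; apply/eqP/ip_eq0.
have h := rsubB Kq Kp; have := hp _ h; have := hq _ h.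
by rewrite !(ipDl, ipNl); lra.
Qed.

Lemma oproj_id x : K x -> oproj x = x.
Proof. by move=> Kx; apply: oproj_uniq => // k _; rewrite subrr ip0l. Qed.

Lemma oproj_rlin : rlin oproj.
Proof.
split=> [x y|r x]; apply: oproj_uniq.
- by apply: rsubD; case: (oprojP x); case: (oprojP y).
- move=> k Kk; have := (oprojP x).2 _ Kk; have := (oprojP y).2 _ Kk.
  by rewrite !(ipDl, ipNl); lra.
- by apply: rsubZ; case: (oprojP x).
- by move=> k Kk; rewrite -rsN -rsD ipZl (oprojP x).2// mulr0.
Qed.

Lemma oproj_sym x y : ip (oproj x) y = ip x (oproj y).
Proof.
have := (oprojP x).2 _ (oprojP y).1; have := (oprojP y).2 _ (oprojP x).1.
rewrite !(ipDl, ipNl) (ipC y) (ipC (oproj y)); lra.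
Qed.

Lemma oprojK x : oproj (oproj x) = oproj x.
Proof. by apply: oproj_id; case: (oprojP x). Qed.

Lemma oproj_nm x : ip (oproj x) (oproj x) = ip (oproj x) x.
Proof. by rewrite oproj_sym oprojK ipC. Qed.

End Projection.

(** The representing vector is orthogonal to the closed kernel of [l]. It serves to define a
    vector-valued integral through its scalar pairings. *)
Lemma riesz (l : X -> R) c : (forall x y, l (x + y) = l x + l y) ->
  (forall r x, l (rs r x) = r * l x) -> (forall x, `|l x| <= c * nm x) ->
  exists y, forall z, l z = ip y z.
Proof.
move=> lD lZ lc.
have [l0|] := pselect (forall z, l z = 0).
  by exists 0 => z; rewrite l0 ip0l.
move=> /existsNP[w lw].
have l00 : l 0 = 0 by rewrite -(rs0 0) lZ mul0r.
have lN x : l (- x) = - l x by rewrite -rsN1 lZ mulN1r.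
pose K := [set x | l x = 0].
have sK : real_subspace K.
  split=> [|x y|r x]; rewrite /K /= ?lD -?[_ *: _]/(rs _ _) ?lZ //.
    by move=> -> ->; rewrite addr0.
  by move=> ->; rewrite mulr0.
have cK : closed K.
  apply: closed_seq => u x hu ux; rewrite /K /=.
  have : l (u n) @[n --> \oo] --> l x.
    have /cvg_nm0P h := ux.
    have : l (u n - x) @[n --> \oo] --> 0.
      apply/norm_cvg0P.
      apply: (@squeeze_cvgr _ _ _ _ (fun=> 0) (fun t => c * nm (u t - x))).
      - by near=> t; rewrite normr_ge0 /=.
      - exact: cvg_cst.
      - by rewrite -[X in _ --> X](mulr0 c); apply: cvgM => //; exact: cvg_cst.
    move=> /(@cvgD _ _ _ _ _ _ _ _ _)/(_ (cvg_cst (l x))).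
    rewrite add0r; apply: cvg_trans; apply: near_eq_cvg; near=> n.
    by rewrite /= fctE lD lN subrK.
  have -> : (fun n => l (u n)) = fun=> 0 by apply/funext => n; exact: hu.
  by move=> h; have := cvg_unique _ h (cvg_cst 0); exact.
have [Kp hp] := oprojP cK sK w; set p := oproj K w in Kp hp.
pose v := w - p.
have lv : l v = l w by rewrite /v lD lN Kp subr0.
have v0 : ip v v != 0.
  by apply/eqP => /ip_eq0 v0; apply: lw; rewrite -lv v0.
exists (rs (l v / ip v v) v) => z; rewrite ipZl.
have : K (z - rs (l z / l v) v).
  rewrite /K /= lD lN lZ divfK ?subrr// lv; exact/eqP.
move=> /hp; rewrite -/v ipDr ipNr ipZr => /eqP; rewrite subr_eq0 => /eqP ->.
have lv0 : l v != 0 by rewrite lv; apply/eqP.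
by field; rewrite v0 lv0.
Unshelve. all: by end_near. Qed.

End RealHilbert.

(** * One-parameter groups of isometries *)

Section OneParameter.
Context {R : realType} {X : hilbertType R}.
Implicit Types (x y z : X) (r s t e : R).

Lemma cvg_transfer (w x : nat -> X) (l : X) : w @ \oo --> l ->
  (forall n m, nm (x n - x m) <= nm (w n - w m)) -> exists x0 : X, x @ \oo --> x0.
Proof.
move=> wl h; exists (lim (x @ \oo)); apply/cauchy_cvgP; apply/cauchy_ballP => e e0.
have re : e = (complex.Re e)%:C by rewrite RRe_real // realE ltW.
have e0' : 0 < complex.Re e / 2 by rewrite divr_gt0// -ltcR -re.
have /cvg_nmP/(_ _ e0')[N _ hN] := wl.
exists (x @` [set n | (N <= n)%N], x @` [set n | (N <= n)%N]).
  by split; exists N => // n /= hn; exists n.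
move=> [_ _] /= [[n hn <-] [m hm <-]]; rewrite -ball_normE /= re normE ltcR.
apply: (le_lt_trans (h n m)); have := hN _ hn; have := hN _ hm => /=.
have := nm_triangle (w n) l (w m); rewrite (nmB l); lra.
Qed.

Lemma mvt_bound (f df : R -> R) (c t : R) :
  (forall s, `|s| <= `|t| -> is_derive s (1 : R) f (df s)) ->
  (forall s, `|s| <= `|t| -> `|df s| <= c) -> `|f t - f 0| <= c * `|t|.
Proof.
move=> fd fc.
have [t0|t0|->] := ltgtP t 0; last by rewrite subrr normr0 mulr0.
- have sle s : s \in `[t, 0] -> `|s| <= `|t|.
    by rewrite in_itv /= => /andP[h1 h2]; rewrite !ler0_norm ?lerN2 // ltW.
  have [||s hs h] := @MVT _ f df t 0 t0.
  + by move=> s hs; apply: fd; apply: sle; exact: subset_itv_oo_cc.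
  + apply: derivable_within_continuous => s hs; have := fd s (sle s hs).
    by move=> d; exact: ex_derive.
  + by rewrite distrC h sub0r normrM normrN ler_wpM2r// fc// sle// subset_itv_oo_cc.
- have sle s : s \in `[0, t] -> `|s| <= `|t|.
    by rewrite in_itv /= => /andP[h1 h2]; rewrite !ger0_norm // ltW.
  have [||s hs h] := @MVT _ f df 0 t t0.
  + by move=> s hs; apply: fd; apply: sle; exact: subset_itv_oo_cc.
  + apply: derivable_within_continuous => s hs; have := fd s (sle s hs).
    by move=> d; exact: ex_derive.
  + by rewrite h subr0 normrM ler_wpM2r// fc// sle// subset_itv_oo_cc.
Qed.

Record ugroup (u : R -> X -> X) : Prop := UGroup {
  ug_lin : forall t, rlin (u t);
  ug_nm : forall t x, nm (u t x) = nm x;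
  ugM : forall s t x, u (s + t) x = u s (u t x);
  ug_cont : forall x, continuous (fun t => u t x) }.

Definition gen (u : R -> X -> X) x y : Prop :=
  rs t^-1 (u t x - x) @[t --> (0 : R)^'] --> y.

Variable u : R -> X -> X.
Hypothesis ug : ugroup u.

Lemma iso_ip (f : X -> X) : rlin f -> (forall x, nm (f x) = nm x) ->
  forall x y, ip (f x) (f y) = ip x y.
Proof.
move=> fl fn x y.
have pol (a b : X) : ip a b = 4^-1 * (nm (a + b) ^+ 2 - nm (a - b) ^+ 2).
  by rewrite !nm_sq !(ipDl, ipDr, ipNl, ipNr, ipC b a); field.
by rewrite pol -rlinD// -rlinB// !fn -pol.
Qed.

Lemma ug0 x : u 0 x = x.
Proof.
apply/eqP; rewrite -subr_eq0; apply/eqP/nm_eq0.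
by rewrite -(ug_nm ug 0) (rlinB (ug_lin ug 0)) -ugM// addr0 subrr nm0.
Qed.

Lemma ugK t x : u (- t) (u t x) = x. Proof. by rewrite -ugM// addNr ug0. Qed.
Lemma ugNK t x : u t (u (- t) x) = x. Proof. by rewrite -ugM// addrN ug0. Qed.

Lemma ug_ip t x y : ip (u t x) (u t y) = ip x y.
Proof. by apply: iso_ip; [exact: ug_lin|exact: ug_nm]. Qed.

Lemma ug_adj t x y : ip (u t x) y = ip x (u (- t) y).
Proof. by rewrite -(ug_ip (- t)) ugK. Qed.

Lemma ug_near x e : 0 < e ->
  exists2 d, 0 < d & forall t, `|t| < d -> nm (u t x - x) < e.
Proof.
move=> e0; have := @ug_cont _ ug x 0; rewrite /continuous_at ug0 => /cvg_nmP/(_ _ e0).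
move=> [d /= d0 h]; exists d => // t td; apply: h => /=.
by rewrite sub0r normrN.
Qed.

(** A division-free form of the limit, which also covers t = 0. *)
Lemma genP x y : gen u x y <-> forall e, 0 < e ->
  exists2 d, 0 < d & forall t, `|t| < d -> nm (u t x - x - rs t y) <= e * `|t|.
Proof.
split=> [/cvg_nmP h e e0|h].
  have := h _ e0; rewrite /dnbhs /within /= => -[d /= d0 hd]; exists d => // t td.
  have [->|t0] := eqVneq t 0.
    by rewrite ug0 rs0 !subrr nm0 normr0 mulr0.
  have := hd t; rewrite /= sub0r normrN => /(_ td t0) /ltW.
  rewrite -(ler_pM2l (_ : 0 < `|t|)) ?normr_gt0// -nmZ rsD rsN rsA divff// rs1.
  by rewrite mulrC.
apply/cvg_nmP => e e0; have e20 : 0 < e / 2 by rewrite divr_gt0.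
have [d d0 hd] := h _ e20; rewrite /dnbhs /within /=; exists d => //= t.
rewrite /= sub0r normrN => td t0; have := hd _ td.
rewrite -ler_pdivrMr ?normr_gt0// mulrC -normfV -nmZ rsD rsN rsA mulVf// rs1.
by move=> h2; apply: (le_lt_trans h2); lra.
Qed.

Lemma genD x y x' y' : gen u x y -> gen u x' y' -> gen u (x + x') (y + y').
Proof.
move=> h1 h2; apply: cvg_trans (cvgD h1 h2); apply: near_eq_cvg; near=> t.
by rewrite /= fctE -rsD (rlinD (ug_lin ug t)) opprD addrACA.
Unshelve. all: by end_near. Qed.

Lemma genZ r x y : gen u x y -> gen u (rs r x) (rs r y).
Proof.
move=> h1; have H0 : rs r (rs t^-1 (u t x - x)) @[t --> (0 : R)^'] --> rs r y by exact: cvg_rs.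
apply: cvg_trans H0; apply: near_eq_cvg; near=> t.
by rewrite /= (rlinZ (ug_lin ug t)) -rsN -rsD !rsA mulrC.
Unshelve. all: by end_near. Qed.

Lemma genN x y : gen u x y -> gen u (- x) (- y).
Proof. by rewrite -!rsN1; exact: genZ. Qed.

Lemma gen_comm (f : X -> X) x y : rlin f -> bnd f -> (forall t x, f (u t x) = u t (f x)) ->
  gen u x y -> gen u (f x) (f y).
Proof.
move=> fl fb fu h; apply: cvg_trans (cvg_op fl fb h); apply: near_eq_cvg; near=> t.
by rewrite /= rlinZ// rlinB// fu.
Unshelve. all: by end_near. Qed.

Lemma gen_u t x y : gen u x y -> gen u (u t x) (u t y).
Proof.
apply: gen_comm; first exact: ug_lin.
  by apply: bnd_iso => ?; rewrite ug_nm.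
by move=> s z; rewrite -!ugM// addrC.
Qed.

Lemma gen_uniq x y y' : gen u x y -> gen u x y' -> y = y'.
Proof. exact: cvgX_unique. Qed.

Lemma gen_weak x y z t : gen u x y ->
  is_derive t (1 : R) (fun s => ip (u s x) z) (ip (u t y) z).
Proof.
move=> h.
have H : h^-1 *: (ip (u (h *: (1 : R) + t) x) z - ip (u t x) z) @[h --> 0^'] --> ip (u t y) z.
  have H0 : ip (rs r^-1 (u r (u t x) - u t x)) z @[r --> (0 : R)^'] --> ip (u t y) z.
    by apply: cvg_ip; [exact: gen_u|exact: cvg_cst].
  apply: cvg_trans H0; apply: near_eq_cvg; near=> r.
  by rewrite ipZl ipDl ipNl -ugM// [r *: 1]mulr1.
split; first by apply/cvg_ex; exists (ip (u t y) z).
by apply: cvg_lim => //; exact: H.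
Unshelve. all: by end_near. Qed.

(** The left-hand vector is the integral of u s y - y over [0, t]. The bound sees x only through y,
    which gives the uniformity behind [gen_closed]. *)
Lemma gen_bound x y t e : gen u x y ->
  (forall s, `|s| <= `|t| -> nm (u s y - y) <= e) ->
  nm (u t x - x - rs t y) <= e * `|t|.
Proof.
move=> h he.
have e0 : 0 <= e by apply: le_trans (he 0 _); rewrite ?nm_ge0// normr0.
apply: nm_bound => [|z]; first by rewrite mulr_ge0.
pose f s := ip (u s x) z - s * ip y z.
have -> : ip (u t x - x - rs t y) z = f t - f 0.
  by rewrite /f ug0 mul0r subr0 !(ipDl, ipNl, ipZl); ring.
apply: (le_trans (ler_norm _)); rewrite mulrAC.
apply: (@mvt_bound f (fun s => ip (u s y) z - ip y z)) => s hs.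
  have -> : f = (fun s => ip (u s x) z) - (fun s => s * ip y z) by [].
  apply: is_deriveB; first exact: gen_weak.
  have -> : (fun s => s * ip y z) = (ip y z) \*: id.
    by apply/funext => r /=; rewrite [LHS]mulrC.
  by apply: is_derive_eq; rewrite [LHS]mulr1.
rewrite -ipNl -ipDl; apply: (le_trans (CS _ _)).
by rewrite ler_wpM2r ?nm_ge0// he.
Qed.

(** The rate at which the difference quotients of x n converge depends only on the modulus of
    continuity of the orbit of y n, and that is eventually controlled by the orbit of y0. *)
Lemma gen_closed (x y : nat -> X) x0 y0 : (forall n, gen u (x n) (y n)) ->
  x @ \oo --> x0 -> y @ \oo --> y0 -> gen u x0 y0.
Proof.
move=> h hx hy; apply/genP => e e0.
have e20 : 0 < e / 2 by rewrite divr_gt0.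
have [d d0 hd] := ug_near y0 e20; exists d => // t td.
have H1 : nm (u t (x n) - x n - rs t (y n)) @[n --> \oo] --> nm (u t x0 - x0 - rs t y0).
  apply: cvg_nm; apply: cvgB; last exact: cvg_rs.
  apply: cvgB => //; apply: cvg_op => //; first exact: ug_lin.
  by apply: bnd_iso => ?; rewrite ug_nm.
apply: (ler_cvg_to H1 (cvg_cst (e * `|t|))).
have e40 : 0 < e / 4 by rewrite divr_gt0.
have /cvg_nmP/(_ _ e40) := hy.
apply: filterS => n hn; apply: gen_bound => // s st.
have := hd s (le_lt_trans st td).
have -> : u s (y n) - y n = u s (y n - y0) + (u s y0 - y0) + (y0 - y n).
  rewrite (rlinB (ug_lin ug s)); apply: ipext => z; rewrite !(ipDl, ipNl); ring.
have := nmD (u s (y n - y0) + (u s y0 - y0)) (y0 - y n).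
have := nmD (u s (y n - y0)) (u s y0 - y0).
rewrite (ug_nm ug) (nmB y0); lra.
Qed.

(** Since u t has adjoint u (- t), the difference quotient of x at t pairs with x' as minus the
    quotient of x' at - t pairs with x. *)
Lemma gen_skew x y x' y' : gen u x y -> gen u x' y' -> ip y x' = - ip x y'.
Proof.
move=> /genP h /genP h'; apply/eqP; rewrite -addr_eq0 -normr_le0; apply/ler_addgt0Pr => e e0.
rewrite add0r.
pose c := nm x + nm x' + 1.
have c0 : 0 < c by rewrite ltr_wpDl ?addr_ge0 ?nm_ge0.
have ec0 : 0 < e / c by rewrite divr_gt0.
have [d d0 hd] := h _ ec0; have [d' d'0 hd'] := h' _ ec0.
pose t := Order.min d d' / 2.
have m0 : 0 < Order.min d d' by rewrite lt_min d0.
have t0 : 0 < t by rewrite divr_gt0.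
have tm : t < Order.min d d' by rewrite /t; lra.
have td : `|t| < d by rewrite gtr0_norm//; apply: (lt_le_trans tm); rewrite ge_min lexx.
have td' : `|- t| < d' by rewrite normrN gtr0_norm//; apply: (lt_le_trans tm); rewrite ge_min lexx orbT.
have H1 := le_trans (CS _ x') (ler_wpM2r (nm_ge0 x') (hd _ td)).
have H2 := le_trans (CS _ x) (ler_wpM2r (nm_ge0 x) (hd' _ td')).
rewrite !(ipDl, ipNl, ipZl) normrN (gtr0_norm t0) in H2.
rewrite !(ipDl, ipNl, ipZl) (gtr0_norm t0) in H1.
rewrite (ipC _ x) -ug_adj (ipC x' x) (ipC y' x) in H2.
have : t * `|ip y x' + ip x y'| <= t * e.
  rewrite -[X in X * `|_|](gtr0_norm t0) -normrM.
  have -> : t * (ip y x' + ip x y') = (ip (u t x) x' - ip x x' - - t * ip x y')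
     - (ip (u t x) x' - ip x x' - t * ip y x') by ring.
  apply: (le_trans (ler_normB _ _)); apply: (le_trans (lerD H2 H1)).
  have -> : e / c * t * nm x + e / c * t * nm x' = t * (e * ((nm x + nm x') / c)) by field; rewrite gt_eqF.
  rewrite ler_pM2l// -[leRHS]mulr1 ler_pM2l// ler_pdivrMr// mul1r /c; lra.
by rewrite ler_pM2l.
Qed.

Lemma gen_orth x y : gen u x y -> ip x y = 0.
Proof. by move=> h; have := gen_skew h h; rewrite ipC; lra. Qed.

Section Primitive.
Variable x : X.

Let fcont z : continuous (fun s : R => ip (u s x) z : R^o).
Proof. by move=> s; apply: cvg_ip; [exact: ug_cont|exact: cvg_cst]. Qed.

Let fint z (a b : R) : lebesgue_measure.-integrable `[a, b] (EFin \o (fun s => ip (u s x) z)).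
Proof.
apply: continuous_compact_integrable; first exact: segment_compact.
by apply: continuous_subspaceT; exact: fcont.
Qed.

(** [m t] is the integral of s -> u s x over [0, t], obtained weakly: its pairing with z is a scalar
    integral, and [riesz] supplies the vector. *)
Lemma prim_ex : exists2 m : R -> X, m 0 = 0 &
  forall t z, `|t| < 1 -> is_derive t (1 : R) (fun s => ip (m s) z) (ip (u t x) z).
Proof.
(* Starting the integral at -1 makes every t with |t| < 1 an interior point for the fundamental
   theorem; subtracting [m 0] afterwards moves the base point to 0. *)
pose I t z := (\int[lebesgue_measure]_(s in `[-1, t]) ip (u s x) z)%R.
have P t : exists y, forall z, I t z = ip y z.
  pose c := fine (lebesgue_measure (`[-1, t] : set R)) * nm x.
  have mI : measurable (`[-1, t] : set R) by exact: measurable_itv.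
  apply: (@riesz _ _ _ c) => [y z|r y|y].
  - by rewrite /I -RintegralD//; apply: eq_Rintegral => s _; rewrite ipDr.
  - by rewrite /I -RintegralZl//; apply: eq_Rintegral => s _; rewrite ipZr.
  - apply: (le_trans (le_normr_Rintegral _ _)) => //.
    have -> : c * nm y = (\int[lebesgue_measure]_(s in `[-1, t]) (nm x * nm y))%R.
      by rewrite Rintegral_cst// /c; ring.
    apply: le_Rintegral => //.
    + by have := integrable_abse (fint y (-1) t).
    + apply: continuous_compact_integrable; first exact: segment_compact.
      by apply: continuous_subspaceT => ?; exact: cvg_cst.
    + by move=> s _; apply: (le_trans (CS _ _)); rewrite ug_nm.
move: (choice P) => [m hm].
exists (fun t => m t - m 0); first by rewrite subrr.
move=> t z t1.
have [||||dI dIE] := @continuous_FTC1_closed _ (fun s => ip (u s x) z) (-1) t 1.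
- by move: t1; rewrite ltr_norml => /andP[].
- exact: fint.
- by move: t1; rewrite ltr_norml => /andP[].
- exact: fcont.
have -> : (fun s => ip (m s - m 0) z) = (fun s => I s z) - cst (I 0 z).
  by apply/funext => s; rewrite ipDl ipNl -!hm.
have H : is_derive t (1 : R) (fun s => I s z) (ip (u t x) z).
  by apply: DeriveDef; [exact: dI|rewrite -dIE derive1E].
by apply: is_derive_eq; exact: subr0.

Qed.

End Primitive.

Lemma is_derive_shift (f : R -> R) t r l : is_derive (t + r) (1 : R) f l ->
  is_derive t (1 : R) (fun s => f (s + r)) l.
Proof.
move=> [d e].
have E : (fun h : R => h^-1 *: (f (h *: (1 : R) + t + r) - f (t + r))) =
         (fun h : R => h^-1 *: (f (h *: (1 : R) + (t + r)) - f (t + r))).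
  by apply/funext => h; rewrite addrA.
by apply: DeriveDef; [rewrite /derivable E|rewrite /derive E].
Qed.

Lemma prim_bound x (m : R -> X) t r e :
  (forall t z, `|t| < 1 -> is_derive t (1 : R) (fun s => ip (m s) z) (ip (u t x) z)) ->
  `|t| + `|r| < 1 -> (forall s, `|s| <= `|r| -> nm (u s x - x) <= e) ->
  nm (m (t + r) - m t - rs r (u t x)) <= e * `|r|.
Proof.
move=> hm tr he.
have e0 : 0 <= e by apply: le_trans (he 0 _); rewrite ?nm_ge0// normr0.
apply: nm_bound => [|z]; first by rewrite mulr_ge0.
pose f s := ip (m (t + s)) z - s * ip (u t x) z.
have -> : ip (m (t + r) - m t - rs r (u t x)) z = f r - f 0.
  by rewrite /f addr0 mul0r subr0 !(ipDl, ipNl, ipZl); ring.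
apply: (le_trans (ler_norm _)); rewrite mulrAC.
apply: (@mvt_bound f (fun s => ip (u (t + s) x) z - ip (u t x) z)) => s hs.
  have -> : f = (fun s => ip (m (t + s)) z) - (fun s => s * ip (u t x) z) by [].
  apply: is_deriveB.
    have -> : (fun s => ip (m (t + s)) z) = (fun s => ip (m (s + t)) z).
      by apply/funext => q; rewrite addrC.
    rewrite addrC; apply: (@is_derive_shift (fun s => ip (m s) z)); apply: hm.
    by apply: (le_lt_trans (ler_normD _ _)); apply: le_lt_trans tr; rewrite addrC lerD2l.
  have -> : (fun s => s * ip (u t x) z) = (ip (u t x) z) \*: id.
    by apply/funext => q /=; rewrite [LHS]mulrC.
  by apply: is_derive_eq; rewrite [LHS]mulr1.
rewrite -ipNl -ipDl; apply: (le_trans (CS _ _)).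
rewrite ler_wpM2r ?nm_ge0// ugM// -(rlinB (ug_lin ug t)) (ug_nm ug); exact: he.
Qed.

Lemma deriv0_const (f : R -> R) t : (forall s, `|s| <= `|t| -> is_derive s (1 : R) f 0) ->
  f t = f 0.
Proof.
move=> h; apply/eqP; rewrite -subr_eq0 -normr_le0.
by have := @mvt_bound f (fun=> 0) 0 t h; rewrite mul0r; apply => s _; rewrite normr0.
Qed.

(** Both sides integrate u s x over [r, t + r]; weakly, their difference has derivative 0 in t and
    vanishes at t = 0. *)
Lemma prim_shift x (m : R -> X) t r : m 0 = 0 ->
  (forall t z, `|t| < 1 -> is_derive t (1 : R) (fun s => ip (m s) z) (ip (u t x) z)) ->
  `|t| + `|r| < 1 -> u r (m t) = m (t + r) - m r.
Proof.
move=> m0 hm tr; apply: ipext => z.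
pose f s := ip (m s) (u (- r) z) - ip (m (s + r)) z.
have : f t = f 0.
  apply: deriv0_const => s hs.
  have -> : f = (fun s => ip (m s) (u (- r) z)) - (fun s => ip (m (s + r)) z) by [].
  apply: is_derive_eq.
    apply: is_deriveB.
      apply: hm; apply: (le_lt_trans hs); apply: le_lt_trans tr.
      by rewrite lerDl.
    apply: (@is_derive_shift (fun s => ip (m s) z)); apply: hm.
    by apply: (le_lt_trans (ler_normD _ _)); apply: le_lt_trans tr; rewrite lerD2r.
  by rewrite -ug_adj -ugM// (addrC r) subrr.
rewrite /f m0 add0r ip0l -ug_adj ipDl ipNl; lra.
Qed.

(** The averages of u s x over [0, r] lie in the domain, d mapping them to (u r x - x) / r, and they
    tend to x with r. *)
Lemma gen_dense : dense [set x | exists y, gen u x y].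
Proof.
apply/dense_nmP => x e e0.
have [m m0 hm] := prim_ex x.
have e20 : 0 < e / 2 by rewrite divr_gt0.
have [d d0 hd] := ug_near x e20.
(* r < d makes the average close to x; r < 1/2 leaves room for shifts by |t| < 1/2 inside ]-1, 1[,
   where [m] is a primitive. *)
pose r := Order.min d 1 / 4.
have mi0 : 0 < Order.min d 1 by rewrite lt_min d0 ltr01.
have r0 : 0 < r by rewrite divr_gt0.
have m1 : Order.min d 1 <= d by rewrite ge_min lexx.
have m2 : Order.min d 1 <= 1 by rewrite ge_min lexx orbT.
have rd : r < d by rewrite /r; lra.
have r1 : r < 2^-1 by rewrite /r; lra.
exists (rs r^-1 (m r)); last first.
  have := @prim_bound x m 0 r (e / 2) hm.
  rewrite normr0 add0r add0r m0 subr0 ug0 gtr0_norm// => H.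
  have {}H : nm (m r - rs r x) <= e / 2 * r.
    apply: H => [|s sr]; first lra.
    by apply: ltW; apply: hd; apply: le_lt_trans rd.
  have -> : rs r^-1 (m r) - x = rs r^-1 (m r - rs r x).
    by rewrite rsD rsN rsA mulVf ?rs1// gt_eqF.
  rewrite nmZ gtr0_norm ?invr_gt0// mulrC ltr_pdivrMr//.
  apply: (le_lt_trans H); rewrite ltr_pM2r//; lra.
exists (rs r^-1 (u r x - x)); apply: genZ.
apply/genP => e' e'0.
have e'20 : 0 < e' / 2 by rewrite divr_gt0.
have [d' d'0 hd'] := ug_near x e'20.
exists (Order.min d' 2^-1) => [|t]; first by rewrite lt_min d'0 invr_gt0 ltr0n.
rewrite lt_min => /andP[td' t2].
have he' s : `|s| <= `|t| -> nm (u s x - x) <= e' / 2.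
  by move=> st; apply: ltW; apply: hd'; apply: le_lt_trans td'.
have rt : `|r| + `|t| < 1 by rewrite (gtr0_norm r0); lra.
rewrite (prim_shift m0 hm rt).
have H1 := prim_bound hm rt he'.
have H2 := @prim_bound x m 0 t (e' / 2) hm.
rewrite normr0 !add0r m0 subr0 ug0 in H2.
have {}H2 : nm (m t - rs t x) <= e' / 2 * `|t| by apply: H2 => //; lra.
have -> : m (r + t) - m t - m r - rs t (u r x - x) =
  (m (r + t) - m r - rs t (u r x)) - (m t - rs t x).
  by apply: ipext => z; rewrite !(ipDl, ipNl, ipZl); ring.
apply: (le_trans (nmD _ _)); rewrite nmN; lra.
Qed.

Definition sg (b : bool) : R := if b then 1 else -1.
Lemma sgK b : sg b * sg b = 1. Proof. by case: b; rewrite /sg ?mulr1// mulrNN mulr1. Qed.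

(** g t = ip (u t x) v solves g' = g or g' = - g, hence is g 0 times an exponential; being bounded
    on the whole line, it is zero. *)
Lemma gen_bounded_exp b x y v : gen u x y -> (forall t, ip (u t y) v = sg b * ip (u t x) v) ->
  ip x v = 0.
Proof.
move=> h hv.
pose g t := ip (u t x) v.
pose f t := g t * expR (- (sg b * t)).
have fc t : f t = f 0.
  apply: deriv0_const => s _.
  have dg : is_derive s (1 : R) g (sg b * g s).
    by rewrite /g -hv; exact: gen_weak.
  have de : is_derive s (1 : R) (fun t => expR (- (sg b * t))) (- sg b * expR (- (sg b * s))).
    have -> : (fun t => expR (- (sg b * t))) = expR \o ((- sg b) \*: id).
      by apply/funext => q /=; rewrite -[_ *: _]/(- sg b * q) mulNr.
    have H : is_derive s (1 : R) ((- sg b) \*: (id : R -> R)) (- sg b).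
      by apply: is_derive_eq; rewrite [LHS]mulr1.
    have := @is_derive1_comp R expR ((- sg b) \*: (id : R -> R)) s _ _ (is_derive_expR _) H.
    by rewrite /= -[_ *: s]/(- sg b * s) mulNr mulrC.
  have -> : f = g * (fun t => expR (- (sg b * t))) by [].
  apply: is_derive_eq.
  rewrite -[X in X + _ = _]/(_ * _) -[X in _ + X = _]/(_ * _); ring.
have gE t : ip x v * expR (sg b * t) = g t.
  have := fc t; rewrite /f mulr0 oppr0 expR0 mulr1 /g ug0 => <-.
  by rewrite -mulrA -expRD addNr expR0 mulr1.
apply/eqP; rewrite -normr_eq0; apply/eqP/le_anti; rewrite normr_ge0 andbT.
rewrite leNgt; apply/negP => g0.
pose c := nm x * nm v.
(* At this time the exponential is at least 1 + c / |ip x v|, so that |g| is at least |ip x v| + c,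
   which exceeds its bound c. *)
have := gE (sg b * (c / `|ip x v|)).
rewrite mulrA sgK mul1r => /(congr1 (@Num.norm _ _)).
rewrite normrM (gtr0_norm (expR_gt0 _)) => H.
have c0 : 0 <= c by rewrite mulr_ge0 ?nm_ge0.
have /(ler_wpM2l (ltW g0)) := expR_ge1Dx (c / `|ip x v|).
rewrite H mulrDr mulr1 mulrCA divff ?gt_eqF// mulr1.
have : `|g (sg b * (c / `|ip x v|))| <= c.
  by apply: (le_trans (CS _ _)); rewrite ug_nm.
lra.
Qed.

(** The range of 1 - d is closed because d is skew: |x - d x|^2 = |x|^2 + |d x|^2. By
    [gen_bounded_exp], a vector orthogonal to the range is orthogonal to the domain of d, which is
    dense. The same holds for 1 + d. *)
Lemma res_ex b w : exists x, gen u x (rs (sg b) (x - w)).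
Proof.
pose K' := [set w | exists x, gen u x (rs (sg b) (x - w))].
have sK : real_subspace K'.
  split=> [|x y [x' hx] [y' hy]|r x [x' hx]].
  - exists 0; rewrite subr0 rsr0 /gen.
    have -> : (fun t => rs t^-1 (u t 0 - 0)) = fun=> 0.
      by apply/funext => t; rewrite (rlin0 (ug_lin ug t)) subr0 rsr0.
    exact: cvg_cst.
  - exists (x' + y'); have := genD hx hy; congr gen.
    by rewrite -rsD opprD addrACA.
  - exists (rs r x'); have := @genZ r _ _ hx; congr gen.
    by rewrite rsA mulrC -rsA rsD rsN.
have cK : closed K'.
  apply: closed_seq => v v0 hv vv0; move: (choice hv) => [x hx].
  have [x0 xx0] : exists x0 : X, x @ \oo --> x0.
    apply: (cvg_transfer vv0) => n m.
    have h : gen u (x n - x m) (rs (sg b) ((x n - x m) - (v n - v m))).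
      have := genD (hx n) (genN (hx m)); congr gen.
      by rewrite -rsN -rsD; congr (rs _ _); apply: ipext => z; rewrite !(ipDl, ipNl); ring.
    move: (x n - x m) (v n - v m) h => a c h.
    have o := gen_orth h; rewrite le_nm.
    have -> : c = a - rs (sg b) (rs (sg b) (a - c)).
      by rewrite rsA sgK rs1 opprB addrC subrK.
    move: (rs (sg b) (a - c)) o h => y o h.
    rewrite !(ipDl, ipDr, ipNl, ipNr, ipZl, ipZr) (ipC y) o.
    have := ip_ge0 y; have := sgK b; nra.
  exists x0; apply: (gen_closed hx xx0); apply: cvg_rs; exact: cvgB.
have [Kp hp] := @oprojP _ _ _ cK sK w; set p := oproj K' w in Kp hp.
suff : w - p = 0 by move/eqP; rewrite subr_eq0 => /eqP ->.
apply: ipext => z; rewrite ip0l.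
have hD x y : gen u x y -> ip x (w - p) = 0.
  move=> h; apply: (gen_bounded_exp (b := b) h) => t.
  have ht := gen_u (t := t) h.
  have : K' (u t x - rs (sg b) (u t y)).
    by exists (u t x); rewrite opprB addrC subrK rsA sgK rs1.
  move=> /hp; rewrite ipC ipDl ipNl ipZl => H.
  have : ip (u t x) (w - p) = sg b * ip (u t y) (w - p) by lra.
  by move=> ->; rewrite mulrA sgK mul1r.
have [a ha az] := dense_seq z gen_dense.
have H : ip (w - p) (a n) @[n --> \oo] --> ip (w - p) z.
  by apply: cvg_ip => //; exact: cvg_cst.
have : (fun n => ip (w - p) (a n)) = fun=> 0.
  by apply/funext => n; have [y /hD] := ha n; rewrite ipC.
by move=> E; rewrite E in H; have := cvg_unique _ H (cvg_cst 0); exact.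
Unshelve. all: by end_near. Qed.

(* With [d] the generator, [res u true] is (1 - d)^-1 and [res u false] is
   (1 + d)^-1. *)
Definition res b w : X := xget 0 [set x | gen u x (rs (sg b) (x - w))].

Lemma resP b w : gen u (res b w) (rs (sg b) (res b w - w)).
Proof. by rewrite /res; case: xgetP => // h; have [x hx] := res_ex b w; case: (h x). Qed.

Lemma res_uniq b x w : gen u x (rs (sg b) (x - w)) -> res b w = x.
Proof.
move=> h; have := genD (@resP b w) (genN h).
rewrite -rsN -rsD => h2; have := gen_orth h2.
have -> : res b w - w - (x - w) = res b w - x.
  by apply: ipext => z; rewrite !(ipDl, ipNl); ring.
rewrite ipZr => /(congr1 (fun r => sg b * r)); rewrite mulrA sgK mul1r mulr0.
by move=> /ip_eq0/eqP; rewrite subr_eq0 => /eqP.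
Qed.

Lemma res_rlin b : rlin (res b).
Proof.
split=> [x y|r x]; apply: res_uniq.
  have := genD (@resP b x) (@resP b y); congr gen.
  by rewrite -rsD; congr (rs _ _); rewrite opprD addrACA.
have := @genZ r _ _ (@resP b x); congr gen.
by rewrite rsA mulrC -rsA rsD rsN.
Qed.

Lemma res_nm b x : nm (res b x) <= nm x.
Proof.
rewrite le_nm; have h := @resP b x; have := gen_orth h.
rewrite ipZr => /(congr1 (fun r => sg b * r)); rewrite mulrA sgK mul1r mulr0 ipDr ipNr.
have := CS_sq (res b x) x; have := ip_ge0 x; have := ip_ge0 (res b x).
move: (ip (res b x) (res b x)) (ip x x) (ip (res b x) x) => p q s; nra.
Qed.

Lemma res_adj b x y : ip (res b x) y = ip x (res (~~ b) y).
Proof.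
have := gen_skew (@resP b x) (@resP (~~ b) y).
have -> : sg (~~ b) = - sg b by case: (b); rewrite /sg //= opprK.
rewrite ipZl ipZr => /(congr1 (fun r => sg b * r)).
rewrite mulNr opprK !mulrA sgK !mul1r ipDl ipDr ipNl ipNr; lra.
Qed.

Lemma res_comm (f : X -> X) b x : rlin f -> bnd f -> (forall t x, f (u t x) = u t (f x)) ->
  f (res b x) = res b (f x).
Proof.
move=> fl fb fu; symmetry; apply: res_uniq.
have := gen_comm fl fb fu (@resP b x); congr gen.
by rewrite rlinZ// rlinB.
Qed.

(** Partial fractions of 1 / ((1 - d)(1 + d)), which is (1 + A^2)^-1 for A = i d. *)
Lemma res_mul x : res true (res false x) = rs 2^-1 (res true x + res false x).
Proof.
apply: res_uniq; have := @genZ 2^-1 _ _ (genD (@resP true x) (@resP false x)); congr gen.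
rewrite /sg rs1 rsN1 rs1; apply: ipext => z; rewrite !(ipDl, ipNl, ipZl); by field.
Qed.

Lemma res_gen b x y : gen u x y -> res b (x - rs (sg b) y) = x.
Proof.
move=> h; apply: res_uniq.
by rewrite opprB addrC subrK rsA sgK rs1.
Qed.

End OneParameter.

(** * Square roots of 1 - T for symmetric contractions T *)

Section SquareRoot.
Context {R : realType} {X : hilbertType R}.
Implicit Types (x y z : X) (a b c : R).

Lemma ndbnd_cvg (q : nat -> R) c : (forall n m, (n <= m)%N -> q n <= q m) ->
  (forall n, q n <= c) -> exists2 l, q @ \oo --> l & forall n, q n <= l.
Proof.
move=> qnd qc.
have nd : nondecreasing_seq q by move=> n m; exact: qnd.
have ub : has_ubound (range q) by exists c => _ [n _ <-].
exists (sup (range q)); first exact: nondecreasing_cvgn.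
by move=> n; apply: ub_le_sup => //; exists n.
Qed.

Definition rsym (f : X -> X) : Prop := forall x y, ip (f x) y = ip x (f y).

Lemma rlin_add (f g : X -> X) : rlin f -> rlin g -> rlin (fun x => f x + g x).
Proof.
move=> hf hg; split=> [x y|r x].
  by rewrite (rlinD hf) (rlinD hg) addrACA.
by rewrite (rlinZ hf) (rlinZ hg) rsD.
Qed.

Lemma rlin_opp (f : X -> X) : rlin f -> rlin (fun x => - f x).
Proof.
move=> hf; split=> [x y|r x]; first by rewrite (rlinD hf) opprD.
by rewrite (rlinZ hf) rsN.
Qed.

Lemma rlin_sub (f g : X -> X) : rlin f -> rlin g -> rlin (fun x => f x - g x).
Proof. by move=> hf hg; exact: rlin_add hf (rlin_opp hg). Qed.

Lemma rlin_rs c (f : X -> X) : rlin f -> rlin (fun x => rs c (f x)).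
Proof.
move=> hf; split=> [x y|r x]; first by rewrite (rlinD hf) rsD.
by rewrite (rlinZ hf) !rsA mulrC.
Qed.

Lemma rlin_comp (f g : X -> X) : rlin f -> rlin g -> rlin (fun x => f (g x)).
Proof.
move=> hf hg; split=> [x y|r x]; first by rewrite (rlinD hg) (rlinD hf).
by rewrite (rlinZ hg) (rlinZ hf).
Qed.

Variable T : X -> X.
Hypotheses (Tl : rlin T) (Ts : rsym T) (Tc : forall x, nm (T x) <= nm x).

(* [nnp f a]: [f] is a polynomial in [T] with nonnegative coefficients whose
   value at 1 is [a]. *)
Inductive nnp : (X -> X) -> R -> Prop :=
| nnp_T : nnp T 1
| nnp_0 : nnp (fun=> 0) 0
| nnp_D f g a b : nnp f a -> nnp g b -> nnp (fun x => f x + g x) (a + b)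
| nnp_M f g a b : nnp f a -> nnp g b -> nnp (fun x => f (g x)) (a * b)
| nnp_h f a : nnp f a -> nnp (fun x => rs 2^-1 (f x)) (a / 2).

Lemma nnp_ge0 f a : nnp f a -> 0 <= a.
Proof.
elim=> //; first by move=> ? ? ? ? _ ? _ ?; exact: addr_ge0.
  by move=> ? ? ? ? _ ? _ ?; exact: mulr_ge0.
by move=> ? ? _ ?; exact: divr_ge0.
Qed.

Lemma nnp_rlin f a : nnp f a -> rlin f.
Proof.
elim=> //.
- by split=> *; rewrite ?addr0 ?rsr0.
- by move=> {}f g _ _ _ hf _ hg; exact: rlin_add.
- by move=> {}f g _ _ _ hf _ hg; exact: rlin_comp.
- by move=> {}f _ _ hf; exact: rlin_rs.
Qed.

Lemma nnp_nm f a : nnp f a -> forall x, nm (f x) <= a * nm x.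
Proof.
elim=> //.
- by move=> x; rewrite mul1r.
- by move=> x; rewrite nm0 mul0r.
- move=> {}f g {}a b _ hf _ hg x; apply: (le_trans (nmD _ _)).
  by rewrite mulrDl lerD.
- move=> {}f g {}a b pf hf _ hg x; apply: (le_trans (hf _)).
  by rewrite -mulrA ler_wpM2l// (nnp_ge0 pf).
- move=> {}f {}a _ hf x; rewrite nmZ ger0_norm ?invr_ge0// mulrC mulrAC.
  by rewrite ler_wpM2r ?invr_ge0.
Qed.

Lemma nnp_comm (Z : X -> X) f a : rlin Z -> (forall x, Z (T x) = T (Z x)) ->
  nnp f a -> forall x, Z (f x) = f (Z x).
Proof.
move=> Zl ZT; elim=> //.
- by move=> x; rewrite (rlin0 Zl).
- by move=> {}f g _ _ _ hf _ hg x; rewrite (rlinD Zl) hf hg.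
- by move=> {}f g _ _ _ hf _ hg x; rewrite hf hg.
- by move=> {}f _ _ hf x; rewrite (rlinZ Zl) hf.
Qed.

Lemma nnp_commute f g a b : nnp f a -> nnp g b -> forall x, f (g x) = g (f x).
Proof.
move=> hf hg x; apply: (nnp_comm (nnp_rlin hf) _ hg) => y.
by rewrite -(nnp_comm Tl _ hf).
Qed.

Lemma nnp_sym f a : nnp f a -> rsym f.
Proof.
elim=> //.
- by move=> x y; rewrite ip0l ip0r.
- by move=> {}f g _ _ _ hf _ hg x y; rewrite ipDl ipDr hf hg.
- by move=> f0 g a0 b0 pf hf pg hg x y; rewrite hf hg (nnp_commute pg pf).
- by move=> {}f _ _ hf x y; rewrite ipZl ipZr hf.
Qed.

(* The limit Y of this iteration satisfies Y = (T + Y^2) / 2, so that 1 - Y is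
   the square root of 1 - T. *)
Fixpoint sqY n : X -> X :=
  if n is k.+1 then fun x => rs 2^-1 (T x + sqY k (sqY k x)) else fun=> 0.
Fixpoint sqy n : R := if n is k.+1 then (1 + sqy k * sqy k) / 2 else 0.

Lemma sqY_nnp n : nnp (sqY n) (sqy n).
Proof.
elim: n => [|n IH] /=; first exact: nnp_0.
apply: (nnp_h (f := fun x => T x + sqY n (sqY n x))).
by apply: nnp_D; [exact: nnp_T|exact: (nnp_M IH IH)].
Qed.

Lemma sqy_le1 n : sqy n <= 1.
Proof.
elim: n => [|n IH] /=; first exact: ler01.
have := nnp_ge0 (sqY_nnp n); nra.
Qed.

(** Y_(n+2) - Y_(n+1) = (Y_(n+1) - Y_n)(Y_(n+1) + Y_n) / 2, so the increments remain polynomials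
    with nonnegative coefficients. Their norms are then bounded by the increments of the scalar
    sequence [sqy], which converges, and no order on operators is involved. *)
Lemma sqYS_nnp n : nnp (fun x => sqY n.+1 x - sqY n x) (sqy n.+1 - sqy n).
Proof.
elim: n => [|n IH].
  have -> : (fun x => sqY 1 x - sqY 0 x) = fun x => rs 2^-1 (T x).
    by apply/funext => x; rewrite /= addr0 subr0.
  have -> : sqy 1 - sqy 0 = 1 / 2 by rewrite /= mulr0 addr0 subr0.
  exact: nnp_h nnp_T.
have -> : (fun x => sqY n.+2 x - sqY n.+1 x) = fun x => rs 2^-1
   ((fun x => sqY n.+1 x - sqY n x) ((fun x => sqY n.+1 x + sqY n x) x)).
  apply/funext => x; have h := nnp_rlin (sqY_nnp n.+1); have h' := nnp_rlin (sqY_nnp n).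
  rewrite -[sqY n.+2 x]/(rs 2^-1 (T x + sqY n.+1 (sqY n.+1 x))).
  rewrite -[in X in _ - X]/(rs 2^-1 (T x + sqY n (sqY n x))).
  rewrite -rsN -rsD (rlinD h) (rlinD h') (nnp_commute (sqY_nnp n.+1) (sqY_nnp n)).
  by congr (rs _ _); apply: ipext => z; rewrite !(ipDl, ipNl); ring.
have -> : sqy n.+2 - sqy n.+1 = ((sqy n.+1 - sqy n) * (sqy n.+1 + sqy n)) / 2.
  have e1 : sqy n.+2 = (1 + sqy n.+1 * sqy n.+1) / 2 by [].
  have e2 : sqy n.+1 = (1 + sqy n * sqy n) / 2 by [].
  by rewrite e1 {3}e2; field.
apply: nnp_h; apply: (nnp_M IH); exact: nnp_D (sqY_nnp _) (sqY_nnp _).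
Qed.

Lemma sqYB_nnp n k : nnp (fun x => sqY (k + n)%N x - sqY n x) (sqy (k + n)%N - sqy n).
Proof.
elim: k => [|k IH].
  have -> : (fun x => sqY (0 + n)%N x - sqY n x) = fun=> 0.
    by apply/funext => x; rewrite add0n subrr.
  by rewrite add0n subrr; exact: nnp_0.
have -> : (fun x => sqY (k.+1 + n)%N x - sqY n x) =
  fun x => (sqY (k + n).+1 x - sqY (k + n)%N x) + (sqY (k + n)%N x - sqY n x).
  by apply/funext => x; rewrite addrA subrK.
have -> : sqy (k.+1 + n)%N - sqy n = (sqy (k + n).+1 - sqy (k + n)%N) + (sqy (k + n)%N - sqy n).
  by rewrite addrA subrK.
exact: nnp_D (sqYS_nnp _) IH.
Qed.

Lemma sqY_cvg x : exists y, (sqY n x) @[n --> \oo] --> y.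
Proof.
have nd n m : (n <= m)%N -> sqy n <= sqy m.
  by move=> /subnK <-; rewrite -subr_ge0; exact: nnp_ge0 (sqYB_nnp n (m - n)).
have [l hl le_l] := ndbnd_cvg nd sqy_le1.
apply: (@cauchy_nm _ _ (fun n => sqY n x) (fun n => (l - sqy n) * nm x)).
  rewrite -[X in _ --> X](mul0r (nm x)); apply: cvgM; last exact: cvg_cst.
  by rewrite -(subrr l); apply: cvgB => //; exact: cvg_cst.
move=> n m /subnK <-; apply: (le_trans (nnp_nm (sqYB_nnp n (m - n)) x)).
by rewrite ler_wpM2r ?nm_ge0// lerB.
Qed.

Definition sqYl x : X := sval (cid (sqY_cvg x)).
Lemma sqYlP x : (sqY n x) @[n --> \oo] --> sqYl x.
Proof. by rewrite /sqYl; case: cid. Qed.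

Lemma sqYl_rlin : rlin sqYl.
Proof.
split=> [x y|r x]; apply: (cvgX_unique (@sqYlP _)).
  have -> : (fun n => sqY n (x + y)) = (fun n => sqY n x) + (fun n => sqY n y).
    by apply/funext => n; rewrite (rlinD (nnp_rlin (sqY_nnp n))).
  by apply: cvgD; exact: sqYlP.
have -> : (fun n => sqY n (rs r x)) = (fun n => rs r (sqY n x)).
  by apply/funext => n; rewrite (rlinZ (nnp_rlin (sqY_nnp n))).
by apply: cvg_rs; exact: sqYlP.
Qed.

Lemma sqY_nm n x : nm (sqY n x) <= nm x.
Proof.
apply: (le_trans (nnp_nm (sqY_nnp n) x)).
by rewrite -[leRHS]mul1r ler_wpM2r ?nm_ge0// sqy_le1.
Qed.

Lemma sqYl_nm x : nm (sqYl x) <= nm x.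
Proof.
apply: (ler_cvg_to (cvg_nm _ (@sqYlP x)) (cvg_cst (nm x))).
by near=> n; exact: sqY_nm.
Unshelve. all: by end_near. Qed.

Lemma sqYl_sym : rsym sqYl.
Proof.
move=> x y; apply: (@cvg_unique _ _ ((fun n => ip (sqY n x) y) @ \oo)) => //.
  by apply: cvg_ip; [exact: sqYlP|exact: cvg_cst].
have -> : (fun n => ip (sqY n x) y) = (fun n => ip x (sqY n y)).
  by apply/funext => n; rewrite (nnp_sym (sqY_nnp n)).
by apply: cvg_ip; [exact: cvg_cst|exact: sqYlP].
Qed.

Lemma sqYl_comm (Z : X -> X) : rlin Z -> bnd Z -> (forall x, Z (T x) = T (Z x)) ->
  forall x, Z (sqYl x) = sqYl (Z x).
Proof.
move=> Zl Zb ZT x; apply: (@cvgX_unique _ _ _ \oo _ (fun n => Z (sqY n x))).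
  by apply: cvg_op => //; exact: sqYlP.
have -> : (fun n => Z (sqY n x)) = (fun n => sqY n (Z x)).
  by apply/funext => n; rewrite (nnp_comm Zl ZT (sqY_nnp n)).
exact: sqYlP.
Qed.

Lemma sqYl_eq x : sqYl x = rs 2^-1 (T x + sqYl (sqYl x)).
Proof.
apply: (@cvgX_unique _ _ _ \oo _ (fun n => sqY n.+1 x)).
  by have := @sqYlP x; rewrite -(cvg_shiftS (fun n => sqY n x)).
apply: cvg_rs; apply: cvgD; first exact: cvg_cst.
apply/cvg_nm0P; apply: (@squeeze_cvgr _ _ _ _ (fun=> 0)
  (fun n => nm (sqY n x - sqYl x) + nm (sqY n (sqYl x) - sqYl (sqYl x)))).
- near=> n; rewrite nm_ge0 /=; apply: (le_trans (nm_triangle _ (sqY n (sqYl x)) _)).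
  by rewrite lerD2r -(rlinB (nnp_rlin (sqY_nnp n))) sqY_nm.
- exact: cvg_cst.
- rewrite -[X in _ --> X]addr0; apply: cvgD.
    by apply/cvg_nm0P; exact: sqYlP.
  by apply/cvg_nm0P; exact: sqYlP.
Unshelve. all: by end_near. Qed.

End SquareRoot.

(** * Splitting a bounded symmetric operator by sign *)

Section Splitting.
Context {R : realType} {X : hilbertType R}.
Implicit Types (x y z : X) (a b c : R).

Record oprojection (F : X -> X) : Prop := OProjection {
  op_lin : rlin F; op_idem : forall x, F (F x) = F x; op_sym : rsym F }.

Section OProj.
Variables (F : X -> X) (hF : oprojection F).

Lemma op_ip x : ip (F x) (F x) = ip (F x) x.
Proof. by rewrite (op_sym hF) (op_idem hF) ipC. Qed.

Lemma op_orth x : ip (F x) (x - F x) = 0.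
Proof. by rewrite (op_sym hF) (rlinB (op_lin hF)) (op_idem hF) subrr ip0r. Qed.

Lemma op_pyth x : ip x x = ip (F x) (F x) + ip (x - F x) (x - F x).
Proof.
have h := op_orth x; rewrite -{1 2}(subrK (F x) x).
by rewrite !(ipDl (x - F x)) !(ipDr _ (x - F x)) (ipC (x - F x) (F x)) h; ring.
Qed.

Lemma op_nm x : nm (F x) <= nm x.
Proof. by rewrite le_nm (op_pyth x) lerDl ip_ge0. Qed.

Lemma op_bnd : bnd F.
Proof. by exists 1 => x; rewrite mul1r op_nm. Qed.

End OProj.

Lemma split_contraction (B : X -> X) : rlin B -> rsym B -> (forall x, nm (B x) <= nm x) ->
  exists F, [/\ oprojection F,
   forall Z Z' : X -> X, rlin Z -> rlin Z' -> bnd Z -> bnd Z' ->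
     (forall x y, ip (Z x) y = ip x (Z' y)) ->
     (forall x, Z (B x) = B (Z x)) -> (forall x, Z' (B x) = B (Z' x)) ->
     forall x, Z (F x) = F (Z x),
   forall x, F x = x -> ip (B x) x <= 0,
   forall x, F x = 0 -> 0 <= ip (B x) x &
   forall x, F x = 0 -> ip (B x) x <= 0 -> x = 0].
Proof.
(* F is the projection onto the kernel of |B| + B. *)
move=> Bl Bs Bc.
(* With Y the limit of the iteration for T, the operator C = 1 - Y satisfies C^2 = 1 - T = B^2 and C
   >= 0, so that C is |B|. *)
pose T x := x - B (B x).
have Tl : rlin T by exact: rlin_sub rlin_id (rlin_comp Bl Bl).
have Ts : rsym T by move=> x y; rewrite /T ipDl ipDr ipNl ipNr !Bs.
have Tc x : nm (T x) <= nm x.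
  rewrite le_nm /T !(ipDl, ipDr, ipNl, ipNr).
  have := Bc (B x); rewrite le_nm -(Bs x) (Bs (B x) x) => h.
  have := Bc x; rewrite le_nm => h'; have := ip_ge0 (B x); lra.
pose Y := sqYl Tl Tc; pose C x := x - Y x.
have Yl : rlin Y by exact: sqYl_rlin.
have Yc x : nm (Y x) <= nm x by exact: sqYl_nm.
have Ys : rsym Y by exact: sqYl_sym.
have Cl : rlin C by exact: rlin_sub rlin_id Yl.
have Cs : rsym C by move=> x y; rewrite /C ipDl ipDr ipNl ipNr !Ys.
have Cge x : 0 <= ip (C x) x.
  rewrite /C ipDl ipNl subr_ge0; apply: (le_trans (CS' _ _)).
  by rewrite -nm_sq expr2 ler_wpM2r ?nm_ge0.
have C0 x : ip (C x) x <= 0 -> C x = 0.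
  rewrite /C ipDl ipNl => h.
  have := Yc x; rewrite le_nm => h2.
  by apply: ip_le0; rewrite !(ipDl, ipDr, ipNl, ipNr) (ipC x (Y x)); lra.
have CC x : C (C x) = B (B x).
  have := sqYl_eq Tl Tc x; rewrite -/Y => YE.
  have -> : C (C x) = x - Y x - Y x + Y (Y x).
    by rewrite /C (rlinB Yl); apply: ipext => z; rewrite !(ipDl, ipNl); ring.
  have h z : ip (Y x) z = 2^-1 * (ip x z - ip (B (B x)) z + ip (Y (Y x)) z).
    by rewrite {1}YE ipZl !(ipDl, ipNl).
  by apply: ipext => z; rewrite !(ipDl, ipNl) h; field.
have Ccomm (Z : X -> X) : rlin Z -> bnd Z -> (forall x, Z (B x) = B (Z x)) ->
    forall x, Z (C x) = C (Z x).
  move=> Zl Zb ZB x; rewrite /C (rlinB Zl) (sqYl_comm Tl Tc Zl Zb)// => y.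
  by rewrite /T (rlinB Zl) !ZB.
have Bb : bnd B by exists 1 => x; rewrite mul1r.
have BC x : B (C x) = C (B x) by apply: Ccomm.
pose D x := C x + B x.
have Dl : rlin D by exact: rlin_add.
pose K := [set x | D x = 0].
have sK : real_subspace K.
  split=> [|x y|r x]; rewrite /K /= -?[_ *: _]/(rs _ _).
  - exact: rlin0 Dl.
  - by rewrite (rlinD Dl) => -> ->; rewrite addr0.
  - by rewrite (rlinZ Dl) => ->; rewrite rsr0.
have Db : bnd D.
  exists 3 => x; apply: (le_trans (nmD _ _)).
  have := nmD x (- Y x); rewrite nmN -/(C x); have := Yc x; have := Bc x; lra.
have cK : closed K.
  apply: closed_seq => v x hv vx; apply: (@cvgX_unique _ _ _ \oo _ (fun n => D (v n))).
    exact: cvg_op.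
  have -> : (fun n => D (v n)) = fun=> 0 by apply/funext => n; exact: hv.
  exact: cvg_cst.
(* (B + C)(B - C) = B^2 - C^2 = 0 puts the range of B - C into K; for x orthogonal to K this makes
   |(B - C) x|^2 vanish. *)
have perp x : oproj K x = 0 -> B x = C x.
  move=> x0; have := (oprojP cK sK x).2; rewrite x0 subr0 => h.
  apply/eqP; rewrite -subr_eq0; apply/eqP; apply: ip_eq0.
  have KQ w : K (B w - C w).
    by rewrite /K /= /D (rlinB Cl) (rlinB Bl) CC BC subrKA subrr.
  have := h _ (KQ (B x - C x)); rewrite ipDr ipNr -Bs -Cs => h2.
  by rewrite ipDl ipNl h2.
have onK x : K x -> B x = - C x.
  by rewrite /K /= /D => /eqP; rewrite addrC addr_eq0 => /eqP.
exists (oproj K); split.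
- by split; [exact: oproj_rlin|exact: oprojK|exact: oproj_sym].
(* K is invariant under Z and under its adjoint Z', so Z preserves the orthogonal complement of K as
   well. *)
- move=> Z Z' Zl Zl' Zb Zb' adj ZB ZB' x.
  have ZK y : K y -> K (Z y).
    by rewrite /K /= /D => h; rewrite -ZB -(Ccomm Z)// -(rlinD Zl) h rlin0.
  have ZK' y : K y -> K (Z' y).
    by rewrite /K /= /D => h; rewrite -ZB' -(Ccomm Z')// -(rlinD Zl') h rlin0.
  have [Kp hp] := oprojP cK sK x.
  symmetry; apply: oproj_uniq => //; first exact: ZK.
  by move=> k Kk; rewrite -(rlinB Zl) adj; apply: hp; exact: ZK'.
- move=> x Fx; have /onK -> : K x by rewrite -Fx; case: (oprojP cK sK x).
  by rewrite ipNl oppr_le0.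
- by move=> x /perp ->.
- move=> x Fx; rewrite (perp _ Fx) => /C0 Cx.
  have Kx : K x by rewrite /K /= /D (perp _ Fx) Cx addr0.
  by rewrite -Fx oproj_id.
Qed.

Lemma split_bounded (B : X -> X) c : rlin B -> rsym B -> 0 < c ->
  (forall x, nm (B x) <= c * nm x) ->
  exists F, [/\ oprojection F,
   forall Z Z' : X -> X, rlin Z -> rlin Z' -> bnd Z -> bnd Z' ->
     (forall x y, ip (Z x) y = ip x (Z' y)) ->
     (forall x, Z (B x) = B (Z x)) -> (forall x, Z' (B x) = B (Z' x)) ->
     forall x, Z (F x) = F (Z x),
   forall x, F x = x -> ip (B x) x <= 0,
   forall x, F x = 0 -> 0 <= ip (B x) x &
   forall x, F x = 0 -> ip (B x) x <= 0 -> x = 0].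
Proof.
move=> Bl Bs c0 Bc.
have ci0 : 0 < c^-1 by rewrite invr_gt0.
have [|||F [h1 h2 h3 h4 h5]] := @split_contraction (fun x => rs c^-1 (B x)).
- exact: rlin_rs.
- by move=> x y; rewrite ipZl ipZr Bs.
- by move=> x; rewrite nmZ gtr0_norm// ler_pdivrMl.
exists F; split => //.
- move=> Z Z' Zl Zl' Zb Zb' adj ZB ZB'; apply: (h2 Z Z') => // x; [rewrite (rlinZ (f := Z)) ?ZB//|rewrite (rlinZ (f := Z')) ?ZB'//].
- by move=> x /h3; rewrite ipZl pmulr_rle0.
- by move=> x /h4; rewrite ipZl pmulr_rge0.
- by move=> x /h5 h h'; apply: h; rewrite ipZl pmulr_rle0.
Qed.

(** The squared norms of the Q n x increase and are bounded by that of x, and |Q m x - Q n x|^2 is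
    their increment. *)
Lemma incr_proj (Q : nat -> X -> X) : (forall n, oprojection (Q n)) ->
  (forall n m x, (n <= m)%N -> Q m (Q n x) = Q n x) ->
  forall x, exists y : X, (Q n x) @[n --> \oo] --> y.
Proof.
move=> hQ Qnm x; pose q n := ip (Q n x) (Q n x).
have key n m : (n <= m)%N -> ip (Q m x - Q n x) (Q m x - Q n x) = q m - q n.
  move=> nlem; rewrite !(ipDl, ipDr, ipNl, ipNr) (ipC (Q n x)) -/(q n) -/(q m).
  have -> : ip (Q m x) (Q n x) = q n.
    by rewrite (op_sym (hQ m)) Qnm// ipC -(op_ip (hQ n)).
  ring.
have nd n m : (n <= m)%N -> q n <= q m.
  by move=> /key h; rewrite -subr_ge0 -h ip_ge0.
have [n|l hl le_l] := @ndbnd_cvg R q (ip x x) nd.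
  by rewrite /q -le_nm op_nm.
apply: (@cauchy_nm _ _ (fun n => Q n x) (fun n => Num.sqrt (l - q n))).
  rewrite -[X in _ --> X]sqrtr0; apply: continuous_cvg; first exact: sqrt_continuous.
  by rewrite -(subrr l); apply: cvgB => //; exact: cvg_cst.
by move=> n m nlem; rewrite /nm key// ler_wsqrtr// lerB.
Qed.

End Splitting.

(** * The spectral measure of a generator *)

Section SpectralFamily.
Context {R : realType} {X : hilbertType R}.
Implicit Types (x y z : X) (a b c l m : R).
Variable u : R -> X -> X.
Hypotheses (ug : ugroup u) (ui : forall t x, u t (ii x) = ii (u t x)).

Let P := res u true.
Let P' := res u false.
Let Pl : rlin P := @res_rlin _ _ _ ug true.
Let Pl' : rlin P' := @res_rlin _ _ _ ug false.

(* With A = i d these are (1 + A^2)^-1 and A (1 + A^2)^-1. *)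
Definition specR1 x := rs 2^-1 (P x + P' x).
Definition specR2 x := ii (rs 2^-1 (P x - P' x)).

Let adjP x y : ip (P x) y = ip x (P' y). Proof. exact: @res_adj _ _ _ ug true x y. Qed.
Let adjP' x y : ip (P' x) y = ip x (P y). Proof. exact: @res_adj _ _ _ ug false x y. Qed.
Let Pii x : ii (P x) = P (ii x).
Proof. by apply: (res_comm ug) => //; [exact: rlin_ii|exact: bnd_ii]. Qed.
Let Pii' x : ii (P' x) = P' (ii x).
Proof. by apply: (res_comm ug) => //; [exact: rlin_ii|exact: bnd_ii]. Qed.
Let PnmP x : nm (P x) <= nm x. Proof. exact: res_nm. Qed.
Let PnmP' x : nm (P' x) <= nm x. Proof. exact: res_nm. Qed.

Lemma specR1E x : specR1 x = P (P' x).
Proof. by rewrite /specR1 -(res_mul ug). Qed.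

Lemma specR1_ip x : ip (specR1 x) x = ip (P' x) (P' x).
Proof. by rewrite specR1E adjP. Qed.

Lemma specR1_ge0 x : 0 <= ip (specR1 x) x.
Proof. by rewrite specR1_ip ip_ge0. Qed.

Lemma res0 x : P' x = 0 -> x = 0.
Proof.
move=> h; have := @resP _ _ _ ug false x; rewrite -/P' h /sg rsN1 sub0r opprK => g.
apply: (gen_uniq g).
have -> : (0 : X) = rs 0 x by rewrite rs0.
rewrite rs0 /gen.
have -> : (fun t => rs t^-1 (u t 0 - 0)) = fun=> 0.
  by apply/funext => t; rewrite (rlin0 (ug_lin ug t)) subr0 rsr0.
exact: cvg_cst.
Qed.

Lemma specR1_inj x : ip (specR1 x) x <= 0 -> x = 0.
Proof. by rewrite specR1_ip => /ip_le0/res0. Qed.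

Lemma specR1_lin : rlin specR1. Proof. exact: rlin_rs (rlin_add Pl Pl'). Qed.
Lemma specR2_lin : rlin specR2.
Proof. exact: rlin_comp rlin_ii (rlin_rs _ (rlin_sub Pl Pl')). Qed.

Lemma specR1_sym : rsym specR1.
Proof. by move=> x y; rewrite /specR1 ipZl ipZr ipDl ipDr adjP adjP' addrC. Qed.

Lemma specR2_sym : rsym specR2.
Proof.
move=> x y; rewrite /specR2 ip_iil iiZ ipZl !ipZr iiD iiN Pii Pii'.
by rewrite ipDl ipNl adjP adjP' ipDr ipNr -(Pii y) -(Pii' y); ring.
Qed.

(* (A - l) (1 + A^2)^-1, whose sign is that of A - l. *)
Definition specB l x := specR2 x - rs l (specR1 x).

Lemma specB_lin l : rlin (specB l).
Proof. exact: rlin_sub specR2_lin (rlin_rs _ specR1_lin). Qed.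

Lemma specB_sym l : rsym (specB l).
Proof.
by move=> x y; rewrite /specB ipDl ipDr ipNl ipNr ipZl ipZr specR1_sym specR2_sym.
Qed.

Lemma specB_nm l x : nm (specB l x) <= (1 + `|l|) * nm x.
Proof.
have h1 : nm (specR1 x) <= nm x.
  rewrite /specR1 nmZ ger0_norm ?invr_ge0//.
  have := nmD (P x) (P' x); have := PnmP x; have := PnmP' x; lra.
have h2 : nm (specR2 x) <= nm x.
  rewrite /specR2 nm_ii nmZ ger0_norm ?invr_ge0//.
  have := nmD (P x) (- P' x); rewrite nmN; have := PnmP x; have := PnmP' x; lra.
apply: (le_trans (nmD _ _)); rewrite nmN nmZ mulrDl mul1r lerD//.
by rewrite ler_wpM2l.
Qed.

Lemma specB_ip l x : ip (specB l x) x = ip (specR2 x) x - l * ip (specR1 x) x.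
Proof. by rewrite /specB ipDl ipNl ipZl. Qed.

Lemma specF_ex l : exists F, [/\ oprojection F,
   forall Z Z' : X -> X, rlin Z -> rlin Z' -> bnd Z -> bnd Z' ->
     (forall x y, ip (Z x) y = ip x (Z' y)) ->
     (forall x, Z (specB l x) = specB l (Z x)) -> (forall x, Z' (specB l x) = specB l (Z' x)) ->
     forall x, Z (F x) = F (Z x),
   forall x, F x = x -> ip (specB l x) x <= 0,
   forall x, F x = 0 -> 0 <= ip (specB l x) x &
   forall x, F x = 0 -> ip (specB l x) x <= 0 -> x = 0].
Proof.
apply: (@split_bounded _ _ (specB l) (1 + `|l|)); first exact: specB_lin.
- exact: specB_sym.
- by rewrite ltr_wpDr.
- exact: specB_nm.
Qed.

(** The spectral projection E(]-oo, l]) of A = i d. The point l itself is included, because the form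
    of A - l is strictly positive on the kernel ([specF_gt]). *)
Definition specF l : X -> X := sval (cid (specF_ex l)).

Lemma specF_proj l : oprojection (specF l).
Proof. by rewrite /specF; case: cid => F []. Qed.
Lemma specF_le l x : specF l x = x -> ip (specB l x) x <= 0.
Proof. by rewrite /specF; case: cid => F /= [] _ _ + _ _; apply. Qed.
Lemma specF_ge l x : specF l x = 0 -> 0 <= ip (specB l x) x.
Proof. by rewrite /specF; case: cid => F /= [] _ _ _ + _; apply. Qed.
Lemma specF_gt l x : specF l x = 0 -> ip (specB l x) x <= 0 -> x = 0.
Proof. by rewrite /specF; case: cid => F /= [] _ _ _ _; apply. Qed.

Lemma specF_commB l (Z Z' : X -> X) : rlin Z -> rlin Z' -> bnd Z -> bnd Z' ->
  (forall x y, ip (Z x) y = ip x (Z' y)) ->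
  (forall x, Z (P x) = P (Z x)) -> (forall x, Z (P' x) = P' (Z x)) ->
  (forall x, Z' (P x) = P (Z' x)) -> (forall x, Z' (P' x) = P' (Z' x)) ->
  (forall x, Z (ii x) = ii (Z x)) -> (forall x, Z' (ii x) = ii (Z' x)) ->
  forall x, Z (specF l x) = specF l (Z x).
Proof.
move=> Zl Zl' Zb Zb' adj h1 h2 h1' h2' hi hi'.
have [_ h _ _ _] := svalP (cid (specF_ex l)).
apply: (h Z Z') => // x; rewrite /specB /specR1 /specR2.
  by rewrite (rlinB Zl) hi !(rlinZ Zl) (rlinB Zl) (rlinD Zl) h1 h2.
by rewrite (rlinB Zl') hi' !(rlinZ Zl') (rlinB Zl') (rlinD Zl') h1' h2'.
Qed.

Lemma specF_comm l (Z Z' : X -> X) : rlin Z -> rlin Z' -> bnd Z -> bnd Z' ->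
  (forall x y, ip (Z x) y = ip x (Z' y)) ->
  (forall t x, Z (u t x) = u t (Z x)) -> (forall t x, Z' (u t x) = u t (Z' x)) ->
  (forall x, Z (ii x) = ii (Z x)) -> (forall x, Z' (ii x) = ii (Z' x)) ->
  forall x, Z (specF l x) = specF l (Z x).
Proof.
move=> Zl Zl' Zb Zb' adj h h' hi hi'.
by apply: (@specF_commB l Z Z') => // x; apply: (res_comm ug).
Qed.

Lemma specF_u l t x : u t (specF l x) = specF l (u t x).
Proof.
apply: (@specF_comm l (u t) (u (- t))) => //; try exact: ug_lin.
- by apply: bnd_iso => y; rewrite ug_nm.
- by apply: bnd_iso => y; rewrite ug_nm.
- by move=> y z; rewrite (ug_adj ug).
- by move=> s y; rewrite -!(ugM ug) addrC.
- by move=> s y; rewrite -!(ugM ug) addrC.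
Qed.

Lemma specF_ii l x : ii (specF l x) = specF l (ii x).
Proof.
apply: (@specF_comm l ii (fun x => - ii x)) => //.
- exact: rlin_ii.
- exact: rlin_opp rlin_ii.
- exact: bnd_ii.
- by apply: bnd_iso => y; rewrite nmN nm_ii.
- by move=> y z; rewrite ip_iil ipNr.
- by move=> t y; rewrite (rlinN (ug_lin ug t)) ui.
- by move=> y; rewrite iiN.
Qed.

Lemma specFC l m x : specF l (specF m x) = specF m (specF l x).
Proof.
have Fl := op_lin (specF_proj l); have Fb := op_bnd (specF_proj l).
apply: (@specF_comm m (specF l) (specF l)) => //.
- exact: op_sym (specF_proj l).
- by move=> t y; rewrite specF_u.
- by move=> t y; rewrite specF_u.
- by move=> y; rewrite specF_ii.
- by move=> y; rewrite specF_ii.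
Qed.

(** The difference lies in the range of [specF l], where the form of A - l, and hence that of A - m,
    is nonpositive, and also in the kernel of [specF m], where the latter is strictly positive off
    0. *)
Lemma specF_mono l m x : l <= m -> specF m (specF l x) = specF l x.
Proof.
move=> lm; apply/eqP; rewrite -subr_eq0; apply/eqP.
set y := (X in X = 0).
have ml := op_lin (specF_proj m); have ll := op_lin (specF_proj l).
have y1 : specF m y = 0.
  by rewrite /y (rlinB ml) (op_idem (specF_proj m)) subrr.
have y2 : specF l y = y.
  by rewrite /y (rlinB ll) specFC !(op_idem (specF_proj l)).
apply: specF_gt y1 _; have := specF_le y2.
rewrite !specB_ip; have := specR1_ge0 y; nra.
Qed.

Let Fq l x := ip (specF l x) (specF l x).

Lemma specF_nm_mono x : {homo (fun l => Fq l x) : l m / l <= m}.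
Proof.
move=> l m lm; rewrite /Fq -(specF_mono x lm) specFC -le_nm.
exact: op_nm (specF_proj l) _.
Qed.

Lemma rlin_id' : rlin (@id X). Proof. by []. Qed.

Lemma compl_proj (F : X -> X) : oprojection F -> oprojection (fun x => x - F x).
Proof.
move=> hF; split.
- exact: rlin_sub rlin_id' (op_lin hF).
- by move=> x; rewrite (rlinB (op_lin hF)) (op_idem hF) subrr subr0.
- by move=> x y; rewrite ipDl ipDr ipNl ipNr (op_sym hF).
Qed.

Lemma specF_decr (s : nat -> R) x : (forall n k, (n <= k)%N -> s k <= s n) ->
  exists2 y, (specF (s n) x) @[n --> \oo] --> y & forall n, specF (s n) y = y.
Proof.
move=> sd; have [|n k y nk|z hz] := @incr_proj _ _ (fun n x => x - specF (s n) x) _ _ x.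
- by move=> n; apply: compl_proj; exact: specF_proj.
- rewrite (rlinB (op_lin (specF_proj (s k)))) specFC (specF_mono _ (sd _ _ nk)) subrr subr0//.
have hy : (specF (s n) x) @[n --> \oo] --> x - z.
  have : x - (x - specF (s n) x) @[n --> \oo] --> x - z.
    by apply: cvgB => //; exact: cvg_cst.
  have -> // : (fun n => x - (x - specF (s n) x)) = (fun n => specF (s n) x).
  by apply/funext => n; rewrite opprB addrC subrK.
exists (x - z) => // k.
have H := cvg_op (op_lin (specF_proj (s k))) (op_bnd (specF_proj (s k))) hy.
apply: (cvgX_unique (H _)); apply: cvg_trans hy; apply: near_eq_cvg.
exists k => // n /= kn; rewrite specFC.
by rewrite specFC (specF_mono _ (sd _ _ kn)).
Qed.

(** The limit y of the F_s x for s decreasing to l lies in all ranges of F_s. So the form of A - s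
    at z = y - F_l y is nonpositive for each s, hence for s = l, whereas z lies in the kernel of
    F_l. *)
Lemma specF_rc x : right_continuous (fun l => Fq l x).
Proof.
move=> l.
pose s n : R := l + n.+1%:R^-1.
have sd n k : (n <= k)%N -> s k <= s n.
  by move=> nk; rewrite /s lerD2l lef_pV2 ?posrE// ler_nat.
have ls n : l <= s n by rewrite /s lerDl invr_ge0.
have [y ys ys2] := specF_decr x sd.
have z0 : y - specF l y = 0.
  set z := y - specF l y.
  have z1 : specF l z = 0.
    by rewrite /z (rlinB (op_lin (specF_proj l))) (op_idem (specF_proj l)) subrr.
  have z2 n : specF (s n) z = z.
    by rewrite /z (rlinB (op_lin (specF_proj (s n)))) ys2 specF_mono.
  apply: specF_gt z1 _.
  have H n : ip (specR2 z) z - s n * ip (specR1 z) z <= 0.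
    by rewrite -specB_ip; exact: specF_le.
  rewrite specB_ip.
  have H1 : ip (specR2 z) z - s n * ip (specR1 z) z @[n --> \oo] -->
            ip (specR2 z) z - l * ip (specR1 z) z.
    apply: cvgB; first exact: cvg_cst.
    apply: cvgM; last exact: cvg_cst.
    rewrite -[X in _ --> X]addr0; apply: cvgD; first exact: cvg_cst.
    exact: cvg_harmonic.
  by apply: (ler_cvg_to H1 (cvg_cst 0)); near=> n.
have yE : y = specF l x.
  have H := cvg_op (op_lin (specF_proj l)) (op_bnd (specF_proj l)) ys.
  have : specF l y = specF l x.
    apply: (cvgX_unique (H _)).
    have -> : (fun n => specF l (specF (s n) x)) = fun=> specF l x.
      by apply/funext => n; rewrite specFC specF_mono.
    exact: cvg_cst.
  by move=> <-; apply/eqP; rewrite -subr_eq0 z0.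
have Q : Fq (s n) x @[n --> \oo] --> Fq l x.
  by rewrite /Fq -yE; apply: cvg_ip.
apply/cvgrPdist_le => e e0.
have /cvgrPdist_le/(_ _ e0)[n _ /(_ n (leqnn n)) hn] := Q.
exists (n.+1%:R^-1) => /=; first by rewrite invr_gt0.
move=> m /= lm llm; have lm' : m <= s n.
  by move: lm; rewrite ltr0_norm ?subr_lt0// opprB /s; move: (n.+1%:R^-1) => d; lra.
have h1 := specF_nm_mono x lm'; have h2 := specF_nm_mono x (ltW llm).
have h3 := specF_nm_mono x (ls n).
rewrite distrC ger0_norm ?subr_ge0//; rewrite distrC ger0_norm ?subr_ge0// in hn.
by apply: le_trans hn; rewrite lerD2r.
Unshelve. all: by end_near. Qed.

Let archi0 (p q : R) : 0 <= q -> (forall n : nat, n%:R * q <= p) -> q <= 0.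
Proof.
move=> q0 h; rewrite leNgt; apply/negP => qp.
have := h (Num.truncn (p / q)).+1.
have := truncnS_gt (p / q); rewrite ltr_pdivrMr//; lra.
Qed.

(** The limit y satisfies n <R1 y, y> <= - <R2 y, y> for all n, so <R1 y, y> = 0 and y = 0 by
    injectivity of R1 = (1 + A^2)^-1. The limit at +oo in [specF_y] is symmetric. *)
Lemma specF_Ny x : (specF (- n%:R) x) @[n --> \oo] --> (0 : X).
Proof.
have sd n k : (n <= k)%N -> - k%:R <= - n%:R :> R by rewrite lerN2 ler_nat.
have [y ys ys2] := specF_decr x sd.
suff <- : y = 0 by [].
apply: specR1_inj; apply: (@archi0 (- ip (specR2 y) y)); first exact: specR1_ge0.
by move=> n; have := specF_le (ys2 n); rewrite specB_ip; lra.
Qed.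

Lemma specF_y x : (specF n%:R x) @[n --> \oo] --> x.
Proof.
have [||y hy] := @incr_proj _ _ (fun n => specF n%:R) _ _ x.
- by move=> n; exact: specF_proj.
- by move=> n k z nk; rewrite specF_mono ?ler_nat.
suff xy : x - y = 0 by move/eqP : xy; rewrite subr_eq0 => /eqP xy; rewrite -xy in hy.
have yn n : specF n%:R y = specF n%:R x.
  have H := cvg_op (op_lin (specF_proj n%:R)) (op_bnd (specF_proj n%:R)) hy.
  have K : (fun k : nat => specF n%:R x) @ \oo --> specF n%:R x by exact: cvg_cst.
  apply: (cvgX_unique (H _)); apply: cvg_trans K; apply: near_eq_cvg.
  by exists n => // k /= nk; rewrite specFC specF_mono ?ler_nat.
have y0 n : specF n%:R (x - y) = 0.
  by rewrite (rlinB (op_lin (specF_proj n%:R))) yn subrr.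
apply: specR1_inj; apply: (@archi0 (ip (specR2 (x - y)) (x - y))); first exact: specR1_ge0.
by move=> n; have := specF_ge (y0 n); rewrite specB_ip; lra.
Qed.

End SpectralFamily.

(** * Borel measures on the line and operators given by quadratic forms *)

Section BorelTools.
Context {R : realType}.
Notation BR := (measurableTypeR R).

Lemma ls_measure_ex (q : R -> R) : {homo q : l m / l <= m} -> right_continuous q ->
  exists mu : {measure set BR -> \bar R},
    forall a b : R, a <= b -> mu `]a, b]%classic = (q b - q a)%:E.
Proof.
move=> nd rc.
pose f : cumulative R R := HB.pack q (isCumulative.Build R _ R q nd rc).
exists (lebesgue_stieltjes_measure f) => a b ab.
have h : (wlength f)^*%mu `]a, b]%classic = wlength f `]a, b]%classic.
  by apply: measurable_mu_extE; exact: is_ocitv.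
by apply: (etrans h); rewrite wlength_itv_bnd.
Qed.

(** Dynkin's theorem for the half-open intervals. It gives both the uniqueness of finite measures
    and the existence of the spectral projections. *)
Lemma borel_ind (P : set (set BR)) : P setT ->
  (forall A B : set BR, B `<=` A -> P A -> P B -> P (A `\` B)) ->
  (forall F : nat -> set BR, nondecreasing_seq F -> (forall n, P (F n)) -> P (\bigcup_n F n)) ->
  (forall a b : R, P `]a, b]%classic) ->
  forall B, measurable B -> P B.
Proof.
move=> PT PD Pn Pi B mB.
have L : lambda_system setT P by split.
have G : @ocitv R `<=` P by move=> _ [x _ <-]; exact: Pi.
have := lambda_system_subset (@ocitvI R) L G.
by apply.
Qed.

Lemma finite_measure_unique (m1 m2 : {measure set BR -> \bar R}) :
  (m1 setT < +oo)%E -> m1 setT = m2 setT ->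
  (forall a b : R, m1 `]a, b]%classic = m2 `]a, b]%classic) ->
  forall B, measurable B -> m1 B = m2 B.
Proof.
move=> fin mT mi B mB.
have fin2 : (m2 setT < +oo)%E by rewrite -mT.
have le1 (m : {measure set BR -> \bar R}) A : (m setT < +oo)%E -> measurable A -> (m A < +oo)%E.
  move=> fm mA; apply: le_lt_trans fm; apply: le_measure => //; rewrite inE//.
suff [] : measurable B /\ m1 B = m2 B by [].
apply: (@borel_ind (fun B => measurable B /\ m1 B = m2 B)) => //.
- move=> A C CA [mA hA] [mC hC]; split; first exact: measurableD.
  by rewrite (measureD mA mC (le1 _ _ fin mA)) (measureD mA mC (le1 _ _ fin2 mA)) (setIidr CA); congr (_ - _)%E.
- move=> F ndF hF.
  have mF n : measurable (F n) by case: (hF n).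
  have mU : measurable (\bigcup_n F n) by exact: bigcupT_measurable.
  split=> //.
  have h1 := nondecreasing_cvg_mu (mu := m1) mF mU ndF.
  have h2 := nondecreasing_cvg_mu (mu := m2) mF mU ndF.
  have E : m1 \o F = m2 \o F by apply/funext => n /=; case: (hF n).
  rewrite E in h1; exact: cvg_unique _ h1 h2.
Qed.

End BorelTools.

Section ProjectionTools.
Context {R : realType} {X : hilbertType R}.
Implicit Types (x y z : X) (p q : X -> X).

Lemma rsym_quad_eq p q : rlin p -> rlin q -> rsym p -> rsym q ->
  (forall x, ip (p x) x = ip (q x) x) -> p = q.
Proof.
move=> pl ql ps qs h; apply/funext => x; apply: ipext => z.
have := h (x + z); rewrite (rlinD pl) (rlinD ql) !(ipDl, ipDr).
by rewrite (ps z x) (qs z x) (ipC z) (ipC z (q x)) h h; lra.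
Qed.

Lemma oproj_le p q : oprojection p -> oprojection q ->
  (forall x, ip (p x) x <= ip (q x) x) -> forall x, q (p x) = p x.
Proof.
move=> hp hq h x; have := h (p x); rewrite (op_idem hp) -(op_ip hq) => h2.
have h3 := op_pyth hq (p x).
have : p x - q (p x) = 0 by apply: ip_le0; lra.
by move/eqP; rewrite subr_eq0 => /eqP.
Qed.

Lemma oproj_le_sym p q : oprojection p -> oprojection q ->
  (forall x, q (p x) = p x) -> forall x, p (q x) = p x.
Proof.
by move=> hp hq h x; apply: ipext => z; rewrite (op_sym hp) (op_sym hq) h -(op_sym hp).
Qed.

Lemma oproj_sub p q : oprojection p -> oprojection q ->
  (forall x, q (p x) = p x) -> oprojection (fun x => q x - p x).
Proof.
move=> hp hq h; split.
- exact: rlin_sub (op_lin hq) (op_lin hp).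
- move=> x; rewrite (rlinB (op_lin hq)) (rlinB (op_lin hp)).
  rewrite (op_idem hp) (op_idem hq) h (oproj_le_sym hp hq h).
  by rewrite subrr subr0.
- by move=> x y; rewrite ipDl ipNl ipDr ipNr (op_sym hp) (op_sym hq).
Qed.

Lemma oproj_lim (Q : nat -> X -> X) p : (forall n, oprojection (Q n)) ->
  (forall n m x, (n <= m)%N -> Q m (Q n x) = Q n x) ->
  (forall x, (Q n x) @[n --> \oo] --> p x) -> oprojection p.
Proof.
move=> hQ hnm hp.
have pl : rlin p.
  split=> [x y|r x]; apply: (cvgX_unique (@hp _)).
    have -> : (fun n => Q n (x + y)) = (fun n => Q n x) + (fun n => Q n y).
      by apply/funext => n; rewrite (rlinD (op_lin (hQ n))).
    exact: cvgD.
  have -> : (fun n => Q n (rs r x)) = (fun n => rs r (Q n x)).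
    by apply/funext => n; rewrite (rlinZ (op_lin (hQ n))).
  exact: cvg_rs.
have ps : rsym p.
  move=> x y; apply: (@cvg_unique _ _ ((fun n => ip (Q n x) y) @ \oo)) => //.
    by apply: cvg_ip; [exact: hp|exact: cvg_cst].
  have -> : (fun n => ip (Q n x) y) = (fun n => ip x (Q n y)).
    by apply/funext => n; rewrite (op_sym (hQ n)).
  by apply: cvg_ip; [exact: cvg_cst|exact: hp].
split => // x.
have pQ n y : p (Q n y) = Q n y.
  apply: (cvgX_unique (@hp _)).
  have K : (fun k : nat => Q n y) @ \oo --> Q n y by exact: cvg_cst.
  apply: cvg_trans K; apply: near_eq_cvg; exists n => // k /= nk.
  by rewrite hnm.
have pb : bnd p.
  exists 1 => y; rewrite mul1r; apply: (ler_cvg_to (cvg_nm _ (@hp y)) (cvg_cst (nm y))).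
  by near=> n; exact: op_nm.
have H := cvg_op pl pb (@hp x).
apply: (cvgX_unique (H _)).
have -> : (fun n => p (Q n x)) = (fun n => Q n x) by apply/funext.
exact: hp.
Unshelve. all: by end_near. Qed.

Lemma oproj_quad1 p : oprojection p -> (forall x, ip (p x) x = ip x x) -> p = id.
Proof.
by move=> hp h; apply: rsym_quad_eq => //; [exact: op_lin|exact: op_sym].
Qed.

Lemma oprojection_hdot p : oprojection p -> (forall x, ii (p x) = p (ii x)) ->
  orthogonal_projection p.
Proof.
move=> hp hi; split.
- move=> a x y; rewrite (rlinD (op_lin hp)); congr (_ + _).
  have -> z : a *: z = rs (complex.Re a) z + rs (complex.Im a) (ii z).
    by rewrite /rs /ii scalerA -scalerDl; congr (_ *: _); rewrite mulrC -complexiE -complexE.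
  have -> z : a *: z = rs (complex.Re a) z + rs (complex.Im a) (ii z).
    by rewrite /rs /ii scalerA -scalerDl; congr (_ *: _); rewrite mulrC -complexiE -complexE.
  by rewrite (rlinD (op_lin hp)) !(rlinZ (op_lin hp)) hi.
- exact: op_idem.
- by move=> x y; rewrite !hdotE !(op_sym hp) hi.
Qed.

Lemma hdot_oprojection p : orthogonal_projection p -> oprojection p.
Proof.
move=> [h1 h2 h3]; split => //.
- have hD x y : p (x + y) = p x + p y by have := h1 1 x y; rewrite !scale1r.
  split=> // r x; have := h1 r%:C x 0; rewrite addr0.
  have -> : p 0 = 0 by apply: (addrI (p 0)); rewrite -hD !addr0.
  by rewrite addr0.
- by move=> x y; rewrite /ip h3.
Qed.

Lemma hdot_oproj_ii p : orthogonal_projection p -> forall x, p (ii x) = ii (p x).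
Proof.
move=> hp x; have [h1 _ _] := hp; have := h1 'i x 0.
by rewrite !addr0 (rlin0 (op_lin (hdot_oprojection hp))) addr0.
Qed.

End ProjectionTools.

(** * From the spectral family to a projection-valued measure *)

Section SpectralMeasure.
Context {R : realType} {X : hilbertType R}.
Implicit Types (x y z : X).
Variable u : R -> X -> X.
Hypotheses (ug : ugroup u) (ui : forall t x, u t (ii x) = ii (u t x)).
Notation BR := (measurableTypeR R).
Notation F := (specF ug ui).

Let mu_ex x := ls_measure_ex (@specF_nm_mono _ _ _ ug ui x) (@specF_rc _ _ _ ug ui x).
Let mu x : {measure set BR -> \bar R} := sval (cid (mu_ex x)).

Let muE x a b : a <= b -> mu x `]a, b]%classic =
  (ip (F b x) (F b x) - ip (F a x) (F a x))%:E.
Proof. by rewrite /mu; case: cid => m /= h; exact: h. Qed.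

Let muT x : mu x setT = (ip x x)%:E.
Proof.
pose S n : set BR := `](- n%:R), n%:R]%classic.
have mS n : measurable (S n) by exact: measurable_itv.
have -> : [set: BR] = \bigcup_n S n.
  apply/esym; rewrite -subTset => t _; exists (Num.truncn `|t|).+1 => //.
  rewrite /S /= in_itv /=; have := truncnS_gt `|t|.
  by rewrite ltr_norml => /andP[-> /ltW].
have mU : measurable (\bigcup_n S n) by exact: bigcupT_measurable.
have ndS : nondecreasing_seq S.
  move=> n m nm; apply/subsetPset => t; rewrite /S /= !in_itv /=.
  have : n%:R <= m%:R :> R by rewrite ler_nat.
  by move=> h /andP[h1 h2]; apply/andP; split; lra.
have h1 := nondecreasing_cvg_mu (mu := mu x) mS mU ndS.
apply: (cvg_unique _ h1); first exact: ereal_hausdorff.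
have -> : mu x \o S = EFin \o (fun n => ip (F n%:R x) (F n%:R x) - ip (F (- n%:R) x) (F (- n%:R) x)).
  by apply/funext => n; rewrite /= muE// ge0_cp// ler0n.
apply: cvg_EFin; first by near=> n.
rewrite -[X in _ --> X]subr0 -[X in _ --> _ - X](ip0l (0 : X)).
apply: cvgB; apply: cvg_ip; try exact: specF_y; exact: specF_Ny.
Unshelve. all: by end_near. Qed.

Let isE (B : set BR) (p : X -> X) := oprojection p /\ forall x, mu x B = (ip (p x) x)%:E.

Let FF a b : a <= b -> isE `]a, b]%classic (fun x => F b x - F a x).
Proof.
move=> ab; split.
  by apply: oproj_sub; [exact: specF_proj|exact: specF_proj|move=> x; exact: specF_mono].
by move=> x; rewrite muE// ipDl ipNl !(op_ip (specF_proj _ _ _)).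
Qed.

(** Comparing quadratic forms compares projections, so that a nested pair of projections has a
    projection as difference and an increasing sequence has one as limit; this is what Dynkin's
    theorem asks for. *)
Let E_ex (B : set BR) : measurable B -> exists p, isE B p.
Proof.
move=> mB; suff [] : measurable B /\ exists p, isE B p by [].
apply: (@borel_ind R (fun B => measurable B /\ exists p, isE B p)) => //.
- split => //; exists id; split; first by split.
  by move=> x; rewrite muT.
- move=> A C CA [mA [p [hp pE]]] [mC [q [hq qE]]]; split; first exact: measurableD.
  have qp x : p (q x) = q x.
    apply: oproj_le => // y; rewrite -lee_fin -pE -qE; apply: le_measure => //; by rewrite inE.
  exists (fun x => p x - q x); split; first exact: oproj_sub.
  move=> x; have hlt : (mu x A < +oo)%E by rewrite pE ltry.
  rewrite (measureD mA mC hlt) (setIidr CA) ipDl ipNl EFinB.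
  by congr (_ - _)%E; [exact: pE|exact: qE].
- move=> S ndS hS.
  have mS n : measurable (S n) by case: (hS n).
  have mU : measurable (\bigcup_n S n) by exact: bigcupT_measurable.
  have /choice[Q hQ] : forall n, exists p, isE (S n) p by move=> n; case: (hS n).
  have Qp n : oprojection (Q n) by case: (hQ n).
  have Qnm n m x : (n <= m)%N -> Q m (Q n x) = Q n x.
    move=> nm; apply: oproj_le => // y; rewrite -lee_fin.
    have [_ <-] := hQ n; have [_ <-] := hQ m.
    by apply: le_measure; rewrite ?inE//; apply/subsetPset; exact: ndS.
  have /choice[p hp] := incr_proj Qp Qnm.
  split => //; exists p; split; first exact: oproj_lim Qp Qnm _.
  move=> x; have h1 := nondecreasing_cvg_mu (mu := mu x) mS mU ndS.
  apply: (cvg_unique _ h1); first exact: ereal_hausdorff.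
  have -> : mu x \o S = EFin \o (fun n => ip (Q n x) x).
    by apply/funext => n /=; have [_ ->] := hQ n.
  apply: cvg_EFin; first by near=> n.
  by apply: cvg_ip; [exact: hp|exact: cvg_cst].
- move=> a b; split; first exact: measurable_itv.
  have [ab|ba] := leP a b; first by eexists; exact: FF.
  exists (fun=> 0); split.
    split=> [|//|x y]; last by rewrite ip0l ip0r.
    by split=> [x y|r x]; rewrite ?addr0 ?rsr0.
  by move=> x; rewrite set_itv_ge ?measure0 ?ip0l// bnd_simp -leNgt ltW.
Unshelve. all: by end_near. Qed.

Let E (B : set BR) : X -> X :=
  if pselect (measurable B) is left mB then sval (cid (E_ex mB)) else id.

Let EP B : measurable B -> isE B (E B).
Proof. by move=> mB; rewrite /E; case: pselect => // mB'; case: cid. Qed.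

Let mu_iso (Z : X -> X) x : (forall y, nm (Z y) = nm y) -> (forall l y, Z (F l y) = F l (Z y)) ->
  forall B, measurable B -> mu (Z x) B = mu x B.
Proof.
move=> Zn ZF; apply: finite_measure_unique.
- by rewrite muT ltry.
- by rewrite !muT -!nm_sq Zn.
- move=> a b; have [ab|ba] := leP a b.
    by rewrite !muE// -!nm_sq -!ZF !Zn.
  by rewrite set_itv_ge ?measure0// bnd_simp -leNgt ltW.
Qed.

(** An isometry commuting with the spectral family leaves the scalar measures unchanged, since they
    agree on half-open intervals; polarization turns equality of forms into commutation. *)
Let E_comm (Z : X -> X) B : rlin Z -> (forall y, nm (Z y) = nm y) -> (forall y, exists x, Z x = y) ->
  (forall l y, Z (F l y) = F l (Z y)) -> measurable B -> forall x, Z (E B x) = E B (Z x).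
Proof.
move=> Zl Zn Zs ZF mB x; have [hp pE] := EP mB.
have Zip := iso_ip Zl Zn.
have quad y : ip (E B (Z y)) (Z y) = ip (E B y) y.
  by have := mu_iso y Zn ZF mB; rewrite !pE => -[].
apply: ipext => w; have [z <-] := Zs w; rewrite Zip.
have := quad (x + z); rewrite (rlinD Zl) !(rlinD (op_lin hp)) !(ipDl, ipDr) !quad.
have e1 a b : ip (E B a) b = ip (E B b) a by rewrite (op_sym hp) ipC.
rewrite (e1 (Z z)) (e1 z); lra.
Qed.

Lemma spectral_pvm_ex : exists2 E : pvm X,
  (forall a b, a <= b -> forall x, pvm_proj E `]a, b]%classic x = F b x - F a x) &
  forall t B x, measurable B -> u t (pvm_proj E B x) = pvm_proj E B (u t x).
Proof.
have Eii B : measurable B -> forall x, ii (E B x) = E B (ii x).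
  apply: E_comm; first exact: rlin_ii.
  - exact: nm_ii.
  - by move=> y; exists (- ii y); rewrite iiN iiK opprK.
  - by move=> l y; rewrite specF_ii.
have h1 B : measurable B -> orthogonal_projection (E B).
  by move=> mB; apply: oprojection_hdot; [case: (EP mB)|exact: Eii].
have h2 x : E setT x = x.
  have [hp pE] := EP (@measurableT _ BR).
  suff -> : E setT = id by [].
  by apply: oproj_quad1 => // y; have := pE y; rewrite muT => -[].
have h3 x B : measurable B -> mu x B = (complex.Re (hdot (E B x) x))%:E.
  by move=> mB; have [_ ->] := EP mB.
exists (Pvm h1 h2 h3) => /=.
  move=> a b ab x; have mB : measurable (`]a, b]%classic : set BR) by exact: measurable_itv.
  have [hp pE] := EP mB; have [hq qE] := FF ab.
  suff -> : E `]a, b]%classic = (fun x => F b x - F a x) by [].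
  apply: rsym_quad_eq; [exact: op_lin|exact: op_lin|exact: op_sym|exact: op_sym|].
  by move=> y; have := pE y; rewrite qE => -[].
move=> t B x mB; apply: E_comm => //.
- exact: ug_lin.
- exact: ug_nm.
- by move=> y; exists (u (- t) y); rewrite (ugNK ug).
- by move=> l y; rewrite specF_u.
Qed.

End SpectralMeasure.

(** * Calculus of projection-valued measures *)

Section PvmBasics.
Context {R : realType} {X : hilbertType R}.
Implicit Types (x y z : X).
Notation BR := (measurableTypeR R).
Implicit Types (A B : set BR).
Variable E : pvm X.
Notation e := (pvm_proj E).
Notation m := (pvm_meas E).

Lemma pvm_oproj B : measurable B -> oprojection (e B).
Proof. by move=> mB; apply: hdot_oprojection; exact: pvm_projP. Qed.

Lemma pvm_ii B x : measurable B -> e B (ii x) = ii (e B x).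
Proof. by move=> mB; apply: hdot_oproj_ii; exact: pvm_projP. Qed.

Lemma pvm_mE B x : measurable B -> m x B = (ip (e B x) x)%:E.
Proof. exact: pvm_measE. Qed.

Lemma pvm_mT x : m x setT = (ip x x)%:E.
Proof. by rewrite pvm_mE// pvm_projT. Qed.

Lemma pvm_mfin x B : measurable B -> (m x B < +oo)%E.
Proof. by move=> mB; rewrite pvm_mE// ltry. Qed.

Lemma pvm_nm B x : measurable B -> nm (e B x) <= nm x.
Proof. by move=> mB; apply: op_nm; exact: pvm_oproj. Qed.

Lemma pvm_le A B x : measurable A -> measurable B -> A `<=` B -> e B (e A x) = e A x.
Proof.
move=> mA mB AB; apply: oproj_le; [exact: pvm_oproj|exact: pvm_oproj|] => y.
by rewrite -lee_fin -!pvm_mE//; apply: le_measure => //; rewrite inE.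
Qed.

Lemma pvm_U A B x : measurable A -> measurable B -> A `&` B = set0 ->
  e (A `|` B) x = e A x + e B x.
Proof.
move=> mA mB AB; have mU : measurable (A `|` B) by exact: measurableU.
suff -> : e (A `|` B) = (fun x => e A x + e B x) by [].
apply: rsym_quad_eq.
- exact: op_lin (pvm_oproj mU).
- exact: rlin_add (op_lin (pvm_oproj mA)) (op_lin (pvm_oproj mB)).
- exact: op_sym (pvm_oproj mU).
- by move=> y z; rewrite ipDl ipDr (op_sym (pvm_oproj mA)) (op_sym (pvm_oproj mB)).
- move=> y; apply: EFin_inj; rewrite -(pvm_mE y mU).
  have -> : m y (A `|` B) = (m y A + m y B)%E by apply: measureU.
  by rewrite !pvm_mE// ipDl EFinD.
Qed.

(** e(A) + e(B) = e(A [|] B) is a contraction, so applied to e(B) x it leaves no room for e(A) e(B)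
    x. *)
Lemma pvm_disj A B x : measurable A -> measurable B -> A `&` B = set0 -> e A (e B x) = 0.
Proof.
move=> mA mB AB; have mU : measurable (A `|` B) by exact: measurableU.
have := op_nm (pvm_oproj mU) (e B x); rewrite le_nm (op_ip (pvm_oproj mU)) pvm_U//.
rewrite (op_idem (pvm_oproj mB)) ipDl -(op_ip (pvm_oproj mA)) => h.
by apply: ip_le0; lra.
Qed.

Lemma pvm_I A B x : measurable A -> measurable B -> e A (e B x) = e (A `&` B) x.
Proof.
move=> mA mB.
have mI : measurable (A `&` B) by exact: measurableI.
have mAD : measurable (A `\` B) by exact: measurableD.
have mBD : measurable (B `\` A) by exact: measurableD.
have dec (C D : set BR) : (C `\` D) `|` (C `&` D) = C.
  apply/seteqP; split=> t; first by case=> -[].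
  by move=> Ct; case: (pselect (D t)) => ?; [right|left].
have dj (C D : set BR) : (C `\` D) `&` (C `&` D) = set0.
  by apply/seteqP; split=> t //= [[_ ?] [_ ?]].
have eA y : e A y = e (A `\` B) y + e (A `&` B) y.
  by rewrite -pvm_U ?dec.
have eB y : e B y = e (B `\` A) y + e (A `&` B) y.
  have mI' : measurable (B `&` A) by rewrite setIC.
  by rewrite (setIC A) -pvm_U ?dec.
rewrite eA eB !(rlinD (op_lin (pvm_oproj mAD))) !(rlinD (op_lin (pvm_oproj mI))).
rewrite (op_idem (pvm_oproj mI)).
rewrite !pvm_disj ?add0r//; by apply/seteqP; split=> t //= [[? ?] [? ?]].
Qed.

Lemma pvm_cvg (S : nat -> set BR) x : (forall n, measurable (S n)) -> nondecreasing_seq S ->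
  \bigcup_n S n = setT -> (e (S n) x) @[n --> \oo] --> x.
Proof.
move=> mS ndS ST.
have mU : measurable (\bigcup_n S n) by exact: bigcupT_measurable.
have h1 := nondecreasing_cvg_mu (mu := m x) mS mU ndS.
have h2 : ip (e (S n) x) x @[n --> \oo] --> ip x x.
  move: h1; rewrite ST pvm_mT.
  have -> : m x \o S = EFin \o (fun n => ip (e (S n) x) x).
    by apply/funext => n; rewrite /= pvm_mE.
  by move=> /fine_cvg.
apply/cvg_nm0P; rewrite -[X in _ --> X]sqrtr0.
have -> : (fun n => nm (e (S n) x - x)) = (fun n => Num.sqrt (ip x x - ip (e (S n) x) x)).
  apply/funext => n; rewrite nmB /nm; congr (Num.sqrt _).
  rewrite -(op_ip (pvm_oproj (mS n))).
  have := op_pyth (pvm_oproj (mS n)) x; lra.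
apply: continuous_cvg; first exact: sqrt_continuous.
by rewrite -(subrr (ip x x)); apply: cvgB => //; exact: cvg_cst.
Qed.

End PvmBasics.

(** * Integrals of bounded functions *)

Section Calculus.
Context {R : realType} {X : hilbertType R}.
Implicit Types (x y z : X).
Notation BR := (measurableTypeR R).
Implicit Types (A B : set BR) (f g h : BR -> R) (s : seq (R * set BR)).

Definition smeas s : Prop := forall c, c \in s -> measurable c.2.
(** The sets of the list may overlap, so that sums are concatenations and products are lists of
    pairs, without refining partitions. *)
Definition sfun s (t : BR) : R := \sum_(c <- s) c.1 * \1_(c.2) t.
Definition sop (E : pvm X) s x : X := \sum_(c <- s) rs c.1 (pvm_proj E c.2 x).
Definition sneg s := [seq (- c.1, c.2) | c <- s].
Definition smul s s' := [seq (c.1 * d.1, c.2 `&` d.2) | c <- s, d <- s'].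

Lemma smeas_cons c s : smeas (c :: s) -> measurable c.2 /\ smeas s.
Proof. by move=> h; split; [apply: h; rewrite inE eqxx|move=> d ds; apply: h; rewrite inE ds orbT]. Qed.

Lemma smeas_cat s s' : smeas s -> smeas s' -> smeas (s ++ s').
Proof. by move=> h h' c; rewrite mem_cat => /orP[/h|/h']. Qed.

Lemma smeas_neg s : smeas s -> smeas (sneg s).
Proof. by move=> h c /mapP[d ds ->] /=; exact: (h d ds). Qed.

Lemma smeas_mul s s' : smeas s -> smeas s' -> smeas (smul s s').
Proof.
by move=> h h' c /allpairsP[[d d'] [ds ds' ->]]; apply: measurableI; [exact: h|exact: h'].
Qed.

Lemma sfun_cons c s t : sfun (c :: s) t = c.1 * \1_(c.2) t + sfun s t.
Proof. by rewrite /sfun big_cons. Qed.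
Lemma sfun_cat s s' t : sfun (s ++ s') t = sfun s t + sfun s' t.
Proof. by rewrite /sfun big_cat. Qed.
Lemma sfun_neg s t : sfun (sneg s) t = - sfun s t.
Proof. by rewrite /sfun big_map -sumrN; apply: eq_bigr => c _; rewrite mulNr. Qed.
Lemma sfun_mul s s' t : sfun (smul s s') t = sfun s t * sfun s' t.
Proof.
rewrite /sfun /smul big_allpairs_dep mulr_suml; apply: eq_bigr => c _.
rewrite mulr_sumr; apply: eq_bigr => d _.
by rewrite /= indicI /= mulrACA.
Qed.

Lemma sfun_meas s : smeas s -> measurable_fun setT (sfun s).
Proof.
elim: s => [_|c s IH /smeas_cons[mc /IH ms]].
  have -> : sfun [::] = cst 0 by apply/funext => t; rewrite /sfun big_nil.
  exact: measurable_cst.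
have -> : sfun (c :: s) = (fun t => c.1 * \1_(c.2) t + sfun s t).
  by apply/funext => t; rewrite sfun_cons.
by apply: measurable_funD => //; apply: measurable_funM => //; exact: measurable_indic.
Qed.

Definition bmf g : Prop := measurable_fun setT g /\ exists2 c, 0 <= c & forall t, `|g t| <= c.

Lemma bmf_mul g h : bmf g -> bmf h -> bmf (fun t => g t * h t).
Proof.
move=> [mg [c c0 gc]] [mh [d d0 hd]]; split; first exact: measurable_funM.
by exists (c * d); [exact: mulr_ge0|move=> t; rewrite normrM ler_pM].
Qed.

Lemma bmf_add g h : bmf g -> bmf h -> bmf (fun t => g t + h t).
Proof.
move=> [mg [c c0 gc]] [mh [d d0 hd]]; split; first exact: measurable_funD.
exists (c + d); first exact: addr_ge0.
by move=> t; apply: (le_trans (ler_normD _ _)); exact: lerD.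
Qed.

Lemma bmf_cst c : bmf (fun=> c).
Proof. by split; [exact: measurable_cst|exists `|c|]. Qed.

Lemma bmf_indic B : measurable B -> bmf \1_B.
Proof.
move=> mB; split; first exact: measurable_indic.
by exists 1 => // t; rewrite indicE; case: (_ \in _); rewrite ?normr1 ?normr0.
Qed.

Lemma bmf_sfun s : smeas s -> bmf (sfun s).
Proof.
move=> ms; split; first exact: sfun_meas.
elim: s {ms} => [|c s [d d0 hd]].
  by exists 0 => // t; rewrite /sfun big_nil normr0.
exists (`|c.1| + d); first by rewrite addr_ge0.
move=> t; rewrite sfun_cons; apply: (le_trans (ler_normD _ _)); apply: lerD => //.
rewrite normrM -[leRHS]mulr1 ler_wpM2l// indicE.
by case: (_ \in _); rewrite ?normr1 ?normr0.
Qed.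

Lemma simple_approx g d : bmf g -> 0 < d ->
  exists2 s, smeas s & forall t, `|g t - sfun s t| <= d.
Proof.
move=> [mg [c c0 gc]] d0.
(* [g] is rounded down to the grid of step d that starts at - c; as |g| <= c, finitely many cells
   occur. *)
pose k t := Num.truncn ((g t + c) / d).
have pos t : 0 <= (g t + c) / d.
  rewrite divr_ge0 ?(ltW d0)//; have := gc t; rewrite ler_norml => /andP[]; lra.
have kP t : (k t)%:R * d - c <= g t /\ g t < (k t).+1%:R * d - c.
  have /andP[h1 h2] := Num.Theory.truncn_itv (pos t); rewrite -/(k t) in h1 h2.
  by move: h1 h2; rewrite ler_pdivlMr// ltr_pdivrMr//; lra.
have kN t : (k t < (Num.truncn (2 * c / d)).+1)%N.
  rewrite ltnS /k; apply: le_truncn; rewrite ler_pM2r ?invr_gt0//.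
  have := gc t; rewrite ler_norml => /andP[]; lra.
set N := (Num.truncn (2 * c / d)).+1 in kN.
pose B n : set BR := [set t | k t = n].
have BE n : B n = g @^-1` `[n%:R * d - c, n.+1%:R * d - c[%classic.
  apply/seteqP; split=> t; rewrite /B /= in_itv /=.
    by move=> <-; have [-> ->] := kP t.
  move=> /andP[h1 h2].
  have h3 : n%:R <= (g t + c) / d by rewrite ler_pdivlMr//; lra.
  have h4 : (g t + c) / d < n.+1%:R by rewrite ltr_pdivrMr//; lra.
  by apply/eqP; rewrite /k truncn_eq// h3 h4.
exists [seq (n%:R * d - c, B n) | n <- iota 0 N].
  move=> _ /mapP[n _ ->] /=; rewrite BE -[X in measurable X]setTI.
  by apply: mg => //; exact: measurable_itv.
move=> t; rewrite /sfun big_map.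
rewrite (bigD1_seq (k t)) ?mem_iota ?iota_uniq//= big1 ?addr0; last first.
  move=> n nk; rewrite indicE memNset ?mulr0//= /B /=.
  by move=> kn; rewrite kn eqxx in nk.
rewrite indicE mem_set ?mulr1//; have [h1 h2] := kP t.
rewrite ger0_norm ?subr_ge0//.
by move: h2; rewrite -natr1 mulrDl mul1r; lra.
Qed.

Section Ops.
Variable E : pvm X.
Notation e := (pvm_proj E).
Notation m := (pvm_meas E).

Definition pI x f : R := \int[m x]_t f t.

Lemma bmf_int x g : bmf g -> (m x).-integrable setT (EFin \o g).
Proof.
move=> [mg [c c0 gc]]; apply: measurable_bounded_integrable => //.
  by rewrite pvm_mfin.
by exists c; split; [exact: num_real|move=> d cd t _; apply: (le_trans (gc t)); exact: ltW].
Qed.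

Lemma pI_add x g h : bmf g -> bmf h -> pI x (fun t => g t + h t) = pI x g + pI x h.
Proof. by move=> bg bh; apply: RintegralD => //; exact: bmf_int. Qed.

Lemma pI_scale x c g : bmf g -> pI x (fun t => c * g t) = c * pI x g.
Proof. by move=> bg; apply: RintegralZl => //; exact: bmf_int. Qed.

Lemma pI_indic x B : measurable B -> pI x \1_B = ip (e B x) x.
Proof.
move=> mB; rewrite /pI /Rintegral.
have -> : (\int[m x]_t (\1_B t)%:E)%E = m x (B `&` setT) by exact: integral_indic.
by rewrite setIT pvm_mE.
Qed.

Lemma pI_cst x c : pI x (fun=> c) = c * ip x x.
Proof. by rewrite /pI Rintegral_cst// pvm_mT. Qed.

Lemma pI_le x g h : bmf g -> bmf h -> (forall t, g t <= h t) -> pI x g <= pI x h.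
Proof. by move=> bg bh gh; apply: le_Rintegral => //; exact: bmf_int. Qed.

Lemma pI_bound x g c : bmf g -> (forall t, `|g t| <= c) -> `|pI x g| <= c * ip x x.
Proof.
move=> bg gc; rewrite ler_norml; apply/andP; split.
  rewrite -mulNr -pI_cst; apply: pI_le => //; first exact: bmf_cst.
  by move=> t; have := gc t; rewrite ler_norml => /andP[].
rewrite -pI_cst; apply: pI_le => //; first exact: bmf_cst.
by move=> t; have := gc t; rewrite ler_norml => /andP[].
Qed.

Lemma sop_cons c s x : sop E (c :: s) x = rs c.1 (e c.2 x) + sop E s x.
Proof. by rewrite /sop big_cons. Qed.
Lemma sop_nil x : sop E [::] x = 0.
Proof. by rewrite /sop big_nil. Qed.
Lemma sop_cat s s' x : sop E (s ++ s') x = sop E s x + sop E s' x.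
Proof. by rewrite /sop big_cat. Qed.
Lemma sop_neg s x : sop E (sneg s) x = - sop E s x.
Proof.
rewrite /sop big_map -sumrN; apply: eq_bigr => c _ /=.
by rewrite /rs rmorphN scaleNr.
Qed.

Lemma sop_rlin s : smeas s -> rlin (sop E s).
Proof.
elim: s => [_|c s IH /smeas_cons[mc /IH ms]].
  by split=> *; rewrite !sop_nil ?addr0 ?rsr0.
have -> : sop E (c :: s) = (fun x => rs c.1 (e c.2 x) + sop E s x).
  by apply/funext => x; rewrite sop_cons.
exact: rlin_add (rlin_rs _ (op_lin (pvm_oproj E mc))) ms.
Qed.

Lemma sop_sym s : smeas s -> rsym (sop E s).
Proof.
elim: s => [_|c s IH /smeas_cons[mc /IH ms]] x y; first by rewrite !sop_nil ip0l ip0r.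
by rewrite !sop_cons ipDl ipDr ms ipZl ipZr (op_sym (pvm_oproj E mc)).
Qed.

Lemma pI_sfun s x : smeas s -> pI x (sfun s) = ip (sop E s x) x.
Proof.
elim: s => [_|c s IH /smeas_cons[mc ms]].
  have -> : sfun [::] = fun=> 0 by apply/funext => t; rewrite /sfun big_nil.
  by rewrite pI_cst sop_nil mul0r ip0l.
have -> : sfun (c :: s) = (fun t => c.1 * \1_(c.2) t + sfun s t).
  by apply/funext => t; rewrite sfun_cons.
rewrite pI_add; last exact: bmf_sfun.
  by rewrite pI_scale ?pI_indic ?IH//; [rewrite sop_cons ipDl ipZl|exact: bmf_indic].
by apply: bmf_mul; [exact: bmf_cst|exact: bmf_indic].
Qed.

Lemma sop_mul s s' x : smeas s -> smeas s' -> sop E (smul s s') x = sop E s (sop E s' x).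
Proof.
move=> hs hs'; rewrite /sop /smul big_allpairs_dep big_seq [RHS]big_seq.
apply: eq_bigr => c cs; have mc := hs _ cs.
have -> : e c.2 (\sum_(d <- s') rs d.1 (e d.2 x)) = \sum_(d <- s') rs (d.1) (e (c.2 `&` d.2) x).
  elim: s' hs' => [_|d s' IH /smeas_cons[md ms]].
    by rewrite !big_nil (rlin0 (op_lin (pvm_oproj E mc))).
  rewrite !big_cons (rlinD (op_lin (pvm_oproj E mc))) IH//.
  by rewrite (rlinZ (op_lin (pvm_oproj E mc))) pvm_I.
rewrite /rs scaler_sumr; apply: eq_bigr => d _ /=.
by rewrite scalerA -rmorphM.
Qed.

(** |sop s x|^2 is the integral of the square of the function, so the bound depends on the function
    alone and not on the overlapping sets that represent it. *)
Lemma sop_nm s c x : smeas s -> 0 <= c -> (forall t, `|sfun s t| <= c) -> nm (sop E s x) <= c * nm x.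
Proof.
move=> ms c0 sc; rewrite -ler_sqr ?nnegrE ?mulr_ge0 ?nm_ge0//.
rewrite exprMn !nm_sq.
have -> : ip (sop E s x) (sop E s x) = pI x (sfun (smul s s)).
  by rewrite pI_sfun ?sop_mul ?sop_sym//; exact: smeas_mul.
apply: le_trans (ler_norm _) _; apply: pI_bound; first by apply: bmf_sfun; exact: smeas_mul.
by move=> t; rewrite sfun_mul normrM expr2 ler_pM.
Qed.

Lemma sop_close s s' c x : smeas s -> smeas s' -> 0 <= c ->
  (forall t, `|sfun s t - sfun s' t| <= c) -> nm (sop E s x - sop E s' x) <= c * nm x.
Proof.
move=> ms ms' c0 h; rewrite -sop_neg -sop_cat; apply: sop_nm => //.
  by apply: smeas_cat => //; exact: smeas_neg.
by move=> t; rewrite sfun_cat sfun_neg.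
Qed.

(** The estimate is claimed for every approximation s and not just for the sequence that produces y,
    so that later proofs can use one s for several vectors. *)
Lemma Mop_ex g x : bmf g -> exists y, forall s d, smeas s -> 0 <= d ->
  (forall t, `|g t - sfun s t| <= d) -> nm (y - sop E s x) <= d * nm x.
Proof.
move=> bg.
have dpos n : 0 < n.+1%:R^-1 :> R by rewrite invr_gt0.
have /choice[S hS] : forall n, exists s, smeas s /\ forall t, `|g t - sfun s t| <= n.+1%:R^-1.
  by move=> n; have [s ms hs] := simple_approx bg (dpos n); exists s.
have key n s d : smeas s -> 0 <= d -> (forall t, `|g t - sfun s t| <= d) ->
    nm (sop E (S n) x - sop E s x) <= (n.+1%:R^-1 + d) * nm x.
  move=> ms d0 hd; have [mS hn] := hS n; apply: sop_close => //.
    by rewrite addr_ge0// ltW.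
  move=> t; have -> : sfun (S n) t - sfun s t = (g t - sfun s t) - (g t - sfun (S n) t) by ring.
  by apply: (le_trans (ler_normB _ _)); rewrite addrC lerD.
have [y hy] : exists y : X, (sop E (S n) x) @[n --> \oo] --> y.
  apply: (@cauchy_nm _ _ (fun n => sop E (S n) x) (fun n => (2 * n.+1%:R^-1) * nm x)).
    rewrite -[X in _ --> X](mul0r (nm x)); apply: cvgM; last exact: cvg_cst.
    by rewrite -[X in _ --> X](mulr0 2); apply: cvgM; [exact: cvg_cst|exact: cvg_harmonic].
  move=> n k nk; have [mS hn] := hS n.
  apply: (le_trans (key k _ _ mS (ltW (dpos n)) hn)).
  rewrite ler_wpM2r ?nm_ge0//.
  have : k.+1%:R^-1 <= n.+1%:R^-1 :> R by rewrite lef_pV2 ?posrE// ler_nat.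
  by move: (k.+1%:R^-1) (n.+1%:R^-1) => a b; lra.
exists y => s d ms d0 hd.
have H1 : nm (sop E (S n) x - sop E s x) @[n --> \oo] --> nm (y - sop E s x).
  by apply: cvg_nm; apply: cvgB => //; exact: cvg_cst.
have H2 : (n.+1%:R^-1 + d) * nm x @[n --> \oo] --> d * nm x.
  apply: cvgM; last exact: cvg_cst.
  rewrite -[X in _ --> X]add0r; apply: cvgD; [exact: cvg_harmonic|exact: cvg_cst].
by apply: (ler_cvg_to H1 H2); near=> n; exact: key.
Unshelve. all: by end_near. Qed.

(* The integral of a bounded function, 0 being a default value. *)
Definition Mop g x : X := if pselect (bmf g) is left bg then sval (cid (Mop_ex x bg)) else 0.

Lemma MopP g x s d : bmf g -> smeas s -> 0 <= d ->
  (forall t, `|g t - sfun s t| <= d) -> nm (Mop g x - sop E s x) <= d * nm x.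
Proof. by move=> bg; rewrite /Mop; case: pselect => // ?; case: cid => y /=; apply. Qed.

(** Through this criterion the algebra of [sop] passes to [Mop]. Restricting to d <= 1 keeps the
    approximants bounded, so that errors of products are linear in d. *)
Lemma Mop_char g x y c : bmf g -> 0 <= c ->
  (forall d, 0 < d -> d <= 1 -> exists s, [/\ smeas s, forall t, `|g t - sfun s t| <= d &
     nm (y - sop E s x) <= d * c]) -> y = Mop g x.
Proof.
move=> bg c0 h; apply/eqP; rewrite -subr_eq0; apply/eqP/nm_eq0/le_anti.
rewrite nm_ge0 andbT; apply/ler_addgt0Pr => eps eps0; rewrite add0r.
pose b := c + nm x + eps.
have b0 : 0 < b by rewrite ltr_wpDl// addr_ge0 ?nm_ge0.
pose d := eps / b.
have d0 : 0 < d by rewrite divr_gt0.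
have d1 : d <= 1 by rewrite ler_pdivrMr// mul1r /b; have := nm_ge0 x; lra.
have [s [ms gs ys]] := h _ d0 d1.
have := MopP x bg ms (ltW d0) gs.
rewrite nmB => ys2; apply: (le_trans (nm_triangle _ (sop E s x) _)).
apply: (le_trans (lerD ys ys2)); rewrite -mulrDr /d mulrAC ler_pdivrMr// ler_pM2l//.
by rewrite /b lerDl ltW.
Qed.

Lemma Mop_rlin g : bmf g -> rlin (Mop g).
Proof.
move=> bg; split=> [x y|r x]; symmetry.
  apply: (@Mop_char _ _ _ (nm x + nm y)) => //; first by rewrite addr_ge0 ?nm_ge0.
  move=> d d0 d1; have [s ms hs] := simple_approx bg d0; exists s; split => //.
  rewrite (rlinD (sop_rlin ms)) opprD addrACA; apply: (le_trans (nmD _ _)).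
  by rewrite mulrDr; apply: lerD; apply: MopP => //; exact: ltW.
apply: (@Mop_char _ _ _ (`|r| * nm x)) => //; first by rewrite mulr_ge0 ?nm_ge0.
move=> d d0 d1; have [s ms hs] := simple_approx bg d0; exists s; split => //.
rewrite (rlinZ (sop_rlin ms)) -rsN -rsD nmZ mulrCA ler_wpM2l//.
by apply: MopP => //; exact: ltW.
Qed.

Let eps_eq0 (a c : R) : 0 <= c -> (forall d, 0 < d -> `|a| <= d * c) -> a = 0.
Proof.
move=> c0 h; apply/eqP; rewrite -normr_le0; apply/ler_addgt0Pr => eps eps0; rewrite add0r.
have b0 : 0 < c + 1 by lra.
apply: (le_trans (h (eps / (c + 1)) _)); first by rewrite divr_gt0.
by rewrite mulrAC ler_pdivrMr// ler_pM2l//; lra.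
Qed.

Lemma Mop_sym g : bmf g -> rsym (Mop g).
Proof.
move=> bg x y; apply/eqP; rewrite -subr_eq0; apply/eqP.
apply: (@eps_eq0 _ (2 * (nm x * nm y))); first by rewrite !mulr_ge0 ?nm_ge0.
move=> d d0; have [s ms hs] := simple_approx bg d0.
have h1 := MopP x bg ms (ltW d0) hs; have h2 := MopP y bg ms (ltW d0) hs.
have -> : ip (Mop g x) y - ip x (Mop g y) =
   ip (Mop g x - sop E s x) y - ip x (Mop g y - sop E s y).
  by rewrite ipDl ipDr ipNl ipNr (sop_sym ms); ring.
apply: (le_trans (ler_normB _ _)).
have := le_trans (CS _ _) (ler_wpM2r (nm_ge0 y) h1).
have := le_trans (CS _ _) (ler_wpM2l (nm_ge0 x) h2); lra.
Qed.

Lemma Mop_form g x : bmf g -> ip (Mop g x) x = pI x g.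
Proof.
move=> bg; apply/eqP; rewrite -subr_eq0; apply/eqP.
apply: (@eps_eq0 _ (2 * (nm x * nm x))); first by rewrite !mulr_ge0 ?nm_ge0.
move=> d d0; have [s ms hs] := simple_approx bg d0.
have h1 := MopP x bg ms (ltW d0) hs.
have h2 : `|pI x (fun t => g t + sfun (sneg s) t)| <= d * ip x x.
  apply: pI_bound; last by move=> t; rewrite sfun_neg.
  by apply: bmf_add => //; apply: bmf_sfun; exact: smeas_neg.
rewrite pI_add// ?pI_sfun ?sop_neg ?ipNl in h2; [|exact: smeas_neg|by apply: bmf_sfun; exact: smeas_neg].
have -> : ip (Mop g x) x - pI x g =
   ip (Mop g x - sop E s x) x - (pI x g - ip (sop E s x) x).
  by rewrite ipDl ipNl; ring.
apply: (le_trans (ler_normB _ _)).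
have := le_trans (CS _ _) (ler_wpM2r (nm_ge0 x) h1).
rewrite -nm_sq in h2; lra.
Qed.

Lemma Mop_mul g h x : bmf g -> bmf h -> Mop g (Mop h x) = Mop (fun t => g t * h t) x.
Proof.
move=> bg bh; have [_ [c c0 gc]] := bg; have [_ [c' c'0 hc]] := bh.
(* With both functions approximated up to d / k, the product is off by at most (d / k)(c' + c + 1),
   which is below d. *)
pose k := c + c' + 2.
have k0 : 0 < k by rewrite /k; lra.
apply: (@Mop_char _ _ _ (nm (Mop h x) + nm x * (c + 1))).
- exact: bmf_mul.
- by rewrite addr_ge0 ?mulr_ge0 ?nm_ge0//; lra.
move=> d d0 d1.
have dk0 : 0 < d / k by rewrite divr_gt0.
have dk : d / k * k = d by rewrite divfK// gt_eqF.
have dkd : d / k <= d by rewrite ler_pdivrMr// ler_peMr ?ltW// /k; lra.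
have [s ms hs] := simple_approx bg dk0; have [s' ms' hs'] := simple_approx bh dk0.
have sc t : `|sfun s t| <= c + 1.
  have -> : sfun s t = g t - (g t - sfun s t) by ring.
  by apply: (le_trans (ler_normB _ _)); have := gc t; have := hs t; lra.
exists (smul s s'); split; first exact: smeas_mul.
  move=> t; rewrite sfun_mul.
  have -> : g t * h t - sfun s t * sfun s' t =
    (g t - sfun s t) * h t + sfun s t * (h t - sfun s' t) by ring.
  apply: (le_trans (ler_normD _ _)); rewrite !normrM -[leRHS]dk.
  have h1 : `|g t - sfun s t| * `|h t| <= d / k * c' by rewrite ler_pM.
  have h2 : `|sfun s t| * `|h t - sfun s' t| <= (c + 1) * (d / k) by rewrite ler_pM.
  rewrite /k mulrDr mulrDr -/k; move: (d / k) h1 h2 dk0 => q; lra.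
rewrite sop_mul//.
have -> : Mop g (Mop h x) - sop E s (sop E s' x) =
  (Mop g (Mop h x) - sop E s (Mop h x)) + sop E s (Mop h x - sop E s' x).
  by rewrite (rlinB (sop_rlin ms)) addrA subrK.
apply: (le_trans (nmD _ _)); rewrite mulrDr; apply: lerD.
  by apply: (le_trans (MopP _ bg ms (ltW dk0) hs)); rewrite ler_wpM2r ?nm_ge0.
have c1 : 0 <= c + 1 by lra.
apply: (le_trans (sop_nm _ ms c1 sc)).
have := MopP x bh ms' (ltW dk0) hs' => H.
rewrite mulrA mulrC; apply: ler_wpM2r => //.
by apply: (le_trans H); rewrite ler_wpM2r ?nm_ge0.
Qed.

Lemma Mop_indic B : measurable B -> Mop \1_B = e B.
Proof.
move=> mB; apply: rsym_quad_eq.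
- by apply: Mop_rlin; exact: bmf_indic.
- exact: op_lin (pvm_oproj E mB).
- by apply: Mop_sym; exact: bmf_indic.
- exact: op_sym (pvm_oproj E mB).
- by move=> x; rewrite Mop_form ?pI_indic//; exact: bmf_indic.
Qed.

Lemma Mop_add g h x : bmf g -> bmf h -> Mop (fun t => g t + h t) x = Mop g x + Mop h x.
Proof.
move=> bg bh; have bgh := bmf_add bg bh.
suff -> : Mop (fun t => g t + h t) = (fun x => Mop g x + Mop h x) by [].
apply: rsym_quad_eq.
- exact: Mop_rlin.
- exact: rlin_add (Mop_rlin bg) (Mop_rlin bh).
- exact: Mop_sym.
- by move=> y z; rewrite ipDl ipDr (Mop_sym bg) (Mop_sym bh).
- by move=> y; rewrite ipDl !Mop_form// pI_add.
Qed.

Lemma Mop_scale c g x : bmf g -> Mop (fun t => c * g t) x = rs c (Mop g x).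
Proof.
move=> bg; have bcg := bmf_mul (bmf_cst c) bg.
suff -> : Mop (fun t => c * g t) = (fun x => rs c (Mop g x)) by [].
apply: rsym_quad_eq.
- exact: Mop_rlin.
- exact: rlin_rs (Mop_rlin bg).
- exact: Mop_sym.
- by move=> y z; rewrite ipZl ipZr (Mop_sym bg).
- by move=> y; rewrite ipZl !Mop_form// pI_scale.
Qed.

Lemma Mop_sq g x : bmf g -> ip (Mop g x) (Mop g x) = pI x (fun t => g t ^+ 2).
Proof.
move=> bg; rewrite (Mop_sym bg) Mop_mul// ipC Mop_form; last exact: bmf_mul.
by congr (pI x _); apply/funext => t; rewrite expr2.
Qed.

Lemma bmf_sq g : bmf g -> bmf (fun t => g t ^+ 2).
Proof. by move=> bg; have := bmf_mul bg bg; under eq_fun do rewrite -expr2. Qed.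

Lemma Mop_nm g c x : bmf g -> 0 <= c -> (forall t, `|g t| <= c) -> nm (Mop g x) <= c * nm x.
Proof.
move=> bg c0 gc; rewrite -ler_sqr ?nnegrE ?mulr_ge0 ?nm_ge0//.
rewrite exprMn !nm_sq Mop_sq//.
apply: le_trans (ler_norm _) _; apply: pI_bound; first exact: bmf_sq.
by move=> t; rewrite normrX lerXn2r ?nnegrE.
Qed.

Lemma Mop_bnd g : bmf g -> bnd (Mop g).
Proof. by move=> bg; have [_ [c c0 gc]] := bg; exists c => x; exact: Mop_nm. Qed.

End Ops.

Lemma Mop_intertwine (E E' : pvm X) (Z : X -> X) (phi : BR -> BR) g x :
  rlin Z -> bnd Z -> measurable_fun setT phi ->
  (forall B y, measurable B -> Z (pvm_proj E (phi @^-1` B) y) = pvm_proj E' B (Z y)) ->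
  bmf g -> Z (Mop E (fun t => g (phi t)) x) = Mop E' g (Z x).
Proof.
move=> Zl [c0 Zc] mphi hZ bg; have [mg [b b0 gb]] := bg.
pose c := `|c0|.
have cc y : nm (Z y) <= c * nm y.
  by apply: (le_trans (Zc y)); rewrite ler_wpM2r ?nm_ge0 ?ler_norm.
have bgp : bmf (fun t => g (phi t)).
  split; first exact: (measurableT_comp mg mphi).
  by exists b.
apply: (@Mop_char _ _ _ _ (c * nm x)) => //; first by rewrite mulr_ge0 ?nm_ge0// normr_ge0.
move=> d d0 d1; have [s ms hs] := simple_approx bg d0; exists s; split => //.
pose s' := [seq (p.1, phi @^-1` p.2) | p <- s].
have ms' : smeas s'.
  by move=> _ /mapP[p /ms mp ->] /=; rewrite -[X in measurable X]setTI; exact: mphi.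
have E1 : sop E' s (Z x) = Z (sop E s' x).
  rewrite /s'; elim: s ms {hs s' ms'} => [_|p s IH /smeas_cons[mp ms]].
    by rewrite !sop_nil (rlin0 Zl).
  by rewrite /= !sop_cons (rlinD Zl) IH// (rlinZ Zl) hZ.
have E2 t : sfun s' t = sfun s (phi t).
  by rewrite /sfun /s' big_map; apply: eq_bigr => p _.
rewrite E1 -(rlinB Zl); apply: (le_trans (cc _)).
rewrite mulrCA ler_wpM2l//; first exact: normr_ge0.
by apply: MopP => //; [exact: ltW|move=> t; rewrite E2].
Qed.

End Calculus.

(** * Integrals of unbounded functions *)

Section PvmIntegral.
Context {R : realType} {X : hilbertType R}.
Implicit Types (x y z : X).
Notation BR := (measurableTypeR R).
Implicit Types (A B : set BR).
Variables (E : pvm X) (f : BR -> R).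
Hypothesis mf : measurable_fun setT f.
Notation e := (pvm_proj E).
Notation m := (pvm_meas E).

(** The line is exhausted by sets on which f is bounded; the corresponding projections increase to
    the identity and map into the domain of the integral. *)
Definition trB (n : nat) : set BR := f @^-1` `[- n%:R, n%:R]%classic.
Definition trf (n : nat) (t : BR) : R := f t * \1_(trB n) t.

Lemma trB_meas n : measurable (trB n).
Proof.
rewrite /trB -[X in measurable X]setTI; apply: mf => //; exact: measurable_itv.
Qed.

Lemma trB_in n t : trB n t <-> `|f t| <= n%:R.
Proof. by rewrite /trB /= in_itv /= ler_norml. Qed.

Lemma trf_in n t : trB n t -> trf n t = f t.
Proof. by move=> h; rewrite /trf indicE mem_set// mulr1. Qed.

Lemma trf_out n t : ~ trB n t -> trf n t = 0.
Proof. by move=> h; rewrite /trf indicE memNset// mulr0. Qed.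

Lemma trB_mono n k : (n <= k)%N -> trB n `<=` trB k.
Proof.
by move=> nk t /trB_in h; apply/trB_in; apply: (le_trans h); rewrite ler_nat.
Qed.

Lemma trB_nd : nondecreasing_seq trB.
Proof. by move=> n k nk; apply/subsetPset; exact: trB_mono. Qed.

Lemma trB_near t : exists n, forall k, (n <= k)%N -> trB k t.
Proof.
exists (Num.truncn `|f t|).+1 => k nk; apply/trB_in.
by apply: (le_trans (ltW (truncnS_gt _))); rewrite ler_nat.
Qed.

Lemma trB_T : \bigcup_n trB n = setT.
Proof.
rewrite -subTset => t _; have [n hn] := trB_near t.
by exists n => //; exact: hn.
Qed.

Lemma trf_bound n t : `|trf n t| <= n%:R.
Proof.
have [h|h] := pselect (trB n t); first by rewrite trf_in//; apply/trB_in.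
by rewrite trf_out// normr0.
Qed.

Lemma trf_le n t : `|trf n t| <= `|f t|.
Proof.
have [h|h] := pselect (trB n t); first by rewrite trf_in.
by rewrite trf_out// normr0.
Qed.

Lemma trf_bmf n : bmf (trf n).
Proof.
split; last by exists n%:R => //; exact: trf_bound.
by apply: measurable_funM => //; apply: measurable_indic; exact: trB_meas.
Qed.

Lemma en_cvg x : (e (trB n) x) @[n --> \oo] --> x.
Proof. apply: pvm_cvg; [exact: trB_meas|exact: trB_nd|exact: trB_T]. Qed.

Lemma en_M n k x : (n <= k)%N -> e (trB n) (Mop E (trf k) x) = Mop E (trf n) x.
Proof.
move=> nk; rewrite -(Mop_indic E (trB_meas n)) Mop_mul; [|exact: bmf_indic (trB_meas n)|exact: trf_bmf].
congr (Mop E _ x); apply/funext => t.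
have [h|h] := pselect (trB n t).
  by rewrite !trf_in//; [rewrite indicE mem_set// mul1r|exact: trB_mono h].
by rewrite (trf_out h) indicE memNset// mul0r.
Qed.

Lemma pI_E x g : bmf g -> (pI E x g)%:E = (\int[m x]_t (g t)%:E)%E.
Proof.
move=> bg; rewrite /pI /Rintegral fineK//.
exact: integrable_fin_num (bmf_int E x bg).
Qed.

(** |Mop (trf n) x|^2 is the integral of the truncated square; monotone convergence turns the
    integral condition into a uniform bound on vectors. *)
Lemma pvm_domP x : pvm_dom E f x <-> exists C, forall n, nm (Mop E (trf n) x) <= C.
Proof.
have tE n : (nm (Mop E (trf n) x) ^+ 2)%:E = (\int[m x]_t (trf n t ^+ 2)%:E)%E.
  by rewrite nm_sq Mop_sq ?pI_E//; [exact: bmf_sq (trf_bmf n)|exact: trf_bmf].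
have mt n : measurable_fun setT (fun t : BR => (trf n t ^+ 2)%:E).
  apply/measurable_EFinP; apply: measurable_funX; exact: (trf_bmf n).1.
have mf2 : measurable_fun setT (fun t : BR => (f t ^+ 2)%:E).
  by apply/measurable_EFinP; apply: measurable_funX.
split=> [dx|[C hC]].
  exists (Num.sqrt (fine (\int[m x]_t (f t ^+ 2)%:E)%E)) => n.
  have fin : (\int[m x]_t (f t ^+ 2)%:E)%E \is a fin_num.
    rewrite ge0_fin_numE//; apply: integral_ge0 => t _; by rewrite lee_fin sqr_ge0.
  rewrite -(ger0_norm (nm_ge0 (Mop E (trf n) x))) -sqrtr_sqr ler_wsqrtr//.
  rewrite -lee_fin tE fineK//; apply: ge0_le_integral => //.
    by move=> t _; rewrite lee_fin sqr_ge0.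
  by move=> t _; rewrite lee_fin -(real_normK (num_real (trf n t))) -(real_normK (num_real (f t))) lerXn2r ?nnegrE//; exact: trf_le.
rewrite /pvm_dom.
have := @cvg_monotone_convergence _ _ _ (m x) setT (@measurableT _ _)
   (fun n t => (trf n t ^+ 2)%:E) mt.
move=> /(_ _ _)/[dup] H _.
have lim t : limn (fun n => (trf n t ^+ 2)%:E) = (f t ^+ 2)%:E.
  apply/cvg_lim; first exact: ereal_hausdorff.
  have [n hn] := trB_near t.
  have K : (fun k : nat => (f t ^+ 2)%:E) @ \oo --> (f t ^+ 2)%:E by exact: cvg_cst.
  apply: cvg_trans K; apply: near_eq_cvg; exists n => // k /= nk.
  by rewrite trf_in//; exact: hn.
have {}H : (\int[m x]_t (trf n t ^+ 2)%:E)%E @[n --> \oo] --> (\int[m x]_t (f t ^+ 2)%:E)%E.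
  have -> : (\int[m x]_t (f t ^+ 2)%:E)%E = (\int[m x]_t (limn (fun n => (trf n t ^+ 2)%:E)))%E.
    by apply: eq_integral => t _; rewrite lim.
  apply: H.
    by move=> n t _; rewrite lee_fin sqr_ge0.
  move=> t _ n k nk; rewrite lee_fin.
  have [h|h] := pselect (trB n t).
    by rewrite !trf_in//; exact: trB_mono h.
  by rewrite (trf_out h) expr0n sqr_ge0.
have C0 : 0 <= C by apply: le_trans (hC 0%N); exact: nm_ge0.
apply: (@le_lt_trans _ _ ((C ^+ 2)%:E)); last exact: ltry.
apply: (cvge_to_le H); near=> n; rewrite -tE lee_fin lerXn2r ?nnegrE ?nm_ge0//.
Unshelve. all: by end_near. Qed.

Lemma pvm_domD x y : pvm_dom E f x -> pvm_dom E f y -> pvm_dom E f (x + y).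
Proof.
move=> /pvm_domP[C hC] /pvm_domP[D hD]; apply/pvm_domP; exists (C + D) => n.
rewrite (rlinD (Mop_rlin E (trf_bmf n))); apply: (le_trans (nmD _ _)).
exact: lerD.
Qed.

Lemma pvm_domN x : pvm_dom E f x -> pvm_dom E f (- x).
Proof.
move=> /pvm_domP[C hC]; apply/pvm_domP; exists C => n.
by rewrite (rlinN (Mop_rlin E (trf_bmf n))) nmN.
Qed.

Lemma Mop_ii g x : bmf g -> Mop E g (ii x) = ii (Mop E g x).
Proof.
move=> bg; symmetry; apply: (@Mop_intertwine _ _ E E ii id g x) => //.
- exact: rlin_ii.
- exact: bnd_ii.
- by move=> B y mB; rewrite pvm_ii.
Qed.

Lemma pvm_dom_ii x : pvm_dom E f x -> pvm_dom E f (ii x).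
Proof.
move=> /pvm_domP[C hC]; apply/pvm_domP; exists C => n.
by rewrite (Mop_ii _ (trf_bmf n)) nm_ii.
Qed.

Lemma pvm_dom_en n x : pvm_dom E f (e (trB n) x).
Proof.
apply/pvm_domP; exists (n%:R * nm x) => k.
rewrite -(Mop_indic E (trB_meas n)) Mop_mul; [|exact: trf_bmf|exact: bmf_indic (trB_meas n)].
apply: Mop_nm => //.
  by apply: bmf_mul; [exact: trf_bmf|exact: bmf_indic (trB_meas n)].
move=> t; have [h|h] := pselect (trB n t).
  by rewrite indicE mem_set// mulr1; apply: (le_trans (trf_le _ _)); apply/trB_in.
by rewrite indicE memNset// mulr0 normr0.
Qed.

(** The measure is finite, so |f| <= 1 + f^2 makes f integrable when f^2 is, and dominated
    convergence applies. *)
Lemma pI_lim x : pvm_dom E f x -> pI E x (trf n) @[n --> \oo] --> pI E x f.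
Proof.
move=> dx.
have mEf : measurable_fun setT (EFin \o f) by apply/measurable_EFinP.
have intf : (m x).-integrable setT (EFin \o f).
  have mf2 : measurable_fun setT (fun t : BR => f t ^+ 2) by apply: measurable_funX.
  have i2 : (m x).-integrable setT (fun t => (f t ^+ 2)%:E).
    apply/integrableP; split; first by apply/measurable_EFinP.
    have -> : (\int[m x]_t `|(f t ^+ 2)%:E|)%E = (\int[m x]_t (f t ^+ 2)%:E)%E.
      by apply: eq_integral => t _; rewrite gee0_abs// lee_fin sqr_ge0.
    exact: dx.
  have i1 : (m x).-integrable setT (EFin \o (fun=> 1 : R)) by exact: bmf_int (bmf_cst 1).
  apply: (le_integrable _ mEf _ (integrableD _ i1 i2)) => // t _ /=.
  rewrite lee_fin [leRHS]ger0_norm; last by rewrite addr_ge0 ?sqr_ge0.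
  rewrite -(real_normK (num_real (f t))).
  by have := sqr_ge0 (`|f t| - 1); have := normr_ge0 (f t); nra.
have fin : (\int[m x]_t (f t)%:E)%E \is a fin_num by exact: integrable_fin_num intf.
rewrite /pI /Rintegral; apply: fine_cvg; rewrite fineK//.
apply: (@dominated_cvg _ _ _ (m x) setT (@measurableT _ _)
  (fun n t => (trf n t)%:E) (EFin \o f) (fun t => `|(f t)%:E|)%E).
- by move=> n; apply/measurable_EFinP; exact: (trf_bmf n).1.
- move=> t _; have [n hn] := trB_near t.
  have K : (fun k : nat => (EFin \o f) t) @ \oo --> (EFin \o f) t by exact: cvg_cst.
  apply: cvg_trans K; apply: near_eq_cvg; exists n => // k /= nk.
  by rewrite trf_in//; exact: hn.
- by move=> t _.
- exact: integrable_abse.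
- by move=> n t _; rewrite /= lee_fin trf_le.
Qed.

Lemma quad_lim x z : pvm_dom E f x -> pvm_dom E f z ->
  ip (Mop E (trf n) x) z @[n --> \oo] --> 4^-1 * (pI E (x + z) f - pI E (x - z) f).
Proof.
move=> dx dz.
have -> : (fun n => ip (Mop E (trf n) x) z) =
  (fun n => 4^-1 * (pI E (x + z) (trf n) - pI E (x - z) (trf n))).
  apply/funext => n; have bt := trf_bmf n; have l := Mop_rlin E bt.
  rewrite -!Mop_form// !(rlinD l) (rlinN l) !(ipDl, ipDr, ipNl, ipNr).
  by rewrite (Mop_sym E bt z x) (ipC z); field.
apply: cvgM; first exact: cvg_cst.
apply: cvgB; apply: pI_lim; first exact: pvm_domD.
by apply: pvm_domD => //; exact: pvm_domN.
Qed.

(** In the four-term polarization the terms k = 0, 2 form the real part and k = 1, 3 the imaginary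
    part. The latter is the real part at i z, and the domain is stable under i. *)
Lemma pvm_int_ipP x y : pvm_int E f x y <-> pvm_dom E f x /\
  forall z, pvm_dom E f z -> ip y z = 4^-1 * (pI E (x + z) f - pI E (x - z) f).
Proof.
have sumE z : 4%:R^-1 * \sum_(k < 4) 'i ^+ k * (\int[m (x + 'i ^+ k *: z)]_t f t)%:C =
  (4^-1 * (pI E (x + z) f - pI E (x - z) f))%:C +
  'i * (4^-1 * (pI E (x + ii z) f - pI E (x - ii z) f))%:C :> R[i].
  rewrite !big_ord_recr big_ord0 /= add0r expr0 expr1 scale1r mul1r.
  have -> : 'i ^+ 2 = -1 :> R[i] by rewrite sqrCi.
  have -> : 'i ^+ 3 = - 'i :> R[i] by rewrite exprS sqrCi mulrN1.
  rewrite scaleN1r scaleNr -/(ii z).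
  rewrite -/(pI E (x + z) f) -/(pI E (x + ii z) f) -/(pI E (x - z) f) -/(pI E (x - ii z) f).
  move: (pI E _ _) (pI E _ _) (pI E _ _) (pI E _ _) => a b c d.
  rewrite !rmorphM !rmorphB /= fmorphV rmorph_nat; ring.
split=> -[dx h]; split => // z dz.
  by have := h z dz; rewrite sumE => /(congr1 (@complex.Re R)); rewrite ReD Re_imul /= oppr0 addr0.
by rewrite sumE hdotE (h z dz) (h (ii z) (pvm_dom_ii dz)).
Qed.

(* This reduces unbounded integrals to the calculus of bounded ones. *)
Theorem pvm_intP x y : pvm_int E f x y <-> forall n, e (trB n) y = Mop E (trf n) x.
Proof.
rewrite pvm_int_ipP; split=> [[dx h] n|h].
  apply: ipext => z; rewrite (op_sym (pvm_oproj E (trB_meas n))).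
  have dz := pvm_dom_en n z; rewrite (h _ dz).
  apply: (cvg_unique _ (quad_lim dx dz)) => //.
  have K : (fun k : nat => ip (Mop E (trf n) x) z) @ \oo --> ip (Mop E (trf n) x) z by exact: cvg_cst.
  apply: cvg_trans K; apply: near_eq_cvg; exists n => // k /= nk.
  by rewrite -(op_sym (pvm_oproj E (trB_meas n))) en_M.
have dx : pvm_dom E f x.
  by apply/pvm_domP; exists (nm y) => n; rewrite -h; apply: pvm_nm; exact: trB_meas.
split => // z dz.
apply: (@cvg_unique _ _ ((fun n => ip (Mop E (trf n) x) z) @ \oo)) => //; last exact: quad_lim.
have -> : (fun n => ip (Mop E (trf n) x) z) = (fun n => ip (e (trB n) y) z).
  by apply/funext => n; rewrite h.
by apply: cvg_ip; [exact: en_cvg|exact: cvg_cst].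
Qed.

Lemma pvm_int_uniq x y y' : pvm_int E f x y -> pvm_int E f x y' -> y = y'.
Proof.
move=> /pvm_intP h /pvm_intP h'; apply: (cvgX_unique (@en_cvg y)).
have -> : (fun n => e (trB n) y) = (fun n => e (trB n) y') by apply/funext => n; rewrite h h'.
exact: en_cvg.
Qed.

Lemma pvm_intD x y x' y' : pvm_int E f x y -> pvm_int E f x' y' -> pvm_int E f (x + x') (y + y').
Proof.
move=> /pvm_intP h /pvm_intP h'; apply/pvm_intP => n.
by rewrite (rlinD (op_lin (pvm_oproj E (trB_meas n)))) h h' (rlinD (Mop_rlin E (trf_bmf n))).
Qed.

Lemma pvm_intZ r x y : pvm_int E f x y -> pvm_int E f (rs r x) (rs r y).
Proof.
move=> /pvm_intP h; apply/pvm_intP => n.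
by rewrite (rlinZ (op_lin (pvm_oproj E (trB_meas n)))) h (rlinZ (Mop_rlin E (trf_bmf n))).
Qed.

Lemma pvm_int_ii x y : pvm_int E f x y -> pvm_int E f (ii x) (ii y).
Proof.
move=> /pvm_intP h; apply/pvm_intP => n.
by rewrite (pvm_ii E _ (trB_meas n)) h (Mop_ii _ (trf_bmf n)).
Qed.

Lemma pvm_int_closed (x y : nat -> X) x0 y0 : (forall n, pvm_int E f (x n) (y n)) ->
  x @ \oo --> x0 -> y @ \oo --> y0 -> pvm_int E f x0 y0.
Proof.
move=> h hx hy; apply/pvm_intP => n.
have H1 := cvg_op (op_lin (pvm_oproj E (trB_meas n))) (op_bnd (pvm_oproj E (trB_meas n))) hy.
have H2 := cvg_op (Mop_rlin E (trf_bmf n)) (Mop_bnd E (trf_bmf n)) hx.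
apply: (cvgX_unique (H1 _)).
have -> : (fun k => e (trB n) (y k)) = (fun k => Mop E (trf n) (x k)).
  by apply/funext => k; have /pvm_intP -> := h k.
exact: H2.
Qed.

Lemma pvm_int_bounded B x : measurable B -> bmf (fun t => f t * \1_B t) ->
  pvm_int E f (e B x) (Mop E (fun t => f t * \1_B t) x).
Proof.
move=> mB bB; apply/pvm_intP => n.
rewrite -(Mop_indic E (trB_meas n)) -(Mop_indic E mB).
rewrite !Mop_mul//; [|exact: trf_bmf|exact: bmf_indic|exact: bmf_indic (trB_meas n)].
congr (Mop E _ x); apply/funext => t; rewrite /trf; ring.
Qed.

Lemma pvm_int_restr B x y : measurable B -> (exists n, B `<=` trB n) -> pvm_int E f x y ->
  e B y = Mop E (fun t => f t * \1_B t) x.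
Proof.
move=> mB [n Bn] /pvm_intP h.
have -> : e B y = e B (e (trB n) y).
  rewrite pvm_I//; last exact: trB_meas.
  by have -> : B `&` trB n = B by apply: setIidl.
rewrite h -(Mop_indic E mB) Mop_mul; [|exact: bmf_indic|exact: trf_bmf].
congr (Mop E _ x); apply/funext => t.
have [Bt|Bt] := pselect (B t); last by rewrite indicE memNset// mul0r mulr0.
by rewrite trf_in; [rewrite mulrC|exact: Bn].
Qed.

End PvmIntegral.

Section PvmTransport.
Context {R : realType} {X : hilbertType R}.
Implicit Types (x y z : X).
Notation BR := (measurableTypeR R).
Implicit Types (A B : set BR).

Lemma pvm_int_intertwine (E E' : pvm X) (Z : X -> X) (phi : BR -> BR) (f : BR -> R) x y :
  rlin Z -> bnd Z -> measurable_fun setT phi -> measurable_fun setT f ->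
  (forall B y, measurable B -> Z (pvm_proj E (phi @^-1` B) y) = pvm_proj E' B (Z y)) ->
  pvm_int E (fun t => f (phi t)) x y -> pvm_int E' f (Z x) (Z y).
Proof.
move=> Zl Zb mphi mf hZ.
have mfp : measurable_fun setT (fun t => f (phi t)) by exact: (measurableT_comp mf mphi).
move=> /(@pvm_intP _ _ E _ mfp) h; apply/(@pvm_intP _ _ E' _ mf) => n.
rewrite -hZ; last exact: trB_meas.
have := h n; rewrite /trB => ->.
rewrite -(Mop_intertwine x Zl Zb mphi hZ (trf_bmf mf n)).
by congr (Z (Mop E _ x)).
Qed.

(** Only the conjugated projections are required to commute with i, so that Z may be antilinear. *)
Lemma pvm_transport_ex (E : pvm X) (Z Z' : X -> X) (phi : BR -> BR) :
  rlin Z -> rlin Z' -> (forall x, nm (Z x) = nm x) -> cancel Z Z' -> cancel Z' Z ->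
  (forall B x, measurable B -> ii (Z (pvm_proj E B (Z' x))) = Z (pvm_proj E B (Z' (ii x)))) ->
  measurable_fun setT phi ->
  exists E' : pvm X, forall B x, measurable B ->
    pvm_proj E' B x = Z (pvm_proj E (phi @^-1` B) (Z' x)).
Proof.
move=> Zl Zl' Zn ZK ZK' Zi mphi.
have Zip := iso_ip Zl Zn.
have mpre B : measurable B -> measurable (phi @^-1` B).
  by move=> mB; rewrite -[X in measurable X]setTI; exact: mphi.
pose mm x : {measure set BR -> \bar R} := [the measure _ _ of pushforward (pvm_meas E (Z' x)) phi].
pose pp B x := Z (pvm_proj E (phi @^-1` B) (Z' x)).
have h1 B : measurable B -> orthogonal_projection (pp B).
  move=> mB; have hp := pvm_oproj E (mpre _ mB).
  apply: oprojection_hdot; last by move=> x; apply: Zi; exact: mpre.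
  split.
  - exact: rlin_comp Zl (rlin_comp (op_lin hp) Zl').
  - by move=> x; rewrite /pp ZK (op_idem hp).
  - move=> x y; rewrite /pp -{1}(ZK' y) Zip (op_sym hp) -{2}(ZK' x) Zip//.
have h2 x : pp setT x = x by rewrite /pp preimage_setT pvm_projT ZK'.
have h3 x B : measurable B -> mm mphi x B = (complex.Re (hdot (pp B x) x))%:E.
  move=> mB; rewrite -[LHS]/(pvm_meas E (Z' x) (phi @^-1` B)) pvm_mE; last exact: mpre.
  by rewrite -[complex.Re _]/(ip _ _) /pp -[in RHS](ZK' x) ZK Zip.
by exists (Pvm h1 h2 h3).
Qed.

End PvmTransport.

(** * Uniqueness of the spectral measure *)

Section SpectralUniqueness.
Context {R : realType} {X : hilbertType R}.
Implicit Types (x y z : X).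
Notation BR := (measurableTypeR R).
Implicit Types (A B : set BR).

Lemma ind_in B t : B t -> \1_B t = 1 :> R.
Proof. by move=> h; rewrite indicE mem_set. Qed.

Lemma ind_out B t : ~ B t -> \1_B t = 0 :> R.
Proof. by move=> h; rewrite indicE memNset. Qed.

Definition idR : BR -> R := fun t => t.
Lemma idR_meas : measurable_fun setT idR.
Proof. exact: measurable_id. Qed.

(* [v n] stands for (A - c)^n x; by [spseqP] such sequences characterize the
   range of E([c - r, c + r]) in terms of A alone. *)
Definition spseq (A : X -> X -> Prop) (c r : R) x : Prop :=
  exists v : nat -> X, [/\ v 0%N = x, forall n, A (v n) (v n.+1 + rs c (v n)) &
    forall n, nm (v n) <= r ^+ n * nm x].

Lemma spseq_sub (A A' : X -> X -> Prop) c r x : (forall x y, A x y -> A' x y) ->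
  spseq A c r x -> spseq A' c r x.
Proof. by move=> h [v [v0 vA vn]]; exists v; split => // n; apply: h; exact: vA. Qed.

Lemma geometric_le0 (a b p q : R) : 0 <= p -> p < q -> (forall n, q ^+ n * a <= p ^+ n * b) -> a <= 0.
Proof.
move=> p0 pq h.
have q0 : 0 < q by exact: le_lt_trans pq.
have H1 n : a <= (p / q) ^+ n * b.
  rewrite expr_div_n mulrAC ler_pdivlMr ?exprn_gt0// mulrC; exact: h.
have H2 : (p / q) ^+ n * b @[n --> \oo] --> 0.
  rewrite -[X in _ --> X](mul0r b); apply: cvgM; last exact: cvg_cst.
  apply: cvg_expr; rewrite ger0_norm ?divr_ge0 ?(ltW q0)//.
  by rewrite ltr_pdivrMr// mul1r.
by apply: (ler_cvg_to (cvg_cst a) H2); near=> n.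
Unshelve. all: by end_near. Qed.

(** On the range of E(B) the operator A - c expands norms by at least r + d, while the sequence
    grows no faster than r^n. *)
Lemma spseq_restr (E : pvm X) (c r d : R) x B : measurable B -> (exists n, B `<=` trB idR n) ->
  0 <= r -> 0 < d -> (forall t, B t -> r + d <= `|t - c|) ->
  spseq (pvm_int E idR) c r x -> pvm_proj E B x = 0.
Proof.
move=> mB Bn r0 d0 hB [v [v0 vA vn]].
have bB : bmf (fun t => idR t * \1_B t).
  have [n hn] := Bn; split.
    by apply: measurable_funM; [exact: idR_meas|exact: measurable_indic].
  exists n%:R => // t; have [Bt|Bt] := pselect (B t).
    by rewrite indicE mem_set// mulr1; apply/(trB_in idR); exact: hn.
  by rewrite indicE memNset// mulr0 normr0.
have bcB : bmf (fun t : BR => (- c) * \1_B t) by apply: bmf_mul; [exact: bmf_cst|exact: bmf_indic].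
pose g t : R := idR t * \1_B t + (- c) * \1_B t.
have bg : bmf g by exact: bmf_add.
have step n : pvm_proj E B (v n.+1) = Mop E g (v n).
  have := pvm_int_restr idR_meas mB Bn (vA n).
  rewrite (rlinD (op_lin (pvm_oproj E mB))) (rlinZ (op_lin (pvm_oproj E mB))).
  rewrite Mop_add// Mop_scale; last exact: bmf_indic.
  rewrite (Mop_indic E mB) => <-.
  by apply: ipext => z; rewrite !(ipDl, ipZl); ring.
have grow n : (r + d) * nm (pvm_proj E B (v n)) <= nm (pvm_proj E B (v n.+1)).
  rewrite step -ler_sqr ?nnegrE ?mulr_ge0 ?nm_ge0//; last by rewrite addr_ge0// ltW.
  rewrite exprMn !nm_sq (Mop_sq E _ bg) (op_ip (pvm_oproj E mB)) -(pI_indic E _ mB).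
  rewrite -pI_scale; last exact: bmf_indic.
  apply: pI_le; first by apply: bmf_mul; [exact: bmf_cst|exact: bmf_indic].
    exact: bmf_sq.
  move=> t; rewrite /g /idR; have [Bt|Bt] := pselect (B t); last first.
    by rewrite indicE memNset// !mulr0 addr0 expr0n.
  rewrite indicE mem_set// !mulr1 -[leRHS](real_normK (num_real _)) lerXn2r ?nnegrE//.
    by rewrite addr_ge0// ltW.
  exact: hB.
have pw n : (r + d) ^+ n * nm (pvm_proj E B x) <= nm (pvm_proj E B (v n)).
  elim: n => [|n IH]; first by rewrite expr0 mul1r v0.
  apply: le_trans (grow n); rewrite exprS -mulrA ler_wpM2l//.
  by rewrite addr_ge0// ltW.
apply: nm_eq0; apply/le_anti; rewrite nm_ge0 andbT.
apply: (@geometric_le0 _ (nm x) r (r + d)) => //; first by rewrite ltrDl.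
move=> n; apply: (le_trans (pw n)); apply: le_trans (vn n).
exact: pvm_nm.
Qed.

Lemma spseqP (E : pvm X) (c r : R) x : 0 <= r ->
  spseq (pvm_int E idR) c r x <-> pvm_proj E `[c - r, c + r]%classic x = x.
Proof.
move=> r0; set I : set BR := `[c - r, c + r]%classic.
have mI : measurable I by exact: measurable_itv.
have II t : I t <-> `|t - c| <= r.
  by rewrite /I /= in_itv /= ler_norml; split=> /andP[h1 h2]; apply/andP; split; lra.
split=> [h|h].
  (* The complement of I is exhausted by bounded sets that keep the distance r + 1/(k+1) from c;
     [spseq_restr] kills x on each of them. *)
  pose S k : set BR := (`]-oo, c - (r + k.+1%:R^-1)]%classic `|` `[c + (r + k.+1%:R^-1), +oo[%classic)
     `&` `[- k%:R, k%:R]%classic.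
  have mS k : measurable (S k).
    by apply: measurableI; [apply: measurableU|]; exact: measurable_itv.
  have dpos k : 0 < k.+1%:R^-1 :> R by rewrite invr_gt0.
  have SE k t : S k t <-> r + k.+1%:R^-1 <= `|t - c| /\ `|t| <= k%:R.
    have D0 : 0 < r + k.+1%:R^-1 by rewrite ltr_wpDl.
    rewrite /S /= !in_itv /= andbT ler_norml.
    move: (k.+1%:R^-1) D0 => d D0.
    split=> -[h1 h2]; split => //.
      by case: h1 => h1; rewrite ler_normr; apply/orP; [right|left]; lra.
    by move: h1; rewrite ler_normr => /orP[h1|h1]; [right|left]; lra.
  have S0 k : pvm_proj E (S k) x = 0.
    apply: (@spseq_restr E c r k.+1%:R^-1) => //.
      by exists k => t /SE[_ ?]; apply/(trB_in idR).
    by move=> t /SE[].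
  have SI k : S k `&` I = set0.
    apply/seteqP; split=> t //= [/SE[h1 _] /II h2].
    by move: (dpos k) h1; move: (k.+1%:R^-1) => d; lra.
  have mU k : measurable (S k `|` I) by exact: measurableU.
  have nd : nondecreasing_seq (fun k => S k `|` I).
    move=> n k nk; apply/subsetPset => t [/SE[h1 h2]|It]; last by right.
    left; apply/SE; split; last by apply: (le_trans h2); rewrite ler_nat.
    apply: le_trans h1; rewrite lerD2l lef_pV2 ?posrE// ler_nat//.
  have UT : \bigcup_k (S k `|` I) = setT.
    rewrite -subTset => t _.
    have [It|It] := pselect (I t); first by exists 0%N => //; right.
    have It' : 0 < `|t - c| - r by rewrite subr_gt0 ltNge; apply/negP => /II.
    pose n1 := (Num.truncn `|t|).+1; pose n2 := Num.truncn ((`|t - c| - r)^-1).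
    exists (maxn n1 n2) => //; left; apply/SE; split.
      have h1 : (`|t - c| - r)^-1 < (maxn n1 n2).+1%:R.
        by apply: (lt_le_trans (truncnS_gt _)); rewrite ler_nat ltnS leq_maxr.
      have h2 : (maxn n1 n2).+1%:R^-1 < `|t - c| - r.
        by rewrite -[ltRHS]invrK ltf_pV2 ?posrE ?invr_gt0.
      by move: h2; move: (_.+1%:R^-1) => a; lra.
    apply: (le_trans (ltW (truncnS_gt _))); rewrite ler_nat leq_maxl//.
  have := @pvm_cvg _ _ E _ x mU nd UT.
  have -> : (fun n => pvm_proj E (S n `|` I) x) = fun=> pvm_proj E I x.
    by apply/funext => k; rewrite pvm_U// S0 add0r.
  by move=> H; apply: (cvgX_unique _ H); exact: cvg_cst.
(* Conversely the iterates (A - c)^n x are integrals of bounded functions when x lies in the range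
   of E(I). *)
pose g n (t : BR) : R := (t - c) ^+ n * \1_I t.
have gb n t : `|g n t| <= r ^+ n.
  rewrite /g; have [It|It] := pselect (I t).
    by rewrite indicE mem_set// mulr1 normrX lerXn2r ?nnegrE//; apply/II.
  by rewrite indicE memNset// mulr0 normr0 exprn_ge0.
have bg n : bmf (g n).
  split; last by exists (r ^+ n); [exact: exprn_ge0|exact: gb].
  apply: measurable_funM; last exact: measurable_indic.
  apply: measurable_funX; apply: measurable_funB; [exact: idR_meas|exact: measurable_cst].
exists (fun n => Mop E (g n) x); split.
- rewrite -[RHS]h -(Mop_indic E mI); congr (Mop E _ x); apply/funext => t.
  by rewrite /g expr0 mul1r.
- move=> n.
  have bI : bmf (fun t : BR => idR t * \1_I t).
    have -> : (fun t : BR => idR t * \1_I t) = (fun t : BR => g 1%N t + c * \1_I t).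
      by apply/funext => t; rewrite /g /idR expr1; ring.
    by apply: bmf_add => //; apply: bmf_mul; [exact: bmf_cst|exact: bmf_indic].
  have := pvm_int_bounded E (@idR_meas) (Mop E (g n) x) mI bI.
  rewrite -{1}(Mop_indic E mI) !Mop_mul//; last exact: bmf_indic.
  have -> : (fun t : BR => \1_I t * g n t) = g n.
    apply/funext => t; rewrite /g indicE; case: (_ \in _); rewrite ?mulr0 ?mulr1 ?mul1r//.
  congr (pvm_int E _ _ _).
  rewrite -Mop_scale// -Mop_add//; last by apply: bmf_mul => //; exact: bmf_cst.
  congr (Mop E _ x); apply/funext => t; rewrite /g /idR indicE exprS.
  by case: (_ \in _); rewrite ?mulr0 ?mulr1 ?addr0 ?mul0r//; ring.
- by move=> n; apply: Mop_nm => //; exact: exprn_ge0.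
Qed.

Lemma oproj_same_range (p q : X -> X) : oprojection p -> oprojection q ->
  (forall x, p x = x <-> q x = x) -> p = q.
Proof.
move=> hp hq h; apply/funext => x.
have h1 y : q (p y) = p y by apply/h; rewrite (op_idem hp).
have h2 y : p (q y) = q y by apply/h; rewrite (op_idem hq).
by rewrite -(oproj_le_sym hp hq h1) h2.
Qed.

(** By [spseqP] the operator determines the range of E([a, b]), hence the projection itself; c and r
    are the midpoint and half the length. *)
Theorem spectral_uniq (E E' : pvm X) :
  (forall x y, pvm_int E idR x y <-> pvm_int E' idR x y) ->
  forall B, measurable B -> pvm_proj E B = pvm_proj E' B.
Proof.
move=> h B mB.
have cl (a b : R) : pvm_proj E `[a, b]%classic = pvm_proj E' `[a, b]%classic.
  have mI : measurable (`[a, b]%classic : set BR) by exact: measurable_itv.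
  apply: oproj_same_range; [exact: pvm_oproj|exact: pvm_oproj|] => x.
  have [ab|ba] := leP a b; last first.
    have e0 (F : pvm X) : pvm_proj F `[a, b]%classic x = 0.
      have -> : `[a, b]%classic = set0 :> set BR by rewrite set_itv_ge// bnd_simp -ltNge.
      by have := pvm_disj F x (@measurable0 _ BR) (@measurableT _ BR) (set0I _); rewrite pvm_projT.
    by rewrite !e0.
  have r0 : 0 <= (b - a) / 2 by rewrite divr_ge0// subr_ge0.
  have e1 : (a + b) / 2 - (b - a) / 2 = a by field.
  have e2 : (a + b) / 2 + (b - a) / 2 = b by field.
  have := spseqP E ((a + b) / 2) x r0; have := spseqP E' ((a + b) / 2) x r0.
  rewrite e1 e2 => <- <-.
  split; apply: spseq_sub => x' y'.
    exact: (proj1 (h x' y')).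
  exact: (proj2 (h x' y')).
have me x : forall B, measurable B -> pvm_meas E x B = pvm_meas E' x B.
  apply: finite_measure_unique; [by rewrite pvm_mT ltry|by rewrite !pvm_mT|].
  move=> a b.
  (* Half-open intervals are increasing unions of closed ones, on which the measures already
     agree. *)
  pose S n : set BR := `[a + n.+1%:R^-1, b]%classic.
  have US : `]a, b]%classic = \bigcup_n S n by rewrite itv_open_bnd_bigcup.
  have mS n : measurable (S n) by exact: measurable_itv.
  have mU : measurable (\bigcup_n S n) by exact: bigcupT_measurable.
  have nd : nondecreasing_seq S.
    move=> n k nk; apply/subsetPset => t; rewrite /S /= !in_itv /= => /andP[h1 ->].
    rewrite andbT; apply: le_trans h1; rewrite lerD2l lef_pV2 ?posrE// ler_nat//.
  have h1 := nondecreasing_cvg_mu (mu := pvm_meas E x) mS mU nd.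
  have h2 := nondecreasing_cvg_mu (mu := pvm_meas E' x) mS mU nd.
  rewrite US; apply: (cvg_unique _ h1); first exact: ereal_hausdorff.
  have -> : pvm_meas E x \o S = pvm_meas E' x \o S.
    by apply/funext => n /=; rewrite !pvm_mE// /S cl.
  exact: h2.
have pB := pvm_oproj E mB; have pB' := pvm_oproj E' mB.
apply: rsym_quad_eq; [exact: op_lin|exact: op_lin|exact: op_sym|exact: op_sym|].
by move=> x; have := me x B mB; rewrite !pvm_mE// => -[].
Qed.

Lemma spectral_uniq_int (E E' : pvm X) (f : BR -> R) : measurable_fun setT f ->
  (forall x y, pvm_int E idR x y <-> pvm_int E' idR x y) ->
  forall x y, pvm_int E f x y -> pvm_int E' f x y.
Proof.
move=> mf h x y.
apply: (@pvm_int_intertwine _ _ E E' id id f) => //; first by exists 1 => z; rewrite mul1r.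
by move=> B z mB; rewrite preimage_id (spectral_uniq h mB).
Qed.

End SpectralUniqueness.

(** * The generator as a spectral integral *)

Section SpectralExistence.
Context {R : realType} {X : hilbertType R}.
Implicit Types (x y z w : X).
Notation BR := (measurableTypeR R).
Implicit Types (A B : set BR).
Variable u : R -> X -> X.
Hypotheses (ug : ugroup u) (ui : forall t x, u t (ii x) = ii (u t x)).
Notation F := (specF ug ui).

(** The graph of A = i d, in a form convertible to [scale_op 'i (dU U h)] for the group at hand. *)
Definition sagen x y : Prop := exists2 z, gen u x z & y = ii z.

Section WithE.
Variable E : pvm X.
Hypothesis EF : forall a b, a <= b -> forall x, pvm_proj E `]a, b]%classic x = F b x - F a x.
Hypothesis Eu : forall t B x, measurable B -> u t (pvm_proj E B x) = pvm_proj E B (u t x).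
Notation e := (pvm_proj E).
Notation J a b := (`]a, b]%classic : set BR).

Let mJ (a b : R) : measurable (J a b). Proof. exact: measurable_itv. Qed.

Let egen B x z : measurable B -> gen u x z -> gen u (e B x) (e B z).
Proof.
move=> mB; apply: gen_comm; first exact: op_lin (pvm_oproj E mB).
  exact: op_bnd (pvm_oproj E mB).
by move=> t y; rewrite Eu.
Qed.

(** The sign conditions defining [specF] concern (A - l)(1 + A^2)^-1; here they are transferred to A
    itself. *)
Let form_bounds a b w z : a <= b -> e (J a b) w = w -> gen u w z ->
  a * ip w w <= ip (ii z) w <= b * ip w w.
Proof.
move=> ab we wz.
have ze : e (J a b) z = z.
  by apply: (gen_uniq _ wz); rewrite -{1}we; exact: egen.
(* v = (1 + d) w. As 1 + A^2 = (1 - d)(1 + d) and 1 + d, 1 - d are adjoint, the forms of (1 +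
   A^2)^-1 and A (1 + A^2)^-1 at v are |w|^2 and <A w, w>. *)
pose v := w + z.
have ve : e (J a b) v = v by rewrite /v (rlinD (op_lin (pvm_oproj E (mJ a b)))) we ze.
have Pv : res u false v = w.
  by have := res_gen ug false wz; rewrite /sg rsN1 opprK.
have vFb : F b v = v.
  rewrite -[in LHS]ve EF// (rlinB (op_lin (specF_proj ug ui b))) (op_idem (specF_proj ug ui b)).
  by rewrite specF_mono// -EF.
have vFa : F a v = 0.
  rewrite -[in LHS]ve EF// (rlinB (op_lin (specF_proj ug ui a))) (op_idem (specF_proj ug ui a)).
  by rewrite specFC specF_mono// subrr.
have := specF_le vFb; have := specF_ge vFa; rewrite !specB_ip.
have -> : ip (specR1 u v) v = ip w w by rewrite (specR1_ip ug) Pv.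
suff -> : ip (specR2 u v) v = ip (ii z) w by move=> h1 h2; apply/andP; split; lra.
have q1 : specR1 u v = res u true w by rewrite (specR1E ug) Pv.
have q2 : specR2 u v = ii (res u true w - w).
  rewrite /specR2; congr (ii _); rewrite -q1 /specR1 -Pv.
  by apply: ipext => y; rewrite !(ipDl, ipNl, ipZl); field.
have g1 := @resP _ _ _ ug true w; rewrite /sg rs1 in g1.
rewrite q2; move: (res u true w) g1 => q g1.
have giz : gen u (ii w) (ii z).
  apply: gen_comm wz; [exact: rlin_ii|exact: bnd_ii|by move=> t y; rewrite ui].
have k1 := gen_skew ug g1 giz.
rewrite /v iiD iiN !(ipDl, ipDr, ipNl, ipNr) !ip_iil.
rewrite !(ipDl, ipDr, ipNl, ipNr) in k1.
have := ip_iil z w; have := ip_iil w w; have := ip_iil w z.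
rewrite (ipC (ii w) w) (ipC (ii z) w) (ipC (ii w) z); lra.
Qed.

Let norm_bound (n : nat) w z : (0 < n)%N -> e (J (- n%:R) n%:R) w = w -> gen u w z ->
  nm z <= n%:R * nm w.
Proof.
move=> n0 we wz; set I := J (- n%:R) n%:R in we.
have mI : measurable I by exact: mJ.
have n0' : 0 < n%:R :> R by rewrite ltr0n.
have nn : - n%:R <= n%:R :> R by lra.
have ze : e I z = z by apply: (gen_uniq _ wz); rewrite -{1}we; exact: egen.
have el := op_lin (pvm_oproj E mI).
(* The polarized form bound 4 <A w, c> <= 2 n (|w|^2 + |c|^2) yields the norm bound at c = A w / n.
   This vector need not lie in the domain, so it is approximated by projected vectors of the
   domain. *)
pose y := rs n%:R^-1 (ii z).
have ye : e I y = y by rewrite /y (rlinZ el) (pvm_ii E _ mI) ze.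
have [a ha ay] := dense_seq y (gen_dense ug).
have key k : 4 * ip (ii z) (e I (a k)) <= 2 * n%:R * (ip w w + ip (e I (a k)) (e I (a k))).
  have [b hb] := ha k; have gb := egen mI hb.
  have ee : e I (e I (a k)) = e I (a k) by exact: op_idem (pvm_oproj E mI) _.
  move: (e I (a k)) (e I b) gb ee => c d gb ee.
  have /andP[_ h1] := form_bounds nn (etrans (rlinD el w c) (congr2 _ we ee)) (genD ug wz gb).
  have /andP[h2 _] := form_bounds nn (etrans (rlinB el w c) (congr2 (fun x y => x - y) we ee)) (genD ug wz (genN ug gb)).
  have gid : gen u (ii c) (ii d).
    apply: gen_comm gb; [exact: rlin_ii|exact: bnd_ii|by move=> t q; rewrite ui].
  have sk := gen_skew ug wz gid.
  have sk2 : ip (ii d) w = ip (ii z) c by rewrite (ip_iil z c) sk opprK ipC.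
  rewrite iiD !(ipDl, ipDr) in h1; rewrite iiD iiN !(ipDl, ipDr, ipNl, ipNr) in h2.
  rewrite (ipC c w) in h1 h2; rewrite sk2 in h1 h2.
  move: h1 h2; move: (ip (ii z) c) (ip (ii z) w) (ip (ii d) c) (ip w w) (ip c c) (ip w c) => p1 p2 p3 p4 p5 p6.
  by move=> h1 h2; lra.
have lim : e I (a k) @[k --> \oo] --> y.
  by rewrite -ye; exact: cvg_op el (op_bnd (pvm_oproj E mI)) ay.
have L1 : 4 * ip (ii z) (e I (a k)) @[k --> \oo] --> 4 * ip (ii z) y.
  by apply: cvgM; [exact: cvg_cst|apply: cvg_ip => //; exact: cvg_cst].
have L2 : 2 * n%:R * (ip w w + ip (e I (a k)) (e I (a k))) @[k --> \oo] --> 2 * n%:R * (ip w w + ip y y).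
  by apply: cvgM; [exact: cvg_cst|apply: cvgD; [exact: cvg_cst|exact: cvg_ip]].
have : 4 * ip (ii z) y <= 2 * n%:R * (ip w w + ip y y).
  by apply: (ler_cvg_to L1 L2); near=> k; exact: key.
rewrite /y !(ipZl, ipZr) ip_ii => H.
rewrite -ler_sqr ?nnegrE ?mulr_ge0 ?nm_ge0// exprMn !nm_sq.
have H' : 4 * (n%:R^-1 * ip z z) * n%:R <= 2 * n%:R * (ip w w + n%:R^-1 * (n%:R^-1 * ip z z)) * n%:R.
  by rewrite ler_pM2r.
have E1 : 4 * (n%:R^-1 * ip z z) * n%:R = 4 * ip z z by field; rewrite gt_eqF.
have E2 : 2 * n%:R * (ip w w + n%:R^-1 * (n%:R^-1 * ip z z)) * n%:R = 2 * (n%:R ^+ 2 * ip w w) + 2 * ip z z.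
  by field; rewrite gt_eqF.
rewrite E1 E2 in H'; lra.
Unshelve. all: by end_near. Qed.

(** On this range d is closed, densely defined and bounded by [norm_bound], hence everywhere
    defined. *)
Let gen_total (n : nat) w : (0 < n)%N -> e (J (- n%:R) n%:R) w = w -> exists z, gen u w z.
Proof.
move=> n0 we; set I := J (- n%:R) n%:R in we.
have mI : measurable I by exact: mJ.
have el := op_lin (pvm_oproj E mI).
have [a ha aw] := dense_seq w (gen_dense ug).
move: (choice ha) => [b hb].
have lim : e I (a k) @[k --> \oo] --> w.
  by rewrite -we; exact: cvg_op el (op_bnd (pvm_oproj E mI)) aw.
have [z hz] : exists z : X, (fun k => e I (b k)) @ \oo --> z.
  apply: (cvg_transfer (cvg_rs (r := n%:R) _ lim)) => k l.
  rewrite -rsN -rsD nmZ (ger0_norm (ler0n _ _)); apply: norm_bound => //.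
    by rewrite (rlinB el) !(op_idem (pvm_oproj E mI)).
  by rewrite -!(rlinB el); apply: egen => //; apply: genD => //; exact: genN.
exists z; apply: (gen_closed ug _ lim hz) => k; exact: egen.
Qed.

Let bJ (n : nat) : bmf (fun t : BR => idR t * \1_(J (- n%:R) n%:R) t).
Proof.
split; first by apply: measurable_funM; [exact: idR_meas|apply: measurable_indic].
exists n%:R => // t; have [h|h] := pselect (J (- n%:R) n%:R t).
  rewrite indicE mem_set// mulr1 /idR; move: h; rewrite /= in_itv /= ler_norml.
  by move=> /andP[/ltW -> ->].
by rewrite indicE memNset// mulr0 normr0.
Qed.

(** A and M both have their forms between a and b on the range of E(]a, b]), so they differ there by
    at most b - a. Halving the interval splits w orthogonally and halves the error, k times over. *)
Let bisect (n k : nat) a b w z : a <= b -> J a b `<=` J (- n%:R) n%:R ->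
  e (J a b) w = w -> gen u w z ->
  `|ip (ii z) w - ip (Mop E (fun t : BR => idR t * \1_(J (- n%:R) n%:R) t) w) w| <= (b - a) / 2 ^+ k * ip w w.
Proof.
set M := Mop _ _.
have Me B x : measurable B -> M (e B x) = e B (M x).
  move=> mB; rewrite -(Mop_indic E mB) /M !Mop_mul//; try exact: bmf_indic.
  by congr (Mop E _ x); apply/funext => t; rewrite mulrC.
elim: k a b w z => [|k IH] a b w z ab sub we wz.
  rewrite expr0 divr1.
  have /andP[h1 h2] := form_bounds ab we wz.
  have ME : ip (M w) w = pI E w (fun t : BR => idR t * \1_(J a b) t).
    have -> : ip (M w) w = ip (Mop E \1_(J a b) (M w)) w by rewrite Mop_indic// -Me// we.
    rewrite /M Mop_mul ?Mop_form//; try exact: bmf_indic.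
    - congr (pI E w _); apply/funext => t.
      have [h|h] := pselect (J a b t); last by rewrite !(ind_out h) mul0r mulr0.
      by rewrite (ind_in h) (ind_in (sub _ h)) mul1r.
    - by apply: bmf_mul => //; exact: bmf_indic.
  have bab : bmf (fun t : BR => idR t * \1_(J a b) t).
    have := bmf_mul (bJ n) (bmf_indic (mJ a b)).
    congr bmf; apply/funext => t.
    have [h|h] := pselect (J a b t); last by rewrite !(ind_out h) !mulr0.
    by rewrite (ind_in h) (ind_in (sub _ h)) !mulr1.
  have cst c : pI E w (fun t : BR => c * \1_(J a b) t) = c * ip w w.
    by rewrite pI_scale ?pI_indic ?we//; exact: bmf_indic.
  have bc c : bmf (fun t : BR => c * \1_(J a b) t) by apply: bmf_mul; [exact: bmf_cst|exact: bmf_indic].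
  have h3 : a * ip w w <= ip (M w) w.
    rewrite ME -cst; apply: pI_le => // t.
    have [h|h] := pselect (J a b t); last by rewrite indicE memNset// !mulr0.
    by rewrite indicE mem_set// !mulr1 /idR; move: h; rewrite /= in_itv /= => /andP[/ltW].
  have h4 : ip (M w) w <= b * ip w w.
    rewrite ME -cst; apply: pI_le => // t.
    have [h|h] := pselect (J a b t); last by rewrite indicE memNset// !mulr0.
    by rewrite indicE mem_set// !mulr1 /idR; move: h; rewrite /= in_itv /= => /andP[].
  by rewrite ler_norml; apply/andP; split; lra.
pose c := (a + b) / 2.
have ac : a <= c by rewrite /c; lra.
have cb : c <= b by rewrite /c; lra.
have sub1 : J a c `<=` J a b.
  by move=> t; rewrite /= !in_itv /= => /andP[-> h]; apply: (le_trans h).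
have sub2 : J c b `<=` J a b.
  by move=> t; rewrite /= !in_itv /= => /andP[h ->]; rewrite (le_lt_trans ac h).
have dj : J a c `&` J c b = set0.
  apply/seteqP; split=> t //=; rewrite !in_itv /= => -[/andP[_ h1] /andP[h2 _]]; lra.
have un : J a b = J a c `|` J c b.
  apply/seteqP; split=> t /=; last by case=> [/sub1|/sub2].
  rewrite !in_itv /= => /andP[h1 h2]; have [h|h] := leP t c; [left|right]; apply/andP; split => //.
pose w1 := e (J a c) w; pose w2 := e (J c b) w.
pose z1 := e (J a c) z; pose z2 := e (J c b) z.
have ze : e (J a b) z = z by apply: (gen_uniq _ wz); rewrite -{1}we; exact: egen.
have wE : w = w1 + w2 by rewrite -[LHS]we un pvm_U.
have zE : z = z1 + z2 by rewrite -[LHS]ze un pvm_U.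
have I1 := IH a c w1 z1 ac (subset_trans sub1 sub) (op_idem (pvm_oproj E (mJ a c)) w) (egen (mJ a c) wz).
have I2 := IH c b w2 z2 cb (subset_trans sub2 sub) (op_idem (pvm_oproj E (mJ c b)) w) (egen (mJ c b) wz).
have orth x y : ip (e (J a c) x) (e (J c b) y) = 0.
  by rewrite (op_sym (pvm_oproj E (mJ a c))) pvm_disj// ip0r.
have o1 : ip (ii z1) w2 = 0 by rewrite /z1 -(pvm_ii E _ (mJ a c)) orth.
have o2 : ip (ii z2) w1 = 0 by rewrite /z2 -(pvm_ii E _ (mJ c b)) ipC orth.
have o3 : ip (M w1) w2 = 0 by rewrite /w1 Me// orth.
have o4 : ip (M w2) w1 = 0 by rewrite /w2 Me// ipC orth.
have o5 : ip w1 w2 = 0 by rewrite orth.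
have Ml : rlin M by exact: Mop_rlin.
have -> : ip (ii z) w - ip (M w) w = (ip (ii z1) w1 - ip (M w1) w1) + (ip (ii z2) w2 - ip (M w2) w2).
  by rewrite {1}zE wE iiD (rlinD Ml) !(ipDl, ipDr) o1 o2 o3 o4; ring.
have -> : ip w w = ip w1 w1 + ip w2 w2 by rewrite wE !(ipDl, ipDr) (ipC w2) o5; ring.
apply: (le_trans (ler_normD _ _)); apply: (le_trans (lerD I1 I2)).
rewrite exprS invfM /c; move: (2 ^+ k) => q; lra.
Qed.

Let gen_Mop (n : nat) x z : (0 < n)%N -> gen u (e (J (- n%:R) n%:R) x) z ->
  ii z = Mop E (fun t : BR => idR t * \1_(J (- n%:R) n%:R) t) x.
Proof.
move=> n0; set I := J (- n%:R) n%:R.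
have mI : measurable I by exact: mJ.
have el := op_lin (pvm_oproj E mI); have ee := op_idem (pvm_oproj E mI).
have nn : - n%:R <= n%:R :> R by have : 0 <= n%:R :> R by []; lra.
set M := Mop _ _.
have bI : bmf (fun t : BR => idR t * \1_I t) := bJ n.
(* g = d E(I) is everywhere defined, so i g and M are symmetric operators, and it suffices to
   compare their quadratic forms. *)
have /choice[g hg] : forall x, exists z, gen u (e I x) z.
  by move=> y; apply: (@gen_total n) => //; exact: ee.
have ge y : e I (g y) = g y.
  by apply: (gen_uniq _ (hg y)); rewrite -{1}(ee y); exact: egen.
have gl : rlin g.
  split=> [y y'|r y].
    by apply: (gen_uniq (hg _)); rewrite (rlinD el); exact: genD.
  by apply: (gen_uniq (hg _)); rewrite (rlinZ el); exact: genZ.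
have Me y : M (e I y) = M y.
  rewrite -(Mop_indic E mI) /M Mop_mul//; last exact: bmf_indic.
  congr (Mop E _ y); apply/funext => t; rewrite indicE.
  by case: (_ \in _); rewrite ?mulr0// !mulr1.
have eM y : e I (M y) = M y.
  rewrite -(Mop_indic E mI) /M Mop_mul//; last exact: bmf_indic.
  congr (Mop E _ y); apply/funext => t; rewrite indicE.
  by case: (_ \in _); rewrite ?mulr0 ?mul0r// mul1r.
suff LM : (fun y => ii (g y)) = M.
  by move=> hz; rewrite -LM; congr (ii _); exact: gen_uniq hz (hg x).
apply: rsym_quad_eq.
- exact: rlin_comp rlin_ii gl.
- exact: Mop_rlin.
- move=> y y'.
  have gi : gen u (ii (e I y')) (ii (g y')).
    by apply: gen_comm (hg y'); [exact: rlin_ii|exact: bnd_ii|by move=> t q; rewrite ui].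
  have sk := gen_skew ug (hg y) gi.
  have e1 : ip (g y) (ii y') = ip (g y) (ii (e I y')).
    by rewrite -{1}(ge y) (op_sym (pvm_oproj E mI)) pvm_ii.
  have e2 : ip (e I y) (ii (g y')) = ip y (ii (g y')).
    by rewrite (op_sym (pvm_oproj E mI)) pvm_ii// ge.
  by rewrite ip_iil e1 sk e2 opprK.
- exact: Mop_sym.
- move=> y.
  have -> : ip (ii (g y)) y = ip (ii (g y)) (e I y).
    by rewrite -(op_sym (pvm_oproj E mI)) pvm_ii// ge.
  have -> : ip (M y) y = ip (M (e I y)) (e I y).
    by rewrite Me -(op_sym (pvm_oproj E mI)) eM.
  apply/eqP; rewrite -subr_eq0 -normr_le0.
  have H k : `|ip (ii (g y)) (e I y) - ip (M (e I y)) (e I y)| <=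
      (n%:R - - n%:R) / 2 ^+ k * ip (e I y) (e I y).
    by apply: bisect => //; exact: ee.
  apply: (@geometric_le0 R _ ((n%:R - - n%:R) * ip (e I y) (e I y)) 1 2) => //; first by rewrite ltr1n.
  move=> k; rewrite expr1n mul1r mulrC -ler_pdivlMr ?exprn_gt0//.
  by rewrite mulrAC.
Qed.

Lemma sagen_spectral x y : sagen x y <-> pvm_int E idR x y.
Proof.
(* The truncation sets are closed intervals and the spectral family provides half-open ones;
   enlarging n by one absorbs the endpoint - n. *)
have sub n : trB idR n `<=` J (- n.+1%:R) n.+1%:R.
  move=> t /trB_in; rewrite /idR ler_norml /= in_itv /= => /andP[h1 h2].
  have : (n%:R : R) < n.+1%:R by rewrite ltr_nat.
  by move=> h3; apply/andP; split; lra.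
have mB n := trB_meas (@idR_meas R) n.
have comb n w : Mop E (fun t : BR => idR t * \1_(J (- n.+1%:R) n.+1%:R) t) (pvm_proj E (trB idR n) w)
   = Mop E (trf idR n) w.
  rewrite -(Mop_indic E (mB n)) Mop_mul//; last exact: bmf_indic.
  congr (Mop E _ w); apply/funext => t; rewrite /trf.
  have [h|h] := pselect (trB idR n t); last by rewrite !(ind_out h) !mulr0.
  by rewrite (ind_in h) (ind_in (sub n _ h)) !mulr1.
have gB n w z : gen u (e (trB idR n) w) z -> ii z = Mop E (trf idR n) w.
  rewrite -comb => hz; apply: gen_Mop => //.
  by rewrite pvm_le//; exact: sub.
split=> [[z xz ->]|/(@pvm_intP _ _ E _ (@idR_meas R)) h].
  apply/(@pvm_intP _ _ E _ (@idR_meas R)) => n.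
  by rewrite pvm_ii//; apply: gB; exact: egen.
exists (- ii y); last by rewrite iiN iiK opprK.
have c1 := @en_cvg _ _ E _ (@idR_meas R) x.
have c2 : - ii (e (trB idR n) y) @[n --> \oo] --> - ii y.
  by apply: cvgN; apply: cvg_ii; exact: (@en_cvg _ _ E _ (@idR_meas R) y).
apply: (gen_closed ug _ c1 c2) => n.
have [z hz] : exists z, gen u (e (trB idR n) x) z.
  by apply: (@gen_total n.+1) => //; rewrite pvm_le//; exact: sub.
rewrite h -(gB _ _ _ hz) iiK opprK; exact: hz.
Qed.

End WithE.

Theorem spectral_exists : exists E : pvm X, forall x y, sagen x y <-> pvm_int E idR x y.
Proof.
have [E EF Eu] := spectral_pvm_ex ug ui.
by exists E; exact: sagen_spectral EF Eu.
Qed.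

End SpectralExistence.

(** * The standard subspace *)

Section SpectralCommutation.
Context {R : realType} {X : hilbertType R}.
Implicit Types (x y z w : X).
Notation BR := (measurableTypeR R).
Implicit Types (B : set BR) (E : pvm X).

Lemma pvm_int_pushforward E E' (phi f : BR -> BR) x y :
  measurable_fun setT phi -> measurable_fun setT f ->
  (forall B z, measurable B -> pvm_proj E' B z = pvm_proj E (phi @^-1` B) z) ->
  pvm_int E' f x y <-> pvm_int E (fun t => f (phi t)) x y.
Proof.
move=> mphi mf h.
have mfp : measurable_fun setT (fun t => f (phi t)) by exact: (measurableT_comp mf mphi).
have MM n z : Mop E (trf (fun t => f (phi t)) n) z = Mop E' (trf f n) z.
  apply: (@Mop_intertwine _ _ E E' id phi) => //; last exact: trf_bmf.
  - by exists 1 => w; rewrite mul1r.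
  - by move=> B w mB; rewrite h.
split=> [/(@pvm_intP _ _ E' _ mf) H|/(@pvm_intP _ _ E _ mfp) H].
  apply/(@pvm_intP _ _ E _ mfp) => n; rewrite MM -H h//; exact: trB_meas.
apply/(@pvm_intP _ _ E' _ mf) => n; rewrite -MM -H h//; exact: trB_meas.
Qed.

Lemma pvm_int_opp E (f : BR -> R) x y : measurable_fun setT f ->
  pvm_int E f x y -> pvm_int E (fun t => - f t) x (- y).
Proof.
move=> mf; have mf' : measurable_fun setT (fun t => - f t) by exact: measurableT_comp.
have Bt n : trB (fun t => - f t) n = trB f n.
  by apply/seteqP; split=> t /trB_in h; apply/trB_in; rewrite ?normrN// -normrN.
move=> /(@pvm_intP _ _ E _ mf) h; apply/(@pvm_intP _ _ E _ mf') => n.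
have -> : trf (fun t => - f t) n = fun t => (- 1) * trf f n t.
  by apply/funext => t; rewrite /trf Bt; ring.
rewrite Mop_scale; last exact: trf_bmf.
by rewrite Bt (rlinN (op_lin (pvm_oproj E (trB_meas mf n)))) h rsN1.
Qed.

Variable u : R -> X -> X.
Hypotheses (ug : ugroup u) (ui : forall t x, u t (ii x) = ii (u t x)).
Variable E : pvm X.
Hypothesis EA : forall x y, sagen u x y <-> pvm_int E idR x y.

Definition eball (n : nat) : X -> X := pvm_proj E (`[- n%:R, n%:R]%classic : set BR).

Lemma mball (n : nat) : measurable (`[- n%:R, n%:R]%classic : set BR).
Proof. exact: measurable_itv. Qed.

Lemma eball_oproj n : oprojection (eball n).
Proof. exact: pvm_oproj (mball n). Qed.

Lemma eball_cvg x : eball n x @[n --> \oo] --> x.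
Proof. exact: (@en_cvg _ _ E _ (@idR_meas R)). Qed.

(* The ranges of the [eball n] are determined by the generator without the
   complex structure, so that real-linear isometries commuting with the group
   preserve them. *)
Lemma spgenP (n : nat) x : spseq (gen u) 0 n%:R x <-> eball n x = x.
Proof.
have n0 : 0 <= n%:R :> R by [].
have := @spseqP _ _ E 0 n%:R x n0; rewrite sub0r add0r => <-.
have nI (s : R) k y : s = 1 \/ s = -1 -> nm (iter k (fun y => rs s (ii y)) y) = nm y.
  move=> hs; elim: k => //= k IH; rewrite nmZ nm_ii IH.
  by case: hs => ->; rewrite ?normrN1 ?normr1 mul1r.
have gI (s : R) k y z : gen u y z ->
    gen u (iter k (fun y => rs s (ii y)) y) (iter k (fun y => rs s (ii y)) z).
  move=> g; elim: k => //= k IH; apply: (gen_comm (f := fun y => rs s (ii y)) _ _ _ IH).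
  - exact: rlin_rs rlin_ii.
  - by exists `|s| => w; rewrite nmZ nm_ii.
  - by move=> t w; rewrite (rlinZ (ug_lin ug t)) ui.
split=> -[v [v0 vA vn]].
  (* Multiplying the k-th term by i^k turns a chain for d into one for A = i d without changing
     norms; (- i)^k goes back. *)
  exists (fun k => iter k (fun y => rs 1 (ii y)) (v k)); split => //.
    move=> k; apply/EA; have := vA k; rewrite !rs0 !addr0 => /(gI 1 k) g.
    exists (iter k (fun y => rs 1 (ii y)) (v k.+1)) => //.
    by rewrite /= rs1.
  by move=> k; rewrite nI; [exact: vn|left].
exists (fun k => iter k (fun y => rs (-1) (ii y)) (v k)); split => //.
  move=> k; have /EA[z g e] := vA k; move: e; rewrite !rs0 !addr0 => e.
  rewrite iterSr e iiK rsN1 opprK; exact: gI.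
by move=> k; rewrite nI; [exact: vn|right].
Qed.

(** By [spgenP], s maps the range of the projection into itself; an isometric involution is its own
    adjoint, so it preserves the orthogonal complement too. *)
Lemma eball_comm (s : X -> X) n x : rlin s -> (forall y, nm (s y) = nm y) -> involutive s ->
  (forall t y, s (u t y) = u t (s y)) -> s (eball n x) = eball n (s x).
Proof.
move=> sl sn sK su; have he := eball_oproj n.
have sym y z : ip (s y) z = ip y (s z) by rewrite -{1}(sK z) (iso_ip sl sn).
have h y : eball n (s (eball n y)) = s (eball n y).
  apply/spgenP; have /spgenP[v [v0 vA vn]] := op_idem he y.
  exists (fun k => s (v k)); split; first by rewrite v0.
    move=> k; have := vA k; rewrite !rs0 !addr0.
    by apply: gen_comm => //; exact: bnd_iso.
  by move=> k; rewrite !sn.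
apply: ipext => y.
by rewrite [RHS](op_sym he) [RHS]sym -(h y) -(op_sym he) -sym -(op_sym he) h.
Qed.

Lemma eball_invariant (K : set X) n x : closed K -> real_subspace K ->
  (forall t y, K y -> K (u t y)) -> K x -> K (eball n x).
Proof.
move=> cK sK Ku Kx.
have pl := oproj_rlin cK sK.
(* The reflection at [K] commutes with the group. *)
pose s y := rs 2 (oproj K y) - y.
have sl : rlin s by apply: rlin_sub => //; exact: rlin_rs.
have pK y : K (oproj K y) by case: (@oprojP _ _ _ cK sK y).
have h : s (eball n x) = eball n (s x).
  apply: eball_comm => //.
  - move=> y; congr (Num.sqrt _); rewrite /s !(ipDl, ipDr, ipNl, ipNr, ipZl, ipZr).
    by rewrite (oproj_nm cK sK) (ipC y); ring.
  - move=> y; rewrite {1}/s {1}/s (rlinB pl) (rlinZ pl) (oprojK cK sK).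
    by apply: ipext => z; rewrite /s !(ipDl, ipNl, ipZl); ring.
  - move=> t y; rewrite /s (rlinB (ug_lin ug t)) (rlinZ (ug_lin ug t)).
    congr (rs 2 _ - _); apply: oproj_uniq => //; first exact: Ku.
    move=> k Kk; rewrite -(rlinB (ug_lin ug t)) (ug_adj ug).
    by apply: (@oprojP _ _ _ cK sK y).2; exact: Ku.
have sx : s x = x.
  by rewrite /s (oproj_id cK sK)//; apply: ipext => z; rewrite !(ipDl, ipNl, ipZl); ring.
rewrite sx in h.
have -> : eball n x = oproj K (eball n x); last exact: pK.
have : rs 2^-1 (s (eball n x) + eball n x) = rs 2^-1 (eball n x + eball n x) by rewrite h.
rewrite /s subrK rsA mulVf// rs1 => ->.
by apply: ipext => z; rewrite !(ipDl, ipNl, ipZl); field.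
Qed.

End SpectralCommutation.

(** * The fixed space of J Delta^(1/2) and its invariant real subspaces *)

Section StandardSubspace.
Context {R : realType} {X : hilbertType R}.
Implicit Types (x y z w : X).
Notation BR := (measurableTypeR R).
Implicit Types (B : set BR).
Variable u : R -> X -> X.
Hypotheses (ug : ugroup u) (ui : forall t x, u t (ii x) = ii (u t x)).
Variable E : pvm X.
Hypothesis EA : forall x y, sagen u x y <-> pvm_int E idR x y.
Variable J : X -> X.
Hypotheses (Jl : rlin J) (Jn : forall x, nm (J x) = nm x) (JK : involutive J).
Hypotheses (Ji : forall x, J (ii x) = - ii (J x)) (Ju : forall t x, J (u t x) = u t (J x)).
Notation e := (eball E).

Let mopp : measurable_fun setT (fun t : BR => - t : BR).
Proof. exact: measurableT_comp. Qed.

(** J commutes with d and anticommutes with i, hence J A J = - A. So the image of E under J and t ->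
    - t is again a spectral measure of A, and uniqueness identifies it with E. *)
Lemma conj_spectral B x : measurable B ->
  J (pvm_proj E ((fun t : BR => - t : BR) @^-1` B) x) = pvm_proj E B (J x).
Proof.
move=> mB.
have Jb : bnd J by exact: bnd_iso.
have mid' : measurable_fun setT (fun t : BR => - idR t : BR) by exact: mopp.
have JA y z : sagen u y z -> sagen u (J y) (- J z).
  move=> [w g ->]; exists (J w); first exact: gen_comm g.
  by rewrite Ji opprK.
have Jp C w : measurable C -> ii (J (pvm_proj E C (J w))) = J (pvm_proj E C (J (ii w))).
  by move=> mC; rewrite Ji (rlinN (op_lin (pvm_oproj E mC))) pvm_ii// (rlinN Jl) Ji opprK.
have [E' hE'] := pvm_transport_ex Jl Jl Jn JK JK Jp mopp.
have h y z : pvm_int E idR y z <-> pvm_int E' idR y z.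
  split=> [/EA/JA/EA/(pvm_int_opp (@idR_meas R))|H].
    rewrite opprK => H.
    rewrite -(JK y) -(JK z).
    apply: (@pvm_int_intertwine _ _ E E' J (fun t : BR => - t : BR) idR) => //; first exact: idR_meas.
    by move=> C w mC; rewrite hE'// JK.
  have H2 : pvm_int E (fun t => - idR t) (J y) (J z).
    apply: (@pvm_int_intertwine _ _ E' E J (fun t : BR => - t : BR) (fun t => - idR t)) => //.
      move=> C w mC; rewrite hE' ?JK; last by rewrite -[X in measurable X]setTI; exact: mopp.
      congr (pvm_proj E _ _); apply/seteqP; split=> t /=; rewrite opprK//.
    by rewrite (_ : (fun t => _) = idR)//; apply/funext => t; rewrite /idR opprK.
  have := pvm_int_opp mid' H2.
  rewrite (_ : (fun t => _) = idR); last by apply/funext => t; rewrite opprK.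
  by move=> /EA/JA/EA; rewrite (rlinN Jl) opprK !JK.
by rewrite (spectral_uniq h mB) hE'// JK.
Qed.

(** Delta = exp(2 pi A) for A = i dU(h), so this is the symbol of Delta^(1/2). *)
Definition halfmod (t : BR) : R := expR (pi * t).

Lemma expR_meas (c : R) : measurable_fun setT (fun t : BR => expR (c * t) : BR).
Proof.
apply: measurableT_comp; first exact: measurable_expR.
by apply: measurable_funM; [exact: measurable_cst|exact: measurable_id].
Qed.

Lemma halfmod_meas : measurable_fun setT halfmod.
Proof. exact: expR_meas. Qed.

(** J being an involution, J Delta^(1/2) x = x amounts to Delta^(1/2) x = J x, which needs no
    intermediate vector. *)
Definition stdV : set X := [set x | pvm_int E halfmod x (J x)].

Lemma stdV_subspace : real_subspace stdV.
Proof.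
split.
- apply/(@pvm_intP _ _ E _ halfmod_meas) => n.
  rewrite (rlin0 Jl) (rlin0 (op_lin (pvm_oproj E (trB_meas halfmod_meas n)))).
  by rewrite (rlin0 (Mop_rlin E (trf_bmf halfmod_meas n))).
- by move=> x y; rewrite /stdV /= (rlinD Jl); apply: (@pvm_intD _ _ E _ halfmod_meas).
- move=> r x; rewrite /stdV /= -[_ *: _]/(rs r x) (rlinZ Jl).
  exact: (@pvm_intZ _ _ E _ halfmod_meas).
Qed.

Lemma stdV_closed : closed stdV.
Proof.
apply: closed_seq => v x vV vx; apply: (@pvm_int_closed _ _ E _ halfmod_meas v (fun n => J (v n))) => //.
by apply: cvg_op => //; exact: bnd_iso.
Qed.

(** Delta^(1/2) takes i x to i J x by linearity, and to J (i x) = - i J x if i x is in the space. *)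
Lemma stdV_ii x : stdV x -> stdV (ii x) -> x = 0.
Proof.
rewrite /stdV /= Ji => /(@pvm_int_ii _ _ E _ halfmod_meas) h1 h2.
have h := @pvm_int_uniq _ _ E _ halfmod_meas _ _ _ h1 h2.
have : ip (ii (J x)) (ii (J x)) = 0.
  by have := congr1 (ip (ii (J x))) h; rewrite ipNr; lra.
by rewrite ip_ii (iso_ip Jl Jn) => /ip_eq0.
Qed.

Lemma J_eball n x : J (e n x) = e n (J x).
Proof.
rewrite /eball -conj_spectral; last exact: mball.
congr (J (pvm_proj E _ x)); apply/seteqP; split=> t /=; rewrite !in_itv /= -!ler_norml normrN//.
Qed.

Definition modball (b : bool) n (t : BR) : R :=
  expR ((if b then pi else - pi) * t) * \1_(`[- n%:R, n%:R]%classic : set BR) t.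

Lemma modball_bmf b n : bmf (modball b n).
Proof.
split.
  by apply: measurable_funM; [exact: expR_meas|apply: measurable_indic; exact: mball].
exists (expR (pi * n%:R)) => [|t]; first exact: expR_ge0.
rewrite /modball; have [h|h] := pselect ((`[- n%:R, n%:R]%classic : set BR) t); last first.
  by rewrite (ind_out h) mulr0 normr0 expR_ge0.
rewrite (ind_in h) mulr1 ger0_norm ?expR_ge0// ler_expR.
move: h => /=; rewrite in_itv /= => /andP[h1 h2].
have p0 := pi_ge0 R; case: b; nra.
Qed.

(* [modop true n] and [modop false n] are Delta^(1/2) and Delta^(-1/2) cut off
   to the range of [eball n]. *)
Definition modop b n : X -> X := Mop E (modball b n).

Lemma modop_total n x : pvm_int E halfmod (e n x) (modop true n x).
Proof. exact: (@pvm_int_bounded _ _ E _ halfmod_meas _ x (mball n) (modball_bmf true n)). Qed.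

Lemma modop_restr n x y : pvm_int E halfmod x y -> e n y = modop true n x.
Proof.
apply: (@pvm_int_restr _ _ E _ halfmod_meas _ x y (mball n)).
(* On [- n, n] the symbol is at most exp(pi n), so the ball lies in a truncation set of
   [halfmod]. *)
exists (Num.truncn (expR (pi * n%:R) : R)).+1 => t h; apply/(trB_in halfmod); apply/ltW.
apply: le_lt_trans (truncnS_gt _).
rewrite /halfmod ger0_norm ?expR_ge0// ler_expR.
move: h => /=; rewrite in_itv /= => /andP[h1 h2].
have p0 := pi_ge0 R; nra.
Qed.

(** J reflects the spectrum, so it exchanges exp(pi t) and exp(- pi t): J Delta^(1/2) J =
    Delta^(-1/2). *)
Lemma modop_J b n x : J (modop b n x) = modop (~~ b) n (J x).
Proof.
rewrite /modop; have -> : modball b n = fun t => modball (~~ b) n (- t).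
  apply/funext => t; rewrite /modball; congr (expR _ * _).
    by case: b => /=; ring.
  by rewrite !indicE; congr (_%:R); congr nat_of_bool; apply/idP/idP;
    rewrite !inE /= !in_itv /= -!ler_norml normrN.
apply: (@Mop_intertwine _ _ E E J (fun t : BR => - t : BR)) => //; first exact: bnd_iso.
  by move=> B y mB; rewrite conj_spectral.
exact: modball_bmf.
Qed.

Lemma modopK n x : modop true n (modop false n x) = e n x.
Proof.
rewrite /modop Mop_mul; [|exact: modball_bmf|exact: modball_bmf].
rewrite /eball -(Mop_indic E (mball n)); congr (Mop E _ x); apply/funext => t.
rewrite /modball mulrACA -expRD mulNr subrr expR0 mul1r.
by rewrite indicE; case: (_ \in _); rewrite ?mulr0 ?mulr1.
Qed.

Lemma modop_eball b n x : e n (modop b n x) = modop b n x.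
Proof.
rewrite /eball -(Mop_indic E (mball n)) /modop Mop_mul; [|exact: bmf_indic (mball n)|exact: modball_bmf].
congr (Mop E _ x); apply/funext => t; rewrite /modball indicE.
by case: (_ \in _); rewrite ?mulr0 ?mulr1 ?mul1r.
Qed.

Lemma modop_rlin b n : rlin (modop b n).
Proof. exact: Mop_rlin (modball_bmf b n). Qed.

Lemma modop_ii b n x : modop b n (ii x) = ii (modop b n x).
Proof. exact: Mop_ii (modball_bmf b n). Qed.

Lemma eball_ii n x : e n (ii x) = ii (e n x).
Proof. exact: pvm_ii (mball n). Qed.

(** On the range of [e n] the operator S = J Delta^(1/2) is an involution, hence y + S y is fixed by
    S. *)
Lemma stdV_re n x : stdV (e n x + J (modop true n x)).
Proof.
rewrite /stdV /= (rlinD Jl) JK modop_J addrC J_eball /=.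
apply: (@pvm_intD _ _ E _ halfmod_meas); last exact: modop_total.
rewrite -modopK -{1}modop_eball; exact: modop_total.
Qed.

Lemma stdV_decomp n x : exists v w, [/\ stdV v, stdV w & e n x = v + ii w].
Proof.
have [_ _ sZ] := stdV_subspace.
(* With y = e n x these are (y + S y) / 2 and (- i y + S (- i y)) / 2, the real and imaginary parts
   of y for the antilinear involution S. *)
exists (rs 2^-1 (e n x + J (modop true n x))), (rs 2^-1 (e n (- ii x) + J (modop true n (- ii x)))).
split; [apply: sZ; exact: stdV_re|apply: sZ; exact: stdV_re|].
rewrite (rlinN (op_lin (eball_oproj E n))) eball_ii.
rewrite (rlinN (modop_rlin true n)) modop_ii (rlinN Jl) Ji opprK iiZ iiD iiN !iiK opprK.
by apply: ipext => z; rewrite !(ipDl, ipNl, ipZl); field.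
Qed.

Lemma stdV_standard : standard stdV.
Proof.
have sub := stdV_subspace; split => //; first exact: stdV_closed.
  apply/dense_nmP => x d d0.
  have /cvg_nmP/(_ _ d0)[n _ hn] := @eball_cvg _ _ E x.
  have [v [w [vV wV h]]] := stdV_decomp n x.
  by exists (e n x); [exists v => //; exists w|exact: hn n (leqnn n)].
apply/seteqP; split=> [x [xV [y yV yx]]|_ ->]; last first.
  by case: sub => V0 _ _; split => //; exists 0 => //; rewrite scaler0.
have y0 : y = 0 by apply: stdV_ii => //; rewrite -[ii y]/('i *: y) yx.
by rewrite -yx y0 /= scaler0.
Qed.

Section InvariantSubspace.
Variable K : set X.
Hypotheses (cK : closed K) (sK : real_subspace K) (Ku : forall t y, K y -> K (u t y)).

Lemma cyclic_sub_stdV : K `<=` stdV -> cyclic K -> K = stdV.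
Proof.
move=> KV cycK; apply/seteqP; split => // v vV.
have S n k : K k -> J (modop true n k) = e n k.
  by move=> /KV/(@modop_restr n) <-; rewrite -J_eball JK.
have Kev n : K (e n v).
  have [c cK' cv] := @dense_seq _ _ _ v cycK.
  have P j : exists kl : X * X, [/\ K kl.1, K kl.2 & c j = kl.1 + ii kl.2].
    by have [k Kk [l Kl <-]] := cK' j; exists (k, l).
  have [kl hkl] := choice P.
  have el := op_lin (eball_oproj E n).
  have c1 : e n (c j) @[j --> \oo] --> e n v by apply: cvg_op => //; exact: op_bnd (eball_oproj E n).
  have c2 : J (modop true n (c j)) @[j --> \oo] --> J (modop true n v).
    by apply: cvg_op => //; [exact: bnd_iso|apply: cvg_op => //; [exact: modop_rlin|exact: Mop_bnd (modball_bmf true n)]].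
  have Sv : J (modop true n v) = e n v.
    by rewrite -(modop_restr n vV) -J_eball JK.
  rewrite Sv in c2.
  have -> : e n v = rs 2^-1 (e n v + e n v).
    by apply: ipext => z; rewrite !(ipDl, ipNl, ipZl); field.
  apply: (@closed_lim _ _ _ (fun j => rs 2^-1 (e n (c j) + J (modop true n (c j)))) _ cK).
    move=> j.
    have [Kk Kl ->] := hkl j; rewrite (rlinD (modop_rlin true n)) modop_ii.
    rewrite (rlinD Jl) Ji !S// (rlinD el).
    rewrite eball_ii.
    suff -> : rs 2^-1 (e n (kl j).1 + ii (e n (kl j).2) + (e n (kl j).1 - ii (e n (kl j).2))) = e n (kl j).1.
      exact: (eball_invariant ug ui EA).
    by apply: ipext => z; rewrite !(ipDl, ipNl, ipZl); field.
  by apply: cvg_rs; apply: cvgD.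
exact: (@closed_lim _ _ _ _ _ cK Kev (@eball_cvg _ _ E v)).
Qed.

Lemma separating_sup_stdV : stdV `<=` K -> separating K -> K = stdV.
Proof.
move=> VK sepK; apply/seteqP; split => // k Kk.
apply: (@closed_lim _ _ _ _ _ stdV_closed _ (@eball_cvg _ _ E k)) => n.
have Kn : K (e n k) by exact: eball_invariant cK sK Ku Kk.
have [v [w [vV wV h]]] := stdV_decomp n k.
have iwK : K (ii w).
  rewrite -[ii w](addKr v) -h addrC; apply: rsubB => //; exact: VK.
have : (K `&` [set 'i *: x | x in K]) (ii w) by split => //; exists w => //; exact: VK.
by rewrite sepK /= h => ->; rewrite addr0.
Qed.

End InvariantSubspace.

End StandardSubspace.

(** * The two-step functional calculus that defines Delta^(1/2) *)

Section FunctionalCalculus.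
Context {R : realType} {X : hilbertType R}.
Implicit Types (x y : X).
Notation BR := (measurableTypeR R).

Lemma fun_calcP (A : operator X) (E : pvm X) (f : BR -> R) x y : measurable_fun setT f ->
  (forall v w, A v w <-> pvm_int E idR v w) -> fun_calc A f x y <-> pvm_int E f x y.
Proof.
move=> mf AE; split=> [[E' AE' h]|h]; last by exists E.
apply: (@spectral_uniq_int _ _ E' E f mf _ x y h) => v w.
exact: (iff_trans (iff_sym (AE' v w)) (AE v w)).
Qed.

(** The spectral measure of f(A) is the push-forward of E under f, so that the outer square root
    composes with f(t) = exp(2 pi t) to exp(pi t). *)
Lemma sqrt_exp_calcP (A : operator X) (E : pvm X) x y :
  (forall v w, A v w <-> pvm_int E idR v w) ->
  fun_calc (fun_calc A (fun t => expR (2 * pi * t))) Num.sqrt x y <->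
  pvm_int E halfmod x y.
Proof.
move=> AE; set f : BR -> BR := fun t => expR (2 * pi * t).
have mf : measurable_fun setT f by exact: expR_meas.
have msq : measurable_fun setT (Num.sqrt : BR -> BR).
  by apply: continuous_measurable_fun; exact: sqrt_continuous.
have l1 : rlin (@id X) by [].
have [|E' hE'] := @pvm_transport_ex _ _ E id id f l1 l1 (fun=> erefl) (fun=> erefl) (fun=> erefl) _ mf.
  by move=> B z mB; rewrite pvm_ii.
have h v w : fun_calc A f v w <-> pvm_int E' idR v w.
  apply: (iff_trans (fun_calcP v w mf AE)); apply: iff_sym.
  exact: (pvm_int_pushforward v w mf (@idR_meas R) hE').
apply: (iff_trans (fun_calcP x y msq h)).
have -> : halfmod = fun t : BR => Num.sqrt (f t).
  apply/funext => t; rewrite /f /halfmod.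
  rewrite (_ : 2 * pi * t = pi * t + pi * t); last by ring.
  by rewrite expRD -expr2 sqrtr_sqr ger0_norm ?expR_ge0.
exact: (pvm_int_pushforward x y mf msq hE').
Qed.

End FunctionalCalculus.

(** * Local calculus on the Lie group *)

Section ContinuousDerivatives.
Context {R : realType}.

(* A finite frame of [E] is a spanning family with bounded linear coordinates;
   it stands for finite-dimensionality. *)
Definition frame (E : normedModType R) (I : finType) (b : I -> E) (l : I -> E -> R) : Prop :=
  [/\ forall v, v = \sum_i l i v *: b i, forall i, linear_for *%R (l i) &
      forall i v, `|l i v| <= `|v|].

Lemma frame_rV n : frame (fun i : 'I_n => delta_mx 0 i : 'rV[R]_n) (fun i v => v 0 i).
Proof.
split=> [v|i a v w|i v]; first exact: row_sum_delta.
  by rewrite !mxE.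
rewrite [leRHS]mx_normrE.
exact: (@le_bigmax _ _ _ _ (fun ij : 'I_1 * 'I_n => `|v ij.1 ij.2|) (0, i)).
Qed.

Lemma frame_prod (E F : normedModType R) (I J : finType) (b : I -> E) l (c : J -> F) m :
  frame b l -> frame c m ->
  frame (fun k : I + J => match k with inl i => (b i, 0) | inr j => (0, c j) end : E * F)
    (fun k v => match k with inl i => l i v.1 | inr j => m j v.2 end).
Proof.
move=> [b1 b2 b3] [c1 c2 c3]; split=> [[v w]|[i|j] a [v w] [v' w']|[i|j] [v w]] /=.
- rewrite big_sumType /= [X in (X, _)]b1 [X in (_, X)]c1.
  have h1 (a : I -> E) : (\sum_i a i, 0) = \sum_i ((a i, 0) : E * F).
    by apply: (big_morph (fun a : E => (a, 0) : E * F)) => // p q; congr pair; rewrite addr0.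
  have h2 (a : J -> F) : (0, \sum_i a i) = \sum_i ((0, a i) : E * F).
    by apply: (big_morph (fun a : F => (0, a) : E * F)) => // p q; congr pair; rewrite addr0.
  transitivity ((\sum_i l i v *: b i, 0) + (0, \sum_i m i w *: c i) : E * F).
    by congr pair; rewrite ?addr0 ?add0r.
  rewrite h1 h2; congr (_ + _); apply: eq_bigr => i _.
    by congr pair; rewrite scaler0.
  by congr pair; rewrite scaler0.
- exact: b2.
- exact: c2.
- by apply: (le_trans (b3 _ _)); rewrite le_max lexx.
- by apply: (le_trans (c3 _ _)); rewrite le_max lexx orbT.
Qed.

Lemma is_derive_line (V W : normedModType R) (f : V -> W) y v s :
  derivable f (y + s *: v) v ->
  is_derive s (1 : R) (fun s => f (y + s *: v)) ('D_v f (y + s *: v)).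
Proof.
have E : (fun h : R => h^-1 *: (((fun s : R => f (y + s *: v)) \o shift s) (h *: 1) - f (y + s *: v)))
  = (fun h => h^-1 *: ((f \o shift (y + s *: v)) (h *: v) - f (y + s *: v))).
  apply/funext => h /=; congr (_ *: (f _ - _)).
  by rewrite [h *: 1]mulr1 scalerDl addrCA.
by move=> fd; split; rewrite /derivable /derive E.
Qed.

Lemma partial_increment (E : normedModType R) (D : set E) (f : E -> R) x v e :
  open D -> (forall y, D y -> derivable f y v) -> {for x, continuous ('D_v f)} -> D x -> 0 < e ->
  exists2 d, 0 < d & forall y t, `|y - x| < d -> `|t| < d ->
    `|f (y + t *: v) - f y - t * 'D_v f x| <= e * `|t|.
Proof.
move=> oD fd fc Dx e0.
have /nbhs_ballP[r r0 hr] : \forall y \near x, D y /\ `|'D_v f x - 'D_v f y| <= e.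
  near=> y; split; first by near: y; exact: open_nbhs_nbhs.
  by near: y; move/cvgrPdist_le : fc => /(_ _ e0).
have hr' y : `|y - x| < r -> D y /\ `|'D_v f x - 'D_v f y| <= e.
  by move=> h; apply: hr; rewrite -ball_normE /= distrC.
have dpos : 0 < r / (2 * (`|v| + 1)) by rewrite divr_gt0// mulr_gt0// ltr_wpDl.
have hv1 : 0 < `|v| + 1 by rewrite ltr_wpDl.
(* One half of r is for y - x and the other for t v; the summand 1 covers v = 0. *)
exists (Num.min (r / 2) (r / (2 * (`|v| + 1)))); first by rewrite lt_min dpos divr_gt0.
move=> y t; rewrite !lt_min => /andP[y1 _] /andP[_ t1].
have inr s : `|s| <= `|t| -> `|y + s *: v - x| < r.
  move=> st; rewrite addrAC; apply: (le_lt_trans (ler_normD _ _)).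
  rewrite [ltRHS](splitr r); apply: ltr_leD => //.
  rewrite normrZ; apply: (@le_trans _ _ (`|t| * (`|v| + 1))).
    by apply: ler_pM => //; rewrite lerDl.
  by rewrite -ler_pdivlMr// -mulrA -invfM; exact: ltW.
have der s : `|s| <= `|t| -> is_derive s (1 : R) (fun s => f (y + s *: v) - s * 'D_v f x)
    ('D_v f (y + s *: v) - 'D_v f x).
  move=> /inr/hr'[Dy _].
  have h1 := is_derive_line (fd _ Dy).
  have h2 : is_derive s (1 : R) (fun s : R => s * 'D_v f x) ('D_v f x).
    by apply: is_derive_eq; rewrite scaler0 add0r [_%:A]mulr1.
  exact: is_deriveB.
have := @mvt_bound R _ _ e t der.
rewrite scale0r addr0 mul0r subr0 addrAC => h; apply: h => s /inr/hr'[_].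
by rewrite distrC.
Unshelve. all: by end_near. Qed.

(** The increment is taken along one frame vector at a time. The base point moves in the process,
    which is why [partial_increment] and [key] allow any y near x. *)
Lemma frame_increment (E : normedModType R) (I : finType) (b : I -> E) (l : I -> E -> R)
    (D : set E) (f : E -> R) x e : frame b l ->
  open D -> (forall v y, D y -> derivable f y v) -> (forall v, {for x, continuous ('D_v f)}) ->
  D x -> 0 < e ->
  exists2 d, 0 < d & forall v, `|v| < d ->
    `|f (x + v) - f x - \sum_i l i v * 'D_(b i) f x| <= e * `|v|.
Proof.
move=> [fb fl fn] oD fd fc Dx e0.
have [N0|N0] := eqVneq #|I| 0%N.
  exists 1 => // v _; have -> : v = 0.
    rewrite (fb v) big1// => i; have := fintype0 i N0; exact.
  rewrite big1 ?addr0 ?subrr ?normr0 ?mulr0// => i; have := fintype0 i N0; exact.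
have Npos : 0 < #|I|%:R :> R by rewrite ltr0n lt0n.
have key (s : seq I) c : 0 < c -> exists2 d, 0 < d & forall y (t : I -> R), `|y - x| < d ->
    (forall i, `|t i| < d) ->
    `|f (y + \sum_(i <- s) t i *: b i) - f y - \sum_(i <- s) t i * 'D_(b i) f x| <=
      c * \sum_(i <- s) `|t i|.
  move=> c0; elim: s => [|i s [d d0 hd]].
    by exists 1 => // y t _ _; rewrite !big_nil addr0 subrr subr0 normr0 mulr0.
  have [d' d'0 hd'] := partial_increment oD (fd (b i)) (fc (b i)) Dx c0.
  have bi : 0 < `|b i| + 1 by rewrite ltr_wpDl.
  have q0 : 0 < d / (2 * (`|b i| + 1)) by rewrite divr_gt0// mulr_gt0.
  have d2 : 0 < d / 2 by rewrite divr_gt0.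
  have hmin : d / 2 <= d by lra.
  exists (Num.min d' (Num.min (d / 2) (d / (2 * (`|b i| + 1))))).
    by rewrite !lt_min d'0 d2.
  move=> y t; rewrite !lt_min => /and3P[y1 y2 _] tt.
  have t1 j : `|t j| < d' by have := tt j; rewrite !lt_min => /and3P[].
  have t2 j : `|t j| < d by have := tt j; rewrite !lt_min => /and3P[_ h _]; lra.
  have t3 : `|t i| < d / (2 * (`|b i| + 1)) by have := tt i; rewrite !lt_min => /and3P[].
  have ys : `|y + t i *: b i - x| < d.
    rewrite addrAC; apply: (le_lt_trans (ler_normD _ _)).
    rewrite [ltRHS](splitr d); apply: ltr_leD => //.
    rewrite normrZ; apply: (@le_trans _ _ (`|t i| * (`|b i| + 1))).
      by apply: ler_pM => //; rewrite lerDl.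
    by rewrite -ler_pdivlMr// -mulrA -invfM; exact: ltW.
  have h1 := hd' _ _ y1 (t1 i); have h2 := hd _ t ys t2.
  rewrite !big_cons addrA mulrDr.
  set S := \sum_(_ <- _) _ *: _ in h2 *; set S' := \sum_(_ <- _) _ * _ in h2 *.
  apply: le_trans (lerD h1 h2); apply: le_trans (ler_normD _ _).
  by rewrite le_eqVlt; apply/orP; left; apply/eqP; congr `|_|; ring.
have [d d0 hd] := key (index_enum I) (e / #|I|%:R) (divr_gt0 e0 Npos).
exists d => // v vd.
have := hd x (fun i => l i v); rewrite subrr normr0 -fb => /(_ d0) h.
apply: (le_trans (h _)) => [i|]; first exact: le_lt_trans (fn i v) vd.
rewrite -mulrA ler_pM2l// ler_pdivrMl//.
apply: (@le_trans _ _ (\sum_(i : I) `|v|)); first by apply: ler_sum => i _; exact: fn.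
by rewrite sumr_const mulr_natl.
Qed.

Lemma frame_differentiable (E : normedModType R) (I : finType) (b : I -> E) (l : I -> E -> R)
    (D : set E) (f : E -> R) x : frame b l ->
  open D -> (forall v y, D y -> derivable f y v) -> (forall v, {for x, continuous ('D_v f)}) ->
  D x -> differentiable f x.
Proof.
move=> fr oD fd fc Dx; have [fb fl fn] := fr.
pose L v : R := \sum_i l i v * 'D_(b i) f x.
have Llin : linear L.
  move=> a v w; rewrite /L scaler_sumr -big_split; apply: eq_bigr => i _ /=.
  by rewrite fl mulrDl -mulrA.
pose L' : {linear E -> R} := HB.pack L (GRing.isLinear.Build _ _ _ _ _ Llin).
have Lc : continuous L'.
  apply/linear_bounded_continuous/linear_boundedP.
  near=> r => v; apply: (le_trans (ler_norm_sum _ _ _)).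
  apply: (@le_trans _ _ ((\sum_i `|'D_(b i) f x|) * `|v|)).
    by rewrite mulr_suml; apply: ler_sum => i _; rewrite normrM mulrC ler_wpM2l.
  by rewrite ler_wpM2r//; near: r; exact: nbhs_pinfty_ge.
have Lo : f \o shift x = cst (f x) + L' +o_ 0 id.
  apply/eqaddoP => e e0.
  have [d d0 hd] := frame_increment fr oD fd fc Dx e0.
  near=> v.
  have vd : `|v| < d.
    by near: v; apply/nbhs_ballP; exists d => // w; rewrite -ball_normE /= sub0r normrN.
  have -> : (f \o shift x - (cst (f x) + L')) v = f (x + v) - f x - L v.
    by rewrite -[LHS]/(f (v + x) - (f x + L v)) opprD addrA (addrC v).
  exact: hd.
by apply/diff_locallyP; rewrite (diff_unique Lc Lo).
Unshelve. all: by end_near. Qed.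

Lemma is_derive_coord (E : normedModType R) n (f : E -> 'rV[R]_n) x v j :
  derivable f x v -> is_derive x v (fun y => f y 0 j) ('D_v f x 0 j).
Proof.
move=> fd; have h : (fun h : R => h^-1 *: (((fun y => f y 0 j) \o shift x) (h *: v) - f x 0 j)) @ 0^' --> 'D_v f x 0 j.
  have -> : (fun h : R => h^-1 *: (((fun y => f y 0 j) \o shift x) (h *: v) - f x 0 j)) =
     (fun M : 'rV[R]_n => M 0 j) \o (fun h : R => h^-1 *: ((f \o shift x) (h *: v) - f x)).
    by apply/funext => t /=; rewrite !mxE.
  apply: continuous_cvg; [exact: coord_continuous|exact: fd].
by split; [apply/cvg_ex; exists ('D_v f x 0 j)|exact: cvg_lim h].
Qed.

(** [Ck_on] speaks of directional derivatives only; with a finite frame their continuity gives total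
    differentiability, and with it the chain rule along curves. *)
Lemma C1_differentiable (E : normedModType R) (I : finType) (b : I -> E) (l : I -> E -> R) n
    (D : set E) (f : E -> 'rV[R]_n) x : frame b l ->
  open D -> Ck_on 1 D f -> D x -> differentiable f x.
Proof.
move=> fr oD [fc fd] Dx.
have fj j : differentiable (fun y => f y 0 j) x.
  apply: (frame_differentiable fr oD) => // v.
    by move=> y Dy; have := is_derive_coord j ((fd v).1 y Dy) => ?; exact: ex_derive.
  have [h1 [h2 _]] := fd v.
  have hc : {for x, continuous (fun y => 'D_v f y 0 j)}.
    apply: (@continuous_comp _ _ _ ('D_v f) (fun M : 'rV[R]_n => M 0 j)); first exact: h2.
    exact: coord_continuous.
  have e y : D y -> 'D_v (fun y => f y 0 j) y = 'D_v f y 0 j.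
    by move=> Dy; have := is_derive_coord j (h1 y Dy) => H; exact: derive_val.
  rewrite /prop_for /continuous_at e//; apply: cvg_trans hc; apply: near_eq_cvg.
  by near=> y; rewrite e//; near: y; exact: open_nbhs_nbhs.
have -> : f = \sum_(j < n) (fun y => f y 0 j *: (delta_mx 0 j : 'rV[R]_n)).
  by apply/funext => y; rewrite fct_sumE; exact: row_sum_delta.
by apply: differentiable_sum => j; exact: differentiableZl.
Unshelve. all: by end_near. Qed.

Lemma diff_curve (E F : normedModType R) (f : E -> F) (c : R -> E) t v :
  differentiable f (c t) -> is_derive t (1 : R) c v ->
  is_derive t (1 : R) (f \o c) ('D_v f (c t)).
Proof.
move=> df [dc <-].
have dc' : differentiable c t by exact/derivable1_diffP.
have dfc : differentiable (f \o c) t by exact: differentiable_comp.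
split; first exact/derivable1_diffP.
by rewrite deriveE// diff_comp//= -!deriveE.
Qed.

Lemma is_derive_pair (E1 E2 : normedModType R) (c : R -> E1) (d : R -> E2) t v w :
  is_derive t (1 : R) c v -> is_derive t (1 : R) d w ->
  is_derive t (1 : R) (fun s => (c s, d s)) (v, w).
Proof.
move=> [hc <-] [hd <-].
have dc : differentiable c t by exact/derivable1_diffP.
have dd : differentiable d t by exact/derivable1_diffP.
have dp : differentiable (fun s => (c s, d s)) t by exact: differentiable_pair.
split; first exact/derivable1_diffP.
by rewrite !deriveE// diff_pair.
Qed.

Lemma derive_lin (E1 E2 : normedModType R) (f : E1 -> E2) x (r : R) v w :
  differentiable f x -> 'D_(r *: v + w) f x = r *: 'D_v f x + 'D_w f x.
Proof. by move=> df; rewrite !deriveE// linearP. Qed.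

Lemma is_derive_affine (V : normedModType R) (x v : V) (t : R) :
  is_derive t (1 : R) (fun s => x + s *: v) v.
Proof.
have [d e] := is_diff_scalel t v.
have h : is_derive t (1 : R) ( *:%R ^~ v) v.
  by split; [exact/derivable1_diffP|rewrite deriveE// e scale1r].
by rewrite -[X in is_derive _ _ _ X]add0r; exact: is_deriveD.
Qed.

End ContinuousDerivatives.

(** * The group operations in the chart at 1 *)

Section LocalGroup.
Context {R : realType} {n : nat} {G : lieGroupType R n}.
Notation E := 'rV[R]_n.
Notation c1 := (lie_chart (1%g : G)).
Notation phi := (chart_fun c1).
Notation psi := (chart_inv c1).
Notation dom1 := (chart_dom c1).
Notation cod1 := (chart_codom c1).
Notation e1 := (phi 1%g).
Implicit Types (x y z w v : E) (f : G -> G) (a b p q : G).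

Lemma phiK p : dom1 p -> psi (phi p) = p.
Proof. by have [_ _ h _ _] := lie_chartP (1%g : G); exact: h. Qed.

Lemma psi_dom x : cod1 x -> dom1 (psi x).
Proof. by move=> [p dp <-]; rewrite phiK. Qed.

Lemma psiK x : cod1 x -> phi (psi x) = x.
Proof. by move=> [p dp <-]; rewrite phiK. Qed.

Lemma phi_cod p : dom1 p -> cod1 (phi p).
Proof. by move=> dp; exists p. Qed.

Lemma dom1_1 : dom1 1%g.
Proof. exact: lie_chart_center. Qed.

Lemma cod1_e : cod1 e1.
Proof. exact: phi_cod dom1_1. Qed.

Lemma psi_e : psi e1 = 1%g.
Proof. exact: phiK dom1_1. Qed.

Lemma phi_inj p q : dom1 p -> dom1 q -> phi p = phi q -> p = q.
Proof. by move=> dp dq h; rewrite -(phiK dp) h phiK. Qed.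

Lemma near_dom p : dom1 p -> \forall q \near p, dom1 q.
Proof. by have [h _ _ _ _] := lie_chartP (1%g : G) => dp; exact: open_nbhs_nbhs. Qed.

Lemma near_cod x : cod1 x -> \forall y \near x, cod1 y.
Proof. by have [_ h _ _ _] := lie_chartP (1%g : G) => dp; exact: open_nbhs_nbhs. Qed.

Lemma phi_cvg p : dom1 p -> phi q @[q --> p] --> phi p.
Proof. by have [_ _ _ h _] := lie_chartP (1%g : G); exact: h. Qed.

Lemma psi_cvg x : cod1 x -> psi y @[y --> x] --> psi x.
Proof. by have [_ _ _ _ h] := lie_chartP (1%g : G); exact: h. Qed.

Lemma mulg_cvg {T : Type} {F : set_system T} {FF : Filter F} (u v : T -> G) a b :
  u @ F --> a -> v @ F --> b -> (u t * v t)%g @[t --> F] --> (a * b)%g.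
Proof.
move=> ua vb; have h := (@lie_mulg_smooth R n G).1 (a, b).
exact: (cvg_comp _ _ (cvg_pair ua vb) h).
Qed.

Lemma invg_cvg {T : Type} {F : set_system T} {FF : Filter F} (u : T -> G) a :
  u @ F --> a -> (u t)^-1%g @[t --> F] --> (a^-1)%g.
Proof. by move=> ua; exact: (cvg_comp _ _ ua ((@lie_invg_smooth R n G).1 a)). Qed.

Definition locmap f x : E := phi (f (psi x)).
Definition locdom f : set E := [set x | cod1 x /\ dom1 (f (psi x))].

Lemma locdom_open f : continuous f -> open (locdom f).
Proof.
move=> fc; rewrite openE => x [cx dx].
have h : f (psi y) @[y --> x] --> f (psi x) by exact: (cvg_comp _ _ (psi_cvg cx) (fc _)).
by near=> y; split; near: y; [exact: near_cod|exact: h _ (near_dom dx)].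
Unshelve. all: by end_near. Qed.

Lemma locmap_diff f x : smooth_map (@lie_chart R n G) (@lie_chart R n G) f ->
  locdom f x -> differentiable (locmap f) x.
Proof.
move=> [fc fs] dx.
exact: (C1_differentiable (@frame_rV R n) (locdom_open fc) (fs 1%g 1%g 1%N) dx).
Qed.

Definition locmul (p : E * E) : E := phi (psi p.1 * psi p.2)%g.
Definition locmuldom : set (E * E) :=
  [set p | [/\ cod1 p.1, cod1 p.2 & dom1 (psi p.1 * psi p.2)%g]].

Lemma locmuldom_open : open locmuldom.
Proof.
rewrite openE => -[x y] [/= cx cy dxy].
have h1 : psi p.1 @[p --> (x, y)] --> psi x by apply: (cvg_comp _ _ (@cvg_fst _ _ _ _ _)); exact: psi_cvg.
have h2 : psi p.2 @[p --> (x, y)] --> psi y by apply: (cvg_comp _ _ (@cvg_snd _ _ _ _ _)); exact: psi_cvg.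
have h := mulg_cvg h1 h2.
near=> p; split; near: p.
- exact: (@cvg_fst _ _ (nbhs x) (nbhs y) _ _ (near_cod cx)).
- exact: (@cvg_snd _ _ (nbhs x) (nbhs y) _ _ (near_cod cy)).
- exact: h _ (near_dom dxy).
Unshelve. all: by end_near. Qed.

Lemma locmul_smooth k : Ck_on k locmuldom locmul.
Proof.
have -> : locmuldom = [set x | chart_codom (prod_chart c1 c1) x /\
    chart_dom c1 (let y := chart_inv (prod_chart c1 c1) x in y.1 * y.2)%g].
  apply/seteqP; split=> -[x y] /=.
    by move=> [/= [p dp <-] [q dq <-] h]; split => //; exists (p, q).
  by move=> [[[p q] [/= dp dq] [<- <-]] h]; split => //; exact: phi_cod.
exact: (@lie_mulg_smooth R n G).2 (1%g, 1%g) 1%g k.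
Qed.

Let fr2 := frame_prod (@frame_rV R n) (@frame_rV R n).

Lemma locmul_diff (p : E * E) : locmuldom p -> differentiable locmul p.
Proof. exact: (C1_differentiable fr2 locmuldom_open (locmul_smooth 1)). Qed.

(** Smoothness of order two enters here: ad is the derivative of Ad, which is itself built from
    derivatives of the multiplication. *)
Lemma locmul_diff2 (v p : E * E) : locmuldom p -> differentiable ('D_v locmul) p.
Proof. exact: (C1_differentiable fr2 locmuldom_open ((locmul_smooth 2).2 v).2). Qed.

Lemma locmul1l x : cod1 x -> locmul (e1, x) = x.
Proof. by move=> cx; rewrite /locmul /= psi_e mul1g psiK. Qed.

Lemma locmul1r x : cod1 x -> locmul (x, e1) = x.
Proof. by move=> cx; rewrite /locmul /= psi_e mulg1 psiK. Qed.

Lemma locmuldom1r x : cod1 x -> locmuldom (x, e1).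
Proof. by move=> cx; split => //=; [exact: cod1_e|rewrite psi_e mulg1; exact: psi_dom]. Qed.

(** By linearity the two arguments can be varied separately, and with the other one at the unit
    [locmul] is the identity. *)
Lemma locmul_derive_e v w : 'D_(v, w) locmul (e1, e1) = v + w.
Proof.
have d := locmul_diff (locmuldom1r cod1_e).
have -> : (v, w) = 1 *: (v, 0) + (0, w) :> E * E.
  by congr pair; rewrite /= ?scale1r ?addr0 ?scaler0 ?add0r.
have ne u : \forall s \near (0 : R), cod1 (e1 + s *: u).
  have : e1 + s *: u @[s --> (0 : R)] --> e1.
    rewrite -[X in _ --> X]addr0 -[X in _ + X](scale0r u).
    by apply: cvgD; [exact: cvg_cst|apply: cvgZr_tmp; exact: cvg_id].
  by apply; exact: near_cod cod1_e.
have d0 : differentiable locmul (e1 + 0 *: v, e1) by rewrite scale0r addr0.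
have d0' : differentiable locmul (e1, e1 + 0 *: w) by rewrite scale0r addr0.
rewrite derive_lin// scale1r; congr (_ + _).
  have := diff_curve d0 (is_derive_pair (is_derive_affine e1 v 0) (is_derive_cst e1 (0 : R) 1)).
  rewrite scale0r addr0 => -[_ <-].
  have -> : 'D_1 (locmul \o (fun s : R => (e1 + s *: v, e1))) 0 = 'D_1 (fun s : R => e1 + s *: v) 0.
    by apply: near_eq_derive; near=> s; rewrite /= locmul1r//; near: s; exact: ne.
  by have := is_derive_affine e1 v 0 => H; exact: derive_val.
have := diff_curve d0' (is_derive_pair (is_derive_cst e1 (0 : R) 1) (is_derive_affine e1 w 0)).
rewrite scale0r addr0 => -[_ <-].
have -> : 'D_1 (locmul \o (fun s : R => (e1, e1 + s *: w))) 0 = 'D_1 (fun s : R => e1 + s *: w) 0.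
  by apply: near_eq_derive; near=> s; rewrite /= locmul1l//; near: s; exact: ne.
by have := is_derive_affine e1 w 0 => H; exact: derive_val.
Unshelve. all: by end_near. Qed.

End LocalGroup.

Arguments locmul {R n} G p.
Arguments locmuldom {R n} G.

(** * Uniqueness of one-parameter groups *)

Section OneParameterGroups.
Context {R : realType} {n : nat} {G : lieGroupType R n}.
Notation E := 'rV[R]_n.
Notation c1 := (lie_chart (1%g : G)).
Notation phi := (chart_fun c1).
Notation psi := (chart_inv c1).
Notation dom1 := (chart_dom c1).
Notation cod1 := (chart_codom c1).
Notation e1 := (phi 1%g).
Implicit Types (x y z w v : E) (g d : R -> G) (s t : R).

Lemma locmulE (a b : G) : dom1 a -> dom1 b -> locmul G (phi a, phi b) = phi (a * b)%g.
Proof. by move=> da db; rewrite /locmul /= !phiK. Qed.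

Lemma locmuldomE (a b : G) : dom1 a -> dom1 b -> dom1 (a * b)%g -> locmuldom G (phi a, phi b).
Proof. by move=> da db dab; split; rewrite /= ?phiK//; exact: phi_cod. Qed.

Lemma is_derive_at0 (V : normedModType R) (f : R -> V) t l :
  is_derive (0 : R) (1 : R) (fun s => f (t + s)) l -> is_derive t (1 : R) f l.
Proof.
have E : (fun h : R => h^-1 *: ((f \o shift t) (h *: 1) - f t)) =
   (fun h => h^-1 *: (((fun s => f (t + s)) \o shift 0) (h *: 1) - f (t + 0))).
  by apply/funext => h /=; rewrite !addr0 [_ + t]addrC.
by move=> [h1 h2]; split; move: h1 h2; rewrite /derivable /derive E.
Qed.

Lemma opg1 g x : one_parameter_group g x -> g 0 = 1%g.
Proof.
by move=> [_ gM _]; apply: (mulgI (g 0)); rewrite mulg1 -gM addr0.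
Qed.

Lemma opg_neg_derive g x : one_parameter_group g x ->
  is_derive (0 : R) (1 : R) (fun t => phi (g (- t))) (- x).
Proof.
move=> [_ _ [h1 h2]].
have df : differentiable (fun t => phi (g t)) (- (0 : R)) by rewrite oppr0; exact/derivable1_diffP.
have hN : is_derive (0 : R) (1 : R) (fun s : R => - s) (- 1) by exact: is_deriveN.
have := diff_curve df hN.
have -> : 'D_(-1) (fun t : R => phi (g t)) (- 0) = - x; last by [].
by rewrite deriveE// oppr0 linearN -deriveE ?h2// -[X in differentiable _ X]oppr0.
Qed.

Section Uniqueness.
Variables (g d : R -> G) (x : E).
Hypotheses (hg : one_parameter_group g x) (hd : one_parameter_group d x).

Let k t : G := (g t * d (- t))%g.

Let k0 : k 0 = 1%g.
Proof. by rewrite /k oppr0 (opg1 hg) (opg1 hd) mulg1. Qed.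

Let dN_cont : continuous (fun t => d (- t)).
Proof.
by move=> t; have [dc _ _] := hd; exact: (cvg_comp _ _ (cvgN (@cvg_id _ _)) (dc (- t))).
Qed.

Let k_cont : continuous k.
Proof. by move=> t; apply: mulg_cvg; [have [gc _ _] := hg; exact: gc|exact: dN_cont]. Qed.

Let near1 (c : R -> G) t : continuous c -> dom1 (c t) -> \forall s \near t, dom1 (c s).
Proof. by move=> cc dc; exact: cc _ (near_dom dc). Qed.

Let k_derive0 : is_derive (0 : R) (1 : R) (fun t => phi (k t)) 0.
Proof.
have [gc _ gd] := hg.
have g1 : dom1 (g 0) by rewrite (opg1 hg); exact: dom1_1.
have d1 : dom1 (d (- 0)) by rewrite oppr0 (opg1 hd); exact: dom1_1.
have df : differentiable (locmul G) (phi (g 0), phi (d (- 0))).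
  by rewrite oppr0 (opg1 hg) (opg1 hd); apply: locmul_diff; apply: locmuldom1r; exact: cod1_e.
have := diff_curve df (is_derive_pair gd (opg_neg_derive hd)).
rewrite oppr0 (opg1 hg) (opg1 hd) locmul_derive_e subrr.
apply: near_eq_is_derive; near=> s.
rewrite /= locmulE//; near: s; first exact: near1 gc g1.
exact: near1 dN_cont d1.
Unshelve. all: by end_near. Qed.

(** k (t + s) = g t * k s * d (- t), so the derivative at t is the image of the one at 0, which
    vanishes by [k_derive0]. *)
Let k_derive t : dom1 (g t) -> dom1 (d (- t)) -> dom1 (k t) ->
  is_derive t (1 : R) (fun t => phi (k t)) 0.
Proof.
move=> dg dd dk; apply: is_derive_at0.
have dg' : dom1 (g t * k 0)%g by rewrite k0 mulg1.
have df1 : differentiable (locmul G) (phi (g t), phi (k 0)).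
  by rewrite k0; apply: locmul_diff; apply: locmuldom1r; exact: phi_cod.
have h1 := diff_curve df1 (is_derive_pair (is_derive_cst (phi (g t)) (0 : R) 1) k_derive0).
rewrite [X in is_derive _ _ _ X]derive0 in h1.
have e0 : locmul G (phi (g t), phi (k 0)) = phi (g t).
  by rewrite k0 locmul1r//; exact: phi_cod.
have df2 : differentiable (locmul G) (locmul G (phi (g t), phi (k 0)), phi (d (- t))).
  by rewrite e0; apply: locmul_diff; exact: locmuldomE.
have := diff_curve df2 (is_derive_pair h1 (is_derive_cst (phi (d (- t))) (0 : R) 1)).
rewrite [X in is_derive _ _ _ X]derive0.
have k1 : dom1 (k 0) by rewrite k0; exact: dom1_1.
have cgk : continuous (fun s => g t * k s)%g.
  by move=> s; apply: mulg_cvg; [exact: cvg_cst|exact: k_cont].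
apply: near_eq_is_derive; near=> s.
have ks : dom1 (k s) by near: s; exact: near1.
have gks : dom1 (g t * k s)%g by near: s; exact: near1.
rewrite /= !locmulE//; congr phi; rewrite /k.
have [_ gM _] := hg; have [_ dM _] := hd.
by rewrite gM opprD addrC dM !mulgA.
Unshelve. all: by end_near. Qed.

(** k t = g t * d (- t) has zero derivative near 0, hence is 1 there and g = d near 0. Any t is a
    multiple of some t / N near 0, where the two homomorphisms agree. *)
Lemma opg_uniq : g = d.
Proof.
have [gc gM _] := hg; have [dc dM _] := hd.
have /nbhs_ballP[r r0 hr] : \forall t \near (0 : R), [/\ dom1 (g t), dom1 (d (- t)) & dom1 (k t)].
  near=> t; split; near: t.
  - by apply: near1 gc _; rewrite (opg1 hg); exact: dom1_1.
  - by apply: near1 dN_cont _; rewrite oppr0 (opg1 hd); exact: dom1_1.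
  - by apply: near1 k_cont _; rewrite k0; exact: dom1_1.
have small t : `|t| < r -> g t = d t.
  move=> tr.
  have hs s : `|s| <= `|t| -> [/\ dom1 (g s), dom1 (d (- s)) & dom1 (k s)].
    by move=> st; apply: hr; rewrite -ball_normE /= sub0r normrN; exact: le_lt_trans tr.
  have kt : k t = 1%g.
    apply: phi_inj; [by have [] := hs t (lexx _)|exact: dom1_1|].
    suff : phi (k t) = phi (k 0) by rewrite k0.
    apply/rowP => j.
    apply: (@deriv0_const _ (fun s => phi (k s) 0 j)) => s /hs[h1 h2 h3].
    have [e1' e2'] := k_derive h1 h2 h3.
    by have := is_derive_coord j e1'; rewrite e2' mxE.
  by apply: (mulIg (d (- t))); rewrite -[LHS]/(k t) kt -dM subrr (opg1 hd).
apply/funext => t.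
pose N := (Num.truncn (`|t| / r)).+1.
have N0 : N%:R != 0 :> R by rewrite pnatr_eq0.
have tN : `|t / N%:R| < r.
  rewrite normrM normfV (ger0_norm (ler0n _ N)) ltr_pdivrMr ?ltr0n// mulrC -ltr_pdivrMr//.
  exact: truncnS_gt.
have gp m s : g (s *+ m) = d (s *+ m) \/ g s <> d s.
  have [e|ne] := pselect (g s = d s); last by right.
  left; elim: m => [|m IH]; first by rewrite mulr0n (opg1 hg) (opg1 hd).
  by rewrite mulrS gM dM IH e.
have [|] := gp N (t / N%:R); last by move=> /(_ (small _ tN)).
by have -> : t / N%:R *+ N = t by rewrite -[LHS]mulr_natr mulfVK.
Unshelve. all: by end_near. Qed.

End Uniqueness.

Lemma opg_scale g x t : one_parameter_group g x -> one_parameter_group (fun s => g (t * s)) (t *: x).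
Proof.
move=> [gc gM gd]; split.
- by move=> s; exact: (cvg_comp _ _ (cvgM (cvg_cst t) (@cvg_id _ _)) (gc (t * s))).
- by move=> a b; rewrite mulrDr gM.
- have df : differentiable (fun s : R => phi (g s)) (t * 0).
    by rewrite mulr0; apply/derivable1_diffP; exact: ex_derive.
  have hM : is_derive (0 : R) (1 : R) (fun s : R => t * s) t.
    have := @is_derive_affine R R 0 t 0; rewrite (_ : (fun _ => _) = (fun s => t * s))//.
    by apply/funext => s; rewrite add0r [RHS]mulrC.
  have := diff_curve df hM.
  have -> : 'D_t (fun s : R => phi (g s)) (t * 0) = t *: x; last by [].
  have := @derive_lin R R E (fun s => phi (g s)) (t * 0) t 1 0 df.
  by rewrite [_%:A]mulr1 addr0 derive0 addr0 mulr0 => ->; have [_ ->] := gd.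
Qed.

Lemma opg_one : one_parameter_group (fun=> 1%g : G) (0 : E).
Proof. by split=> [t|s t|]; [exact: cvg_cst|rewrite mulg1|exact: is_derive_cst]. Qed.

Lemma lie_expE g x : one_parameter_group g x -> lie_exp x = g 1.
Proof.
move=> hg; rewrite /lie_exp; case: xgetP => [_ -> [d hd <-]|h].
  by rewrite (opg_uniq hd hg).
by case: (h (g 1)); exists g.
Qed.

(* If there were no one-parameter group with velocity [x], then [lie_exp]
   would be constant by the default value of [xget]. *)
Lemma lie_exp_line x : (exists2 g, one_parameter_group g x & forall t, lie_exp (G := G) (t *: x) = g t) \/
  (forall t, lie_exp (G := G) (t *: x) = 1%g).
Proof.
have [[g hg]|ng] := pselect (exists g, @one_parameter_group R n G g x); [left|right].
  by exists g => // t; rewrite (lie_expE (opg_scale t hg)) mulr1.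
move=> t; have [->|t0] := eqVneq t 0; first by rewrite scale0r (lie_expE opg_one).
rewrite /lie_exp; case: xgetP => // p _ [g hg _]; case: ng.
exists (fun s => g (t^-1 * s)); have := opg_scale t^-1 hg.
by rewrite scalerA mulVf// scale1r.
Qed.

End OneParameterGroups.

(** Every term of the series but the zeroth kills v. The partial sums are indexed by m.+1 because
    the empty one is 0 and not 1. *)
Lemma mx_exp_ker (K : numFieldType) (n : nat) (v : 'rV[K]_n) (B C : 'M[K]_n) :
  is_mx_exp B C -> v *m B = 0 -> v *m C = v.
Proof.
move=> BC vB.
have hS m : v *m [series k`!%:R^-1 *: B ^+ k]_k m.+1 = v.
  elim: m => [|m IH].
    by rewrite /series /= big_nat1 expr0 fact0 invr1 scale1r mulmx1.
  rewrite /series /= big_nat_recr//= mulmxDr -[X in X + _]/(v *m [series k`!%:R^-1 *: B ^+ k]_k m.+1) IH.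
  by rewrite -scalemxAr exprS -mulmxE mulmxA vB mul0mx scaler0 addr0.
have BC' : [series k`!%:R^-1 *: B ^+ k]_k m.+1 @[m --> \oo] --> C.
  have := BC; rewrite /is_mx_exp -cvg_shiftS; exact.
apply/rowP => j.
have cv : (v *m [series k`!%:R^-1 *: B ^+ k]_k m.+1) 0 j @[m --> \oo] --> (v *m C) 0 j.
  under eq_fun do rewrite mxE.
  rewrite mxE; apply: cvg_big => [|k _]; first exact: add_continuous.
  apply: cvgM; first exact: cvg_cst.
  exact: (cvg_comp _ _ BC' (@coord_continuous _ _ _ k j C)).
apply: (cvg_unique _ cv) => //.
rewrite /=; under eq_fun do rewrite hS; exact: cvg_cst.
Qed.

(** * The adjoint action and the invariance of exp(t h) under tau *)

Section AdjointInvariance.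
Context {R : realType} {n : nat} {G : lieGroupType R n}.
Notation E := 'rV[R]_n.
Notation c1 := (lie_chart (1%g : G)).
Notation phi := (chart_fun c1).
Notation psi := (chart_inv c1).
Notation dom1 := (chart_dom c1).
Notation cod1 := (chart_codom c1).
Notation e1 := (phi 1%g).
Notation inv1 := (locmap (fun a : G => a^-1)%g).
Implicit Types (x y z w v : E) (g d : R -> G) (s t : R).

Lemma tangent1_linear (f : G -> G) : smooth_map (@lie_chart R n G) (@lie_chart R n G) f ->
  f 1%g = 1%g -> linear (tangent1 f).
Proof.
move=> fs f1 r x y; apply: derive_lin; apply: locmap_diff => //.
by split; [exact: cod1_e|rewrite psi_e f1; exact: dom1_1].
Qed.

Lemma differentiable_scale (V : normedModType R) (a : V -> R) (m : V -> E) (z : V) :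
  differentiable a z -> differentiable m z -> differentiable (fun z : V => a z *: m z) z.
Proof.
move=> da dm.
have -> : (fun z : V => a z *: m z) =
    \sum_(j < n) (fun z : V => (a z * m z 0 j) *: (delta_mx 0 j : E)).
  apply/funext => y; rewrite fct_sumE [in LHS](row_sum_delta (m y)) scaler_sumr.
  by apply: eq_bigr => j _; rewrite scalerA.
apply: differentiable_sum => j; apply: differentiableZl; apply: differentiableM => //.
by apply: (@differentiable_comp _ _ _ _ m (fun M : E => M 0 j)) => //; exact: differentiable_coord.
Qed.

Lemma conj_loc (a : G) : dom1 a -> dom1 a^-1%g ->
  \forall x \near e1, phi (a * psi x * a^-1)%g = locmul G (locmul G (phi a, x), phi a^-1%g).
Proof.
move=> da dV.
have ca : (a * psi x)%g @[x --> e1] --> a.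
  have := mulg_cvg (cvg_cst a) (psi_cvg cod1_e).
  by rewrite psi_e mulg1; exact.
near=> x; have cx : cod1 x by near: x; exact: near_cod cod1_e.
have dx : dom1 (a * psi x)%g by near: x; exact: ca _ (near_dom da).
by rewrite -{2}(psiK cx) locmulE//; [rewrite locmulE|exact: psi_dom].
Unshelve. all: by end_near. Qed.

(** The tangent vector y at 1 carried to the point z by left translation. *)
Definition derive_right y z : E := 'D_(0, y) (locmul G) (z, e1).

Lemma conj_diff (a : G) : dom1 a -> dom1 a^-1%g ->
  differentiable (fun x => locmul G (locmul G (phi a, x), phi a^-1%g)) e1.
Proof.
move=> da dV.
have d1 : differentiable (locmul G) (phi a, e1).
  by apply: locmul_diff; apply: locmuldom1r; exact: phi_cod.
have d2 : differentiable (locmul G) (locmul G (phi a, e1), phi a^-1%g).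
  rewrite locmul1r; last exact: phi_cod.
  by apply: locmul_diff; apply: locmuldomE => //; rewrite mulgV; exact: dom1_1.
have p1 : differentiable (fun x => (phi a, x)) e1.
  by apply: differentiable_pair => //; exact: differentiable_cst.
have d3 : differentiable (fun x => locmul G (phi a, x)) e1.
  exact: (differentiable_comp p1 d1).
have p2 : differentiable (fun x => (locmul G (phi a, x), phi a^-1%g)) e1.
  by apply: differentiable_pair => //; exact: differentiable_cst.
exact: (differentiable_comp p2 d2).
Qed.

Lemma Ad_loc (a : G) y : dom1 a -> dom1 a^-1%g ->
  Ad a y = 'D_(derive_right y (phi a), 0) (locmul G) (phi a, phi a^-1%g).
Proof.
move=> da dV.
rewrite /Ad /tangent1 (near_eq_derive _ (conj_loc da dV)).
have d1 : differentiable (locmul G) (phi a, e1 + 0 *: y).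
  by rewrite scale0r addr0; apply: locmul_diff; apply: locmuldom1r; exact: phi_cod.
have d2 : differentiable (locmul G) (locmul G (phi a, e1 + 0 *: y), phi a^-1%g).
  rewrite scale0r addr0 locmul1r; last exact: phi_cod.
  by apply: locmul_diff; apply: locmuldomE => //; rewrite mulgV; exact: dom1_1.
have h1 := diff_curve d1 (is_derive_pair (is_derive_cst (phi a) (0 : R) 1) (is_derive_affine e1 y 0)).
have h2 := diff_curve d2 (is_derive_pair h1 (is_derive_cst (phi a^-1%g) (0 : R) 1)).
have d3 : derivable (fun x => locmul G (locmul G (phi a, x), phi a^-1%g)) (e1 + 0 *: y) y.
  by rewrite scale0r addr0; apply: diff_derivable; exact: conj_diff.
have h3 := is_derive_line d3.
have := @derive_val _ _ _ _ _ _ _ h3; rewrite scale0r addr0 => <-.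
apply: (etrans (@derive_val _ _ _ _ _ _ _ h2)).
by rewrite /= scale0r addr0 locmul1r//; exact: phi_cod.
Qed.

(* z |-> Ad (psi z) y near the identity, written without differentiating a
   conjugation. *)
Definition mulmap y z : E := \sum_(j < n) (derive_right y z) 0 j *: 'D_(delta_mx 0 j, 0) (locmul G) (z, inv1 z).

Lemma near_inv : \forall z \near e1, [/\ cod1 z & dom1 (psi z)^-1%g].
Proof.
have h : (psi z)^-1%g @[z --> e1] --> (1%g : G).
  by have := invg_cvg (@psi_cvg R n G _ (@cod1_e R n G)); rewrite psi_e invg1; exact.
near=> z; split; near: z; first exact: near_cod cod1_e.
exact: h _ (near_dom dom1_1).
Unshelve. all: by end_near. Qed.

Let linear_left (p : E * E) : locmuldom G p -> forall v,
  'D_(v, 0) (locmul G) p = \sum_(j < n) v 0 j *: 'D_(delta_mx 0 j, 0) (locmul G) p.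
Proof.
move=> /locmul_diff dp v; rewrite deriveE//.
under eq_bigr => j _ do rewrite deriveE//.
rewrite [in LHS](row_sum_delta v).
have -> : (\sum_(j < n) v 0 j *: 'e_j, 0) = \sum_(j < n) v 0 j *: ((delta_mx 0 j : E), (0 : E)).
  transitivity (\sum_(j < n) ((v 0 j *: 'e_j : E), (0 : E))); last first.
    by apply: eq_bigr => j _; congr pair; rewrite scaler0.
  by apply: (big_morph (fun a : E => (a, 0) : E * E)) => // p' q; congr pair; rewrite addr0.
by rewrite linear_sum; apply: eq_bigr => j _; rewrite linearZ.
Qed.

Lemma Ad_mulmap y : \forall z \near e1, Ad (psi z) y = mulmap y z.
Proof.
near=> z; have [cz dV] : [/\ cod1 z & dom1 (psi z)^-1%g] by near: z; exact: near_inv.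
have dz := psi_dom cz.
rewrite Ad_loc// psiK// linear_left//; have := locmuldomE dz dV.
by rewrite mulgV psiK//; apply; exact: dom1_1.
Unshelve. all: by end_near. Qed.

Lemma inv1_e : inv1 e1 = e1.
Proof. by rewrite /locmap psi_e invg1. Qed.

Lemma mulmap_diff y : differentiable (mulmap y) e1.
Proof.
have de : locmuldom G (e1, e1) by exact: locmuldom1r cod1_e.
have did : differentiable (fun z : E => z) e1 by [].
have dinv : differentiable inv1 e1.
  apply: locmap_diff; first exact: lie_invg_smooth.
  by split; [exact: cod1_e|rewrite psi_e invg1; exact: dom1_1].
have -> : mulmap y = \sum_(j < n) (fun z => (derive_right y z) 0 j *: 'D_(delta_mx 0 j, 0) (locmul G) (z, inv1 z)).
  by apply/funext => z; rewrite fct_sumE.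
apply: differentiable_sum => j; apply: differentiable_scale.
  apply: (@differentiable_comp _ _ _ _ (derive_right y) (fun M : E => M 0 j)); last exact: differentiable_coord.
  apply: (@differentiable_comp _ _ _ _ (fun z => (z, e1)) ('D_(0, y) (locmul G))).
    by apply: differentiable_pair => //; exact: differentiable_cst.
  exact: locmul_diff2.
apply: (@differentiable_comp _ _ _ _ (fun z => (z, inv1 z)) ('D_(delta_mx 0 j, 0) (locmul G))).
  exact: differentiable_pair.
by rewrite inv1_e; exact: locmul_diff2.
Qed.

Lemma adE x y : ad (G := G) x y = 'D_x (mulmap y) e1.
Proof. by apply: near_eq_derive; exact: Ad_mulmap. Qed.

Lemma derive_lincomb (V W : normedModType R) (f f' : V -> W) (a v : V) (r : R) :
  derivable f a v -> derivable f' a v ->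
  'D_v (fun z : V => r *: f z + f' z) a = r *: 'D_v f a + 'D_v f' a.
Proof.
move=> d1 d2; rewrite -[fun _ => _]/(r *: f + f').
by rewrite deriveD//; [rewrite deriveZ|exact: derivableZ].
Qed.

(** [lin1_mx] represents [ad x] only once this map is linear. In [mulmap] the dependence on y is
    through a directional derivative of a differentiable map, hence linear. *)
Lemma ad_linear x : linear (@ad R n G x).
Proof.
move=> r y y'; rewrite !adE.
rewrite -derive_lincomb; [|exact: diff_derivable (mulmap_diff y)|exact: diff_derivable (mulmap_diff y')].
apply: near_eq_derive; near=> z.
have cz : cod1 z by near: z; exact: near_cod cod1_e.
rewrite /mulmap scaler_sumr -big_split /=.
apply: eq_bigr => j _; rewrite /derive_right.
have -> : (0, r *: y + y') = r *: (0, y) + (0, y') :> E * E.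
  by congr pair; rewrite /= scaler0 addr0.
rewrite derive_lin; last by apply: locmul_diff; exact: locmuldom1r.
by rewrite !mxE scalerDl scalerA.
Unshelve. all: by end_near. Qed.

Section AlongCurve.
Variables (g : R -> G) (h : E).
Hypothesis hg : one_parameter_group g h.

Let gnear (a : G) t : dom1 (a * g t)%g -> \forall s \near t, dom1 (a * g s)%g.
Proof.
by have [gc _ _] := hg => da; exact: (mulg_cvg (cvg_cst a) (gc t)) _ (near_dom da).
Qed.

(** g t commutes with g s, so conjugation by g t fixes the curve g, whose velocity at 0 is h. *)
Lemma Ad_opg t : dom1 (g t) -> dom1 (g t)^-1%g -> Ad (g t) h = h.
Proof.
move=> dt dV; have [gc gM gd] := hg.
have d0 : differentiable (fun x => locmul G (locmul G (phi (g t), x), phi (g t)^-1%g)) (phi (g 0)).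
  by rewrite (opg1 hg); exact: conj_diff.
rewrite /Ad /tangent1 (near_eq_derive _ (conj_loc dt dV)).
have := diff_curve d0 gd; rewrite (opg1 hg) => h1.
rewrite -(@derive_val _ _ _ _ _ _ _ h1) -(@derive_val _ _ _ _ _ _ _ gd).
apply: near_eq_derive; near=> s.
have d1 : dom1 (g s).
  near: s; have := @gnear 1%g 0; rewrite mul1g (opg1 hg) => /(_ dom1_1).
  by apply: filterS => s; rewrite mul1g.
have d2 : dom1 (g t * g s)%g by near: s; apply: gnear; rewrite (opg1 hg) mulg1.
rewrite /= locmulE// locmulE//; congr phi.
by rewrite -gM addrC gM mulgK.
Unshelve. all: by end_near. Qed.

Lemma ad_opg : ad (G := G) h h = 0.
Proof.
(* Ad (g t) h = h along the one-parameter group [g] of velocity [h]. *)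
have [gc gM gd] := hg.
have d0 : differentiable (mulmap h) (phi (g 0)) by rewrite (opg1 hg); exact: mulmap_diff.
have := diff_curve d0 gd; rewrite (opg1 hg) -adE => h1.
rewrite -(@derive_val _ _ _ _ _ _ _ h1) -[RHS](@derive_val _ _ _ _ _ _ _ (is_derive_cst h (0 : R) 1)).
apply: near_eq_derive.
have c1 : phi (g t) @[t --> (0 : R)] --> e1.
  rewrite -[X in _ --> phi X](opg1 hg); apply: (cvg_comp _ _ (gc 0)); rewrite (opg1 hg).
  exact: phi_cvg dom1_1.
near=> t.
have dt : dom1 (g t).
  near: t; have := @gnear 1%g 0; rewrite mul1g (opg1 hg) => /(_ dom1_1).
  by apply: filterS => s; rewrite mul1g.
have [ct dV] : [/\ cod1 (phi (g t)) & dom1 (psi (phi (g t)))^-1%g] by near: t; exact: c1 _ near_inv.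
have := Ad_opg dt; rewrite phiK// in dV *; move=> /(_ dV) e.
have : Ad (psi (phi (g t))) h = mulmap h (phi (g t)) by near: t; exact: c1 _ (Ad_mulmap h).
by rewrite phiK// e => /esym.
Unshelve. all: by end_near. Qed.

Lemma opg_morph (tau : G -> G) : {morph tau : x y / (x * y)%g} -> tau 1%g = 1%g ->
  smooth_map (@lie_chart R n G) (@lie_chart R n G) tau ->
  one_parameter_group (fun t => tau (g t)) (tangent1 tau h).
Proof.
move=> tM t1 ts; have [gc gM gd] := hg; split.
- by move=> t; exact: (cvg_comp _ _ (gc t) (ts.1 (g t))).
- by move=> s t; rewrite gM tM.
have d0 : differentiable (locmap tau) (phi (g 0)).
  rewrite (opg1 hg); apply: locmap_diff => //.
  by split; [exact: cod1_e|rewrite psi_e t1; exact: dom1_1].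
have := diff_curve d0 gd; rewrite (opg1 hg).
apply: near_eq_is_derive; near=> t.
rewrite /= /locmap phiK//; near: t; have := @gnear 1%g 0; rewrite mul1g (opg1 hg) => /(_ dom1_1).
by apply: filterS => s; rewrite mul1g.
Unshelve. all: by end_near. Qed.

End AlongCurve.

(** The exponential is taken in the complexification, where the image of h is a null vector of the
    exponent; real row vectors embed injectively, which brings the equality back. *)
Lemma tangent1_fix (tau : G -> G) h : smooth_map (@lie_chart R n G) (@lie_chart R n G) tau ->
  tau 1%g = 1%g -> integrates_tau_h h tau -> ad (G := G) h h = 0 -> tangent1 tau h = h.
Proof.
move=> ts t1 it ah.
pose a : {linear E -> E} := HB.pack (@ad R n G h) (GRing.isLinear.Build _ _ _ _ _ (@ad_linear h)).
pose T : {linear E -> E} := HB.pack (tangent1 tau) (GRing.isLinear.Build _ _ _ _ _ (tangent1_linear ts t1)).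
have hA : h *m ad_mx (G := G) h = 0.
  by rewrite -[ad_mx h]/(lin1_mx a) mul_rV_lin1.
rewrite -[LHS]/(T h) -(mul_rV_lin1 T).
have inj : injective (map_mx (real_complex R) : 'rV_n -> 'rV_n) by exact: map_mx_inj.
apply: inj; rewrite map_mxM /=.
set hC := map_mx _ h; move: it; rewrite /integrates_tau_h -[lin1_mx (tangent1 tau)]/(lin1_mx T).
set B := _ *: _; set C := map_mx _ (lin1_mx T) => BC.
have hB : hC *m B = 0 by rewrite /B -scalemxAr -map_mxM /= hA map_mx0 scaler0.
exact: mx_exp_ker BC hB.
Qed.

Lemma tau_lie_exp (tau : G -> G) h t : involutive_lie_automorphism tau ->
  integrates_tau_h h tau -> tau (lie_exp (t *: h)) = lie_exp (t *: h).
Proof.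
move=> [tM _ ts] it.
have t1 : tau 1%g = 1%g by apply: (mulgI (tau 1%g)); rewrite -tM !mulg1.
have [[g hg ->]|->] := @lie_exp_line R n G h; last exact: t1.
have hg' := opg_morph hg tM t1 ts.
rewrite (tangent1_fix ts t1 it (ad_opg hg)) in hg'.
by rewrite -[LHS]/((fun s => tau (g s)) t) (opg_uniq hg' hg).
Qed.

Lemma lie_exp_lineM (h : E) s t : lie_exp ((s + t) *: h) = (lie_exp (s *: h) * lie_exp (t *: h))%g :> G.
Proof.
have [[g [_ gM _] hg]|hg] := @lie_exp_line R n G h; rewrite !hg; first exact: gM.
by rewrite mulg1.
Qed.

Lemma lie_exp_line_continuous (h : E) : continuous (fun t : R => lie_exp (t *: h) : G).
Proof.
have [[g [gc _ _] hg]|hg] := @lie_exp_line R n G h.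
  by rewrite (_ : (fun t => _) = g)//; apply/funext.
by rewrite (_ : (fun t => _) = fun=> 1%g); [move=> t; exact: cvg_cst|apply/funext].
Qed.

End AdjointInvariance.

(** * The nets *)

Section CosetAction.
Local Open Scope quotient_scope.
Context {R : realType} {n : nat} {G : lieGroupType R n}.
Variable H : closed_subgroup G.
Notation M := (coset_space H).
Implicit Types (g k : G) (A B O : set M).

Lemma coset_piE (a b : G) : csub H (a^-1 * b)%g -> \pi_M a = \pi_M b.
Proof. by move=> h; apply/eqmodP/asboolP. Qed.

Lemma coset_repr (a : G) : csub H ((repr (\pi_M a))^-1 * a)%g.
Proof. by have /eqmodP/asboolP := reprK (\pi_M a). Qed.

Lemma coset_act_pi g (a : G) : coset_act g (\pi_M a) = \pi_M (g * a)%g.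
Proof.
apply: coset_piE; rewrite invgM -mulgA (mulgA g^-1)%g mulVg mul1g; exact: coset_repr.
Qed.

Lemma coset_act1 (m : M) : coset_act 1%g m = m.
Proof. by rewrite /coset_act mul1g reprK. Qed.

Lemma coset_actM g k (m : M) : coset_act (g * k)%g m = coset_act g (coset_act k m).
Proof. by rewrite [coset_act k m]/coset_act coset_act_pi mulgA. Qed.

Lemma coset_act_continuous g : continuous (@coset_act R n G H g).
Proof.
apply/quotient_continuous => a.
rewrite (_ : coset_act g \o _ = \pi_M \o (fun a => g * a)%g); last first.
  by apply/funext => b; exact: coset_act_pi.
apply: continuous_comp; last exact: pi_continuous.
by apply: mulg_cvg; [exact: cvg_cst|exact: cvg_id].
Qed.

Lemma translateE g A m : translate g A m <-> A (coset_act g^-1%g m).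
Proof.
split=> [[p Ap <-]|h]; first by rewrite -coset_actM mulVg coset_act1.
by exists (coset_act g^-1%g m) => //; rewrite -coset_actM mulgV coset_act1.
Qed.

Lemma translate1 A : translate 1%g A = A.
Proof. 
apply/seteqP; split=> m; first by move/translateE; rewrite invg1 coset_act1.
by move=> h; apply/translateE; rewrite invg1 coset_act1.
 Qed.

Lemma translateM g k A : translate (g * k)%g A = translate g (translate k A).
Proof.
apply/seteqP; split=> m.
  by move=> /translateE; rewrite invgM coset_actM => h; apply/translateE/translateE.
by move=> /translateE/translateE h; apply/translateE; rewrite invgM coset_actM.
Qed.

Lemma translateK g A : translate g^-1%g (translate g A) = A.
Proof. by rewrite -translateM mulVg translate1. Qed.

Lemma translateVK g A : translate g (translate g^-1%g A) = A.
Proof. by rewrite -translateM mulgV translate1. Qed.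

Lemma translateS g A B : A `<=` B -> translate g A `<=` translate g B.
Proof. exact: image_subset. Qed.

Lemma translate_open g A : open A -> open (translate g A).
Proof.
move=> oA; have -> : translate g A = coset_act g^-1%g @^-1` A.
  by apply/seteqP; split=> m /translateE.
by apply: open_comp => // m _; exact: coset_act_continuous.
Qed.

End CosetAction.

(** * The antiunitary representation and its standard subspace *)

Section Nets.
Context {R : realType} {n : nat} {G : lieGroupType R n} {X : hilbertType R}.
Implicit Types (x y v : X) (g k : G).
Variables (tau : G -> G) (U : G * bool -> X -> X).
Hypotheses (tauP : involutive_lie_automorphism tau) (UP : antiunitary_rep tau U).
Notation u g := (U (g%g, false)).
Notation J := (U (1%g, true)).

Lemma rep_rlin g : rlin (u g).
Proof.
have [_ _ _ /(_ g)[h _ _] _] := UP; split=> [x y|r x].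
  by have := h 1 x y; rewrite !scale1r.
by have := h r%:C x 0; rewrite !addr0 (_ : u g 0 = 0) ?addr0//;
  have := h 1 0 0; rewrite !scale1r addr0 => /eqP; rewrite -[X in X == _]addr0 (inj_eq (addrI _)) => /eqP.
Qed.

Lemma rep_ii g x : u g (ii x) = ii (u g x).
Proof.
have [_ _ _ /(_ g)[h _ _] _] := UP.
by have := h 'i x 0; rewrite addr0 (rlin0 (rep_rlin g)) addr0.
Qed.

Lemma rep_nm g x : nm (u g x) = nm x.
Proof. by have [_ _ _ /(_ g)[_ _ h] _] := UP; rewrite /nm /ip h. Qed.

Lemma repM g k x : u (g * k)%g x = u g (u k x).
Proof. by have [_ h _ _ _] := UP; rewrite -h. Qed.

Lemma rep1 x : u 1%g x = x.
Proof.
have [_ _ _ /(_ 1%g)[_ h _] _] := UP.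
by have [y <-] := h x; rewrite -repM mulg1.
Qed.

Lemma repK g x : u g^-1%g (u g x) = x.
Proof. by rewrite -repM mulVg rep1. Qed.

Lemma repVK g x : u g (u g^-1%g x) = x.
Proof. by rewrite -repM mulgV rep1. Qed.

Lemma rep_cvg g {T : Type} {F : set_system T} {FF : Filter F} (w : T -> X) x :
  w @ F --> x -> u g (w t) @[t --> F] --> u g x.
Proof. by apply: cvg_op; [exact: rep_rlin|exact: bnd_iso (rep_nm g)]. Qed.

Lemma tau1 : tau 1%g = 1%g.
Proof. by have [tM _ _] := tauP; apply: (mulgI (tau 1%g)); rewrite -tM !mulg1. Qed.

Lemma conj_rlin : rlin J.
Proof.
have [_ _ _ _ [h _ _]] := UP.
have J0 : J 0 = 0.
  by have := h 1 0 0; rewrite conjC1 !scale1r addr0 => /eqP; rewrite -[X in X == _]addr0 (inj_eq (addrI _)) => /eqP.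
split=> [x y|r x]; first by have := h 1 x y; rewrite conjC1 !scale1r.
have e := h r%:C x 0; rewrite addr0 J0 addr0 in e; rewrite [LHS]e; congr (_ *: _).
by apply/eqP; rewrite eq_complex /= oppr0 !eqxx.
Qed.

Lemma conj_ii x : J (ii x) = - ii (J x).
Proof.
have [_ _ _ _ [h _ _]] := UP.
by have := h 'i x 0; rewrite addr0 (rlin0 conj_rlin) addr0 conjCi scaleNr.
Qed.

Lemma conj_nm x : nm (J x) = nm x.
Proof. by have [_ _ _ _ [_ _ h]] := UP; rewrite /nm /ip h; case: (hdot x x). Qed.

Lemma conjK : involutive J.
Proof.
move=> x; have [_ h _ _ _] := UP.
by rewrite -h /semidirect_mul /= tau1 mulg1; exact: rep1.
Qed.

Lemma conj_rep g x : J (u g x) = u (tau g) (J x).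
Proof. by have [_ h _ _ _] := UP; rewrite -!h /semidirect_mul /= mul1g mulg1. Qed.

Section Modular.
Variable h : 'rV[R]_n.
Hypothesis it : integrates_tau_h h tau.
Notation gam := (fun t : R => lie_exp (t *: h) : G).
Notation V := (std_subspace U h).

Lemma rep_ugroup : ugroup (fun t => u (gam t)).
Proof.
split.
- by move=> t; exact: rep_rlin.
- by move=> t x; exact: rep_nm.
- by move=> s t x; rewrite lie_exp_lineM repM.
- move=> x t; have [_ _ Uc _ _] := UP.
  have c : (lie_exp (s *: h) : G, false) @[s --> t] --> (lie_exp (t *: h) : G, false).
    exact: (cvg_pair (@lie_exp_line_continuous R n G h t) (cvg_cst false)).
  exact: (cvg_comp _ _ c (Uc x _)).
Qed.

(** A single spectral measure of i dU(h) replaces the two existential choices hidden in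
    [sqrt_modular_op]. *)
Lemma std_subspaceP : exists E : pvm X,
  (forall x y, sagen (fun t => u (gam t)) x y <-> pvm_int E idR x y) /\ V = stdV E J.
Proof.
have [E EA] := spectral_exists rep_ugroup (fun t x => rep_ii (gam t) x).
exists E; split => //.
have h1 x y : scale_op 'i (dU U h) x y <-> pvm_int E idR x y by exact: EA.
have h2 x y : sqrt_modular_op U h x y <-> pvm_int E halfmod x y by exact: sqrt_exp_calcP.
apply/seteqP; split=> [x [w /h2 xw wx]|x xV].
  by rewrite /stdV /= -{2}wx conjK.
by exists (J x); [exact/h2|exact: conjK].
Qed.

Let Ju t x : J (u (gam t) x) = u (gam t) (J x).
Proof. by rewrite conj_rep (tau_lie_exp t tauP it). Qed.

Lemma std_subspace_standard : standard V.
Proof.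
have [E [EA ->]] := std_subspaceP.
exact: (stdV_standard EA conj_rlin conj_nm conjK conj_ii Ju).
Qed.

Lemma std_subspace_cyclic (K : set X) : closed K -> real_subspace K ->
  (forall t x, K x -> K (u (gam t) x)) -> K `<=` V -> cyclic K -> K = V.
Proof.
have [E [EA ->]] := std_subspaceP => cK sK Ku KV.
exact: (cyclic_sub_stdV rep_ugroup (fun t x => rep_ii (gam t) x) EA conj_rlin conj_nm conjK conj_ii Ju cK sK Ku KV).
Qed.

Lemma std_subspace_separating (K : set X) : closed K -> real_subspace K ->
  (forall t x, K x -> K (u (gam t) x)) -> V `<=` K -> separating K -> K = V.
Proof.
have [E [EA ->]] := std_subspaceP => cK sK Ku KV.
exact: (separating_sup_stdV rep_ugroup (fun t x => rep_ii (gam t) x) EA conj_rlin conj_nm conjK conj_ii Ju cK sK Ku KV).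
Qed.

End Modular.

End Nets.

(** * The maximal and minimal nets *)

Section MaxMinNets.
Context {R : realType} {n : nat} {G : lieGroupType R n} {X : hilbertType R}.
Implicit Types (x y v : X) (g k : G).
Variables (tau : G -> G) (U : G * bool -> X -> X).
Hypothesis UP : antiunitary_rep tau U.
Notation u g := (U (g%g, false)).
Variable H : closed_subgroup G.
Notation M := (coset_space H).
Variables (V : set X) (W : set M).
Implicit Types (N : set X) (O : set M).

Lemma rep_imageP g N x : (u g @` N) x <-> N (u g^-1 x).
Proof.
split=> [[y Ny <-]|h]; first by rewrite (repK UP).
by exists (u g^-1 x) => //; rewrite (repVK UP).
Qed.

Lemma rep_image_closed g N : closed N -> closed (u g @` N).
Proof.
move=> cN; apply: closed_seq => w x Nw wx; apply/rep_imageP.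
apply: (@closed_lim _ _ _ (fun i => u g^-1 (w i)) _ cN); first by move=> i; apply/rep_imageP.
exact: (rep_cvg UP).
Qed.

Lemma rep_image_subspace g N : real_subspace N -> real_subspace (u g @` N).
Proof.
move=> sN; have [N0 ND NZ] := sN; split.
- by apply/rep_imageP; rewrite (rlin0 (rep_rlin UP _)).
- by move=> x y /rep_imageP hx /rep_imageP hy; apply/rep_imageP; rewrite (rlinD (rep_rlin UP _)); exact: ND.
- move=> r x /rep_imageP hx; apply/rep_imageP.
  by rewrite -[_ *: _]/(rs r x) (rlinZ (rep_rlin UP _)); exact: NZ.
Qed.

Lemma rep_image_cyclic g N : cyclic N -> cyclic (u g @` N).
Proof.
move=> /dense_nmP h; apply/dense_nmP => x e e0.
have [_ [a Na [b Nb <-]] ab] := h (u g^-1 x) e e0.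
exists (u g a + 'i *: u g b); first by exists (u g a); [exists a|exists (u g b); [exists b|]].
rewrite -[_ *: u g b]/(ii _) -(rep_ii UP) -(rlinD (rep_rlin UP g)) -{1}(repVK UP g x).
by rewrite -(rlinB (rep_rlin UP g)) (rep_nm UP).
Qed.

(** The reverse inclusion is the same one for g^-1 at the translated set. *)
Lemma rep_covariant (N : set M -> set X) :
  (forall g O, open O -> u g @` N O `<=` N (translate g O)) -> covariant U N.
Proof.
move=> h g O oO; apply/seteqP; split; first exact: h.
move=> x hx; apply/rep_imageP; rewrite -(translateK g O).
by apply: h; [exact: translate_open|exists x].
Qed.

Lemma subspace_sum_subspace (I : Type) (P : set I) (F : I -> set X) :
  (forall i, P i -> real_subspace (F i)) -> real_subspace (subspace_sum P F).
Proof.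
move=> sF; split.
- by exists [::]; [|rewrite big_nil].
- move=> _ _ [s hs <-] [t ht <-]; exists (s ++ t); last by rewrite big_cat.
  by move=> x; rewrite mem_cat => /orP[/hs|/ht].
- move=> r _ [s hs <-]; exists [seq r%:C *: x | x <- s]; last by rewrite big_map scaler_sumr.
  move=> _ /mapP[x /hs[i Pi Fx] ->]; exists i => //.
  by have [_ _] := sF i Pi; exact.
Qed.

Lemma subspace_sum_sub (I : Type) (P : set I) (F : I -> set X) N : real_subspace N ->
  (forall i, P i -> F i `<=` N) -> subspace_sum P F `<=` N.
Proof.
move=> [N0 ND _] h _ [s hs <-]; rewrite big_seq; elim/big_ind: _ => // x /hs[i Pi].
exact: h.
Qed.

Lemma sub_subspace_sum (I : Type) (P : set I) (F : I -> set X) i : P i ->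
  F i `<=` subspace_sum P F.
Proof.
move=> Pi x Fx; exists [:: x]; last by rewrite big_seq1.
by move=> y; rewrite inE => /eqP ->; exists i.
Qed.

Lemma closure_subspace N : real_subspace N -> real_subspace (closure N).
Proof.
have seqP x : closure N x -> exists2 w : nat -> X, (forall i, N (w i)) & w @ \oo --> x.
  move=> cx.
  have P i : exists y, N y /\ nm (y - x) < i.+1%:R^-1.
    have e0 : 0 < (i.+1%:R^-1 : R)%:C by rewrite ltcR invr_gt0.
    have [y [Ny]] := cx _ (nbhsx_ballx x _ e0).
    by rewrite -ball_normE /= normE ltcR nmB; exists y.
  have [w hw] := choice P; exists w; first by move=> i; have [] := hw i.
  apply/cvg_nmP => e e0; near=> i; apply: (lt_trans (hw i).2).
  near: i; exact: near_infty_natSinv_lt (PosNum e0).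
have lim x (w : nat -> X) : (forall i, N (w i)) -> w @ \oo --> x -> closure N x.
  move=> hw wx; have cl : closed (closure N) by exact: closed_closure.
  apply: (@closed_lim _ _ _ w x cl) => [i|]; [exact: subset_closure|exact: wx].
move=> [N0 ND NZ]; split; first exact: subset_closure.
- move=> x y /seqP[w hw wx] /seqP[w' hw' wy].
  by apply: (@lim _ (fun i => w i + w' i)); [move=> i; exact: ND|exact: cvgD].
- move=> r x /seqP[w hw wx].
  apply: (@lim _ (fun i => rs r (w i))); [by move=> i; exact: NZ|exact: cvg_rs].
Unshelve. all: by end_near. Qed.

Lemma Hmax_isotone : isotone (Hmax U V W).
Proof. by move=> O1 O2 _ _ O12 x hx g /= O2g; apply: hx; exact: subset_trans O2g. Qed.

Lemma Hmax_covariant : covariant U (Hmax U V W).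
Proof.
apply: rep_covariant => g O _ x /rep_imageP hx k /= Ok.
have h : O `<=` translate (g^-1 * k)%g W.
  by rewrite translateM -(translateK g O); exact: translateS.
by have /rep_imageP := hx _ h; rewrite invgM invgK (repM UP) (repVK UP) => ?; apply/rep_imageP.
Qed.

Lemma Hmax_closed O : closed V -> closed (Hmax U V W O).
Proof. by move=> cV; apply: closed_bigI => g _; exact: rep_image_closed. Qed.

Lemma Hmax_subspace O : real_subspace V -> real_subspace (Hmax U V W O).
Proof.
move=> sV; split.
- by move=> g _; have [] := rep_image_subspace g sV.
- by move=> x y hx hy g Og; have [_ h _] := rep_image_subspace g sV; apply: h; [exact: hx|exact: hy].
- by move=> r x hx g Og; have [_ _ h] := rep_image_subspace g sV; apply: h; exact: hx.
Qed.

Lemma Hmin_isotone : isotone (Hmin U V W).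
Proof.
move=> O1 O2 _ _ O12; apply: closure_subset => _ [s hs <-]; exists s => // x /hs[g gO Fx].
by exists g => //; exact: subset_trans gO _.
Qed.

Lemma Hmin_covariant : covariant U (Hmin U V W).
Proof.
apply: rep_covariant => g O _ _ [x hx <-] B /= Bx.
have c : u g y @[y --> x] --> u g x by apply: (rep_cvg UP); exact: cvg_id.
have [y [[s hs sy] By]] := hx _ (c _ Bx).
exists (u g y); split => //; exists [seq u g z | z <- s]; last first.
  rewrite -sy big_map; elim: (s) => [|a t IH]; first by rewrite !big_nil (rlin0 (rep_rlin UP g)).
  by rewrite !big_cons (rlinD (rep_rlin UP g)) IH.
move=> _ /mapP[z /hs[k kO /rep_imageP Vz] ->]; exists (g * k)%g.
  by rewrite /= translateM; exact: translateS.
by apply/rep_imageP; rewrite invgM (repM UP) (repK UP).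
Qed.

Lemma Hmin_closed O : closed (Hmin U V W O).
Proof. exact: closed_closure. Qed.

Lemma Hmin_subspace O : real_subspace V -> real_subspace (Hmin U V W O).
Proof.
move=> sV; apply: closure_subspace; apply: subspace_sum_subspace => g _.
exact: rep_image_subspace.
Qed.

Lemma Hmax_sub : Hmax U V W W `<=` V.
Proof.
move=> x hx; have /rep_imageP : (u 1 @` V) x by apply: hx; rewrite /= translate1.
by rewrite invg1 (rep1 UP).
Qed.

Lemma Hmin_sup : V `<=` Hmin U V W W.
Proof.
move=> x Vx; apply: subset_closure; apply: (@sub_subspace_sum _ _ _ 1%g).
  by rewrite /= translate1.
by exists x => //; rewrite (rep1 UP).
Qed.

(** W is contained in g W exactly when g^-1 is in S_W, so Hmax(W) is the intersection of the U(g)^-1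
    V with g in S_W. *)
Lemma Hmax_eqP : S_W W `<=` S_V U V <-> Hmax U V W W = V.
Proof.
split=> [h|h g gW].
  apply/seteqP; split; first exact: Hmax_sub.
  move=> v Vv g Wg; apply/rep_imageP; apply: (h g^-1%g); last by exists v.
  by rewrite /S_W /= -[X in _ `<=` X](translateK g); exact: translateS.
move=> _ [v Vv <-]; rewrite -h in Vv.
have /rep_imageP : (u g^-1 @` V) v.
  by apply: Vv; rewrite /= -[X in X `<=` _](translateK g); exact: translateS.
by rewrite invgK.
Qed.

Lemma Hmin_eqP : closed V -> real_subspace V -> S_W W `<=` S_V U V <-> Hmin U V W W = V.
Proof.
move=> cV sV; split=> [h|h g gW].
  apply/seteqP; split; last exact: Hmin_sup.
  rewrite [X in _ `<=` X](closure_id V).1//; apply: closure_subset.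
  by apply: subspace_sum_sub => // g gW; exact: h.
rewrite /S_V /= -[X in _ `<=` X]h; apply: subset_trans (@subset_closure _ _).
exact: (@sub_subspace_sum _ [set g | translate g W `<=` W] (fun g => u g @` V)).
Qed.

End MaxMinNets.

Theorem lemma5p2 (R : realType) (n : nat) (G : lieGroupType R n)
    (h : 'rV[R]_n) (tau : G -> G) (H : closed_subgroup G)
    (W : set (coset_space H)) (X : hilbertType R) (U : G * bool -> X -> X) :
  connected [set: G] ->
  euler_element (G := G) h ->
  involutive_lie_automorphism tau ->
  integrates_tau_h h tau ->
  open W -> W !=set0 ->
  (forall t : R, translate (lie_exp (t *: h)) W `<=` W) ->
  antiunitary_rep tau U ->
  let V := std_subspace U h in
  let HMmax := Hmax U V W in
  let HMmin := Hmin U V W in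
  [/\ (* (a) *)
      [/\ isotone HMmax, covariant U HMmax, isotone HMmin & covariant U HMmin],
      (* (b) *)
      (let C := [set O : set (coset_space H) | open O /\ cyclic (HMmax O)] in
       forall g : G, translate g @` C = C) &
      (* (c) *)
      [<-> S_W W `<=` S_V U V;
           HMmax W = V;
           standard (HMmax W);
           cyclic (HMmax W);
           HMmin W = V;
           standard (HMmin W);
           separating (HMmin W)]].
Proof.
move=> _ _ tauP it oW _ hW UP V HMmax HMmin.
have sV : standard V by exact: (std_subspace_standard tauP UP it).
have [cV rV _ _] := sV.
have covmax : covariant U HMmax by exact: (Hmax_covariant UP).
have covmin : covariant U HMmin by exact: (Hmin_covariant UP).
(* The hypothesis gives one inclusion for every t; the other is its translate for - t. *)
have gamW t : translate (lie_exp (t *: h)) W = W.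
  apply/seteqP; split; first exact: hW.
  have := translateS (g := lie_exp (t *: h)) (hW (- t)).
  by rewrite -translateM -lie_exp_lineM subrr (lie_expE (g := fun=> 1%g) _) ?translate1// scale0r; exact: opg_one.
have invariant (N : set (coset_space H) -> set X) : covariant U N ->
    forall t x, N W x -> N W (U (lie_exp (t *: h), false) x).
  by move=> covN t x Nx; rewrite -(gamW t) -covN//; exists x.
split.
- by split => //; [exact: Hmax_isotone|exact: Hmin_isotone].
- move=> C g.
  have CC k O : C O -> C (translate k O).
    move=> [oO cO]; split; first exact: translate_open.
    by rewrite -covmax//; exact: (rep_image_cyclic UP).
  apply/seteqP; split=> [_ [A CA <-]|A CA]; first exact: CC.
  by exists (translate g^-1%g A); [exact: CC|exact: translateVK].
- tfae.
  + by move/(Hmax_eqP UP).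
  + by move=> ->.
  + by move=> [].
  (* The cycle changes nets here: a cyclic Hmax(W) equals V, which means that S_W is contained in
     S_V, which in turn gives Hmin(W) = V. *)
  + move=> cyc; apply/(Hmin_eqP UP) => //; apply/(Hmax_eqP UP).
    apply: (std_subspace_cyclic tauP UP it) => //.
    * exact: (Hmax_closed UP).
    * exact: (Hmax_subspace UP).
    * exact: invariant.
    * exact: (Hmax_sub UP).
  + by move=> ->.
  + by move=> [].
  + move=> sep; apply/(Hmin_eqP UP) => //.
    apply: (std_subspace_separating tauP UP it) => //.
    * exact: Hmin_closed.
    * exact: (Hmin_subspace UP).
    * exact: invariant.
    * exact: (Hmin_sup UP).
Qed.
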